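(* Let $\gamma_1,\gamma_2,\nu_1,\nu_2,\lambda,\mu,\beta_1,\beta_2$ be smooth functions, defined in a domain $\mathcal D\subset\mathbb R^2$ (with coordinates $(u,v)$), and satisfying the conditions $$\frac{\mu_u}{2\mu\gamma_2+\nu_1\beta_2-\lambda\beta_1}>0,\qquad \frac{\mu_v}{2\mu\gamma_1-\lambda\beta_2+\nu_2\beta_1}>0,$$ $$-\gamma_1\sqrt E\sqrt G=(\sqrt E)_v,\qquad -\gamma_2\sqrt E\sqrt G=(\sqrt G)_u,$$ $$\nu_1\nu_2-\lambda^2+\mu^2=\frac1{\sqrt E}(\gamma_2)_u+\frac1{\sqrt G}(\gamma_1)_v-\left((\gamma_1)^2+(\gamma_2)^2\right),$$ $$2\lambda\gamma_2-\mu\beta_1-(\nu_1-\nu_2)\gamma_1=\frac1{\sqrt E}\lambda_u-\frac1{\sqrt G}(\nu_1)_v,$$ $$2\lambda\gamma_1-\mu\beta_2+(\nu_1-\nu_2)\gamma_2=-\frac1{\sqrt E}(\nu_2)_u+\frac1{\sqrt G}\lambda_v,$$ $$\gamma_1\beta_1-\gamma_2\beta_2+(\nu_1-\nu_2)\mu=-\frac1{\sqrt E}(\beta_2)_u+\frac1{\sqrt G}(\beta_1)_v,$$ where $$\sqrt E=\frac{\mu_u}{2\mu\gamma_2+\nu_1\beta_2-\lambda\beta_1},\qquad \sqrt G=\frac{\mu_v}{2\mu\gamma_1-\lambda\beta_2+\nu_2\beta_1}.$$ Let $\{x_0,y_0,b_0,l_0\}$ be an orthonormal frame at a point $p_0\in\mathbb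 R^4_1$. Then there exist a subdomain $\mathcal D_0\subset\mathcal D$ and a unique spacelike surface $M^2: z=z(u,v)$, $(u,v)\in\mathcal D_0$, whose mean curvature vector at any point is a non-zero spacelike vector. Moreover, $M^2$ passes through $p_0$, the functions $\gamma_1,\gamma_2,\nu_1,\nu_2,\lambda,\mu,\beta_1,\beta_2$ are the geometric functions of $M^2$, and $\{x_0,y_0,b_0,l_0\}$ is the geometric frame of $M^2$ at the point $p_0$.
   Context: $\mathbb R^4_1$ is the four-dimensional Minkowski space with metric $\langle\,,\rangle$ of signature $(3,1)$, with a fixed orthonormal basis $e_1,e_2,e_3,e_4$, $e_1^2=e_2^2=e_3^2=1$, $e_4^2=-1$, giving the orientation, and standard flat connection $\nabla'$. In an orthonormal frame $\{x,y,b,l\}$ the vectors $x,y,b$ have square $1$ and $\langle l,l\rangle=-1$. A surface $z=z(u,v)$ is spacelike if the induced metric is Riemannian; for a surface, $E=\langle z_u,z_u\rangle$, $F=\langle z_u,z_v\rangle$, $G=\langle z_v,z_v\rangle$. $\sigma$ denotes the (normal-bundle-valued) second fundamental tensor and $H=\frac12(\sigma(x,x)+\sigma(y,y))$, for an orthonormal tangent frame $\{x,y\}$, the mean curvature vector. Principal parameters: the surface is parameterized by principal lines if $F=0$ and $M=0$, where $M=\frac{1}{\sqrt{EG-F^2}}\left(c_{11}^1c_{22}^2-c_{11}^2c_{22}^1\right)$, $c_{11}^k=\langle z_{uu},n_k\rangle$, $c_{22}^k=\langle z_{vv},n_k\rangle$, for a normal frame field $\{n_1,n_2\}$ with $\langle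 n_1,n_1\rangle=1$, $\langle n_2,n_2\rangle=-1$, $\langle n_1,n_2\rangle=0$, such that $\{z_u,z_v,n_1,n_2\}$ is positively oriented; thus $M=0$ means that $\sigma(z_u,z_u)$ and $\sigma(z_v,z_v)$ are collinear. Geometric frame and geometric functions (for a spacelike surface with $\langle H,H\rangle>0$ everywhere, parameterized by principal lines $(u,v)$): $x=z_u/\sqrt E$, $y=z_v/\sqrt G$, $b=H/\sqrt{\langle H,H\rangle}$ (so $\langle b,b\rangle=1$ and $b$ is collinear with $\sigma(x,x)$ and $\sigma(y,y)$), and $l$ is the unit normal field, $\langle l,l\rangle=-1$, such that $\{x,y,b,l\}$ is a positively oriented orthonormal frame. The geometric functions are $$\nu_1=\langle\sigma(x,x),b\rangle,\ \nu_2=\langle\sigma(y,y),b\rangle,\ \lambda=\langle\sigma(x,y),b\rangle,\ \mu=\langle\sigma(x,y),l\rangle,$$ $$\gamma_1=-y(\ln\sqrt E),\ \gamma_2=-x(\ln\sqrt G),\ \beta_1=\langle\nabla'_xb,l\rangle,\ \beta_2=\langle\nabla'_yb,l\rangle,$$ so that $\sigma(x,x)=\nu_1b$, $\sigma(x,y)=\lambda b-\mu l$, $\sigma(y,y)=\nu_2b$ and $H=\frac{\nu_1+\nu_2}2\,b$.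
   Formalization: The formal statement prescribes the frame at a parameter point (u0,v0) where ν1+ν2>0 (forced by b=H/√⟨H,H⟩) and takes {x0,y0,b0,l0} positively oriented (forced for a geometric frame); without these the claim is false. *)

(* Defs.v *)
From Stdlib Require Import Reals.
From Coquelicot Require Import Coquelicot.
Open Scope R_scope.

(** * Minkowski space R^4_1, in coordinates with respect to e1, e2, e3, e4 *)

Definition R4 : Type := (R * R * R * R)%type.

Definition mink (p q : R4) : R :=
  let '(p1, p2, p3, p4) := p in
  let '(q1, q2, q3, q4) := q in
  p1 * q1 + p2 * q2 + p3 * q3 - p4 * q4.

Definition det3 (a1 a2 a3 b1 b2 b3 c1 c2 c3 : R) : R :=
  a1 * (b2 * c3 - b3 * c2) - a2 * (b1 * c3 - b3 * c1) + a3 * (b1 * c2 - b2 * c1).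

Definition det4 (a b c d : R4) : R :=
  let '(a1, a2, a3, a4) := a in
  let '(b1, b2, b3, b4) := b in
  let '(c1, c2, c3, c4) := c in
  let '(d1, d2, d3, d4) := d in
  a1 * det3 b2 b3 b4 c2 c3 c4 d2 d3 d4
  - a2 * det3 b1 b3 b4 c1 c3 c4 d1 d3 d4
  + a3 * det3 b1 b2 b4 c1 c2 c4 d1 d2 d4
  - a4 * det3 b1 b2 b3 c1 c2 c3 d1 d2 d3.

Definition positively_oriented (a b c d : R4) : Prop := 0 < det4 a b c d.

Definition oriented_orthonormal (x y b l : R4) : Prop :=
  mink x x = 1 /\ mink y y = 1 /\ mink b b = 1 /\ mink l l = -1 /\
  mink x y = 0 /\ mink x b = 0 /\ mink x l = 0 /\
  mink y b = 0 /\ mink y l = 0 /\ mink b l = 0 /\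
  positively_oriented x y b l.

(** * Domains and smooth functions of (u, v) *)

Definition plane_connected (D : R * R -> Prop) : Prop :=
  forall U V : R * R -> Prop,
    open U -> open V ->
    (forall p, D p -> U p \/ V p) ->
    (exists p, D p /\ U p) -> (exists p, D p /\ V p) ->
    exists p, D p /\ U p /\ V p.

Definition plane_domain (D : R * R -> Prop) : Prop :=
  (exists p, D p) /\ open D /\ plane_connected D.

(** On an open set, [ex_diff_n f n] at every point says that [f] is C^n. *)
Definition smooth_on (D : R * R -> Prop) (f : R -> R -> R) : Prop :=
  forall (n : nat) (u v : R), D (u, v) -> ex_diff_n f n u v.

Definition du (f : R -> R -> R) (u v : R) : R := Derive (fun s => f s v) u.
Definition dv (f : R -> R -> R) (u v : R) : R := Derive (fun t => f u t) v.

(** * Vector-valued functions of (u, v) *)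

Definition pr1 (p : R4) : R := fst (fst (fst p)).
Definition pr2 (p : R4) : R := snd (fst (fst p)).
Definition pr3 (p : R4) : R := snd (fst p).
Definition pr4 (p : R4) : R := snd p.

Definition smooth4_on (D : R * R -> Prop) (W : R -> R -> R4) : Prop :=
  smooth_on D (fun u v => pr1 (W u v)) /\
  smooth_on D (fun u v => pr2 (W u v)) /\
  smooth_on D (fun u v => pr3 (W u v)) /\
  smooth_on D (fun u v => pr4 (W u v)).

Definition du4 (W : R -> R -> R4) (u v : R) : R4 :=
  (du (fun s t => pr1 (W s t)) u v, du (fun s t => pr2 (W s t)) u v,
   du (fun s t => pr3 (W s t)) u v, du (fun s t => pr4 (W s t)) u v).
Definition dv4 (W : R -> R -> R4) (u v : R) : R4 :=
  (dv (fun s t => pr1 (W s t)) u v, dv (fun s t => pr2 (W s t)) u v,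
   dv (fun s t => pr3 (W s t)) u v, dv (fun s t => pr4 (W s t)) u v).

Definition vadd (p q : R4) : R4 :=
  (pr1 p + pr1 q, pr2 p + pr2 q, pr3 p + pr3 q, pr4 p + pr4 q).
Definition vscal (k : R) (p : R4) : R4 :=
  (k * pr1 p, k * pr2 p, k * pr3 p, k * pr4 p).

(** * Parametrized surfaces z : (u, v) |-> R^4_1 *)

Definition fE (z : R -> R -> R4) (u v : R) : R := mink (du4 z u v) (du4 z u v).
Definition fF (z : R -> R -> R4) (u v : R) : R := mink (du4 z u v) (dv4 z u v).
Definition fG (z : R -> R -> R4) (u v : R) : R := mink (dv4 z u v) (dv4 z u v).

Definition spacelike (D : R * R -> Prop) (z : R -> R -> R4) : Prop :=
  forall u v, D (u, v) ->
  forall a c : R, (a, c) <> (0, 0) ->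
    let t := vadd (vscal a (du4 z u v)) (vscal c (dv4 z u v)) in
    0 < mink t t.

(** Component of [w] orthogonal to the tangent plane spanned by [z_u], [z_v];
    the tangential component is found by inverting the Gram matrix. *)
Definition normal_part (z : R -> R -> R4) (u v : R) (w : R4) : R4 :=
  let E := fE z u v in
  let F := fF z u v in
  let G := fG z u v in
  let wu := mink w (du4 z u v) in
  let wv := mink w (dv4 z u v) in
  vadd w
    (vadd (vscal (- ((G * wu - F * wv) / (E * G - F ^ 2))) (du4 z u v))
          (vscal (- ((E * wv - F * wu) / (E * G - F ^ 2))) (dv4 z u v))).

(** A tangent vector field is given by its components [X] in the coordinate
    basis [z_u], [z_v]; [push z X] is the field itself. *)
Definition push (z : R -> R -> R4) (X : R -> R -> R * R) (u v : R) : R4 :=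
  vadd (vscal (fst (X u v)) (du4 z u v)) (vscal (snd (X u v)) (dv4 z u v)).

Definition dir (X : R -> R -> R * R) (f : R -> R -> R) (u v : R) : R :=
  fst (X u v) * du f u v + snd (X u v) * dv f u v.

(** The flat connection of R^4_1 along the surface. *)
Definition nabla' (X : R -> R -> R * R) (W : R -> R -> R4) (u v : R) : R4 :=
  vadd (vscal (fst (X u v)) (du4 W u v)) (vscal (snd (X u v)) (dv4 W u v)).

Definition sigma (z : R -> R -> R4) (X Y : R -> R -> R * R) (u v : R) : R4 :=
  normal_part z u v (nabla' X (push z Y) u v).

(** Mean curvature vector computed from an orthonormal tangent frame. *)
Definition mean_curvature (z : R -> R -> R4) (X Y : R -> R -> R * R)
    (u v : R) : R4 :=
  vscal (1 / 2) (vadd (sigma z X X u v) (sigma z Y Y u v)).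

(** * Principal parameters *)

Definition fM (z : R -> R -> R4) (n1 n2 : R4) (u v : R) : R :=
  let zuu := du4 (du4 z) u v in
  let zvv := dv4 (dv4 z) u v in
  1 / sqrt (fE z u v * fG z u v - fF z u v ^ 2) *
  (mink zuu n1 * mink zvv n2 - mink zuu n2 * mink zvv n1).

Definition normal_frame (z : R -> R -> R4) (u v : R) (n1 n2 : R4) : Prop :=
  mink (du4 z u v) n1 = 0 /\ mink (dv4 z u v) n1 = 0 /\
  mink (du4 z u v) n2 = 0 /\ mink (dv4 z u v) n2 = 0 /\
  mink n1 n1 = 1 /\ mink n2 n2 = -1 /\ mink n1 n2 = 0 /\
  positively_oriented (du4 z u v) (dv4 z u v) n1 n2.

(** [fM] is algebraic in the normal frame and does not depend on its choice, so
    no regularity of a frame field is involved. *)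
Definition principal (D : R * R -> Prop) (z : R -> R -> R4) : Prop :=
  forall u v, D (u, v) ->
    fF z u v = 0 /\
    forall n1 n2 : R4, normal_frame z u v n1 n2 -> fM z n1 n2 u v = 0.

(** * Geometric frame and geometric functions

    The tangent part x = z_u / sqrt E, y = z_v / sqrt G is orthonormal only
    when F = 0, hence the definitions below are meant for principal
    parameters. *)

Definition xdir (z : R -> R -> R4) (u v : R) : R * R := (1 / sqrt (fE z u v), 0).
Definition ydir (z : R -> R -> R4) (u v : R) : R * R := (0, 1 / sqrt (fG z u v)).

Definition frame_x (z : R -> R -> R4) : R -> R -> R4 := push z (xdir z).
Definition frame_y (z : R -> R -> R4) : R -> R -> R4 := push z (ydir z).

Definition Hvec (z : R -> R -> R4) : R -> R -> R4 :=
  mean_curvature z (xdir z) (ydir z).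

Definition frame_b (z : R -> R -> R4) (u v : R) : R4 :=
  vscal (1 / sqrt (mink (Hvec z u v) (Hvec z u v))) (Hvec z u v).

Definition geometric_frame (z : R -> R -> R4) (u v : R) (x y b l : R4) : Prop :=
  x = frame_x z u v /\ y = frame_y z u v /\ b = frame_b z u v /\
  oriented_orthonormal x y b l.

Definition geometric_functions (D : R * R -> Prop) (z : R -> R -> R4)
    (gamma1 gamma2 nu1 nu2 lambda mu beta1 beta2 : R -> R -> R) : Prop :=
  exists l : R -> R -> R4,
  forall u v, D (u, v) ->
    let b := frame_b z in
    geometric_frame z u v (frame_x z u v) (frame_y z u v) (b u v) (l u v) /\
    nu1 u v = mink (sigma z (xdir z) (xdir z) u v) (b u v) /\
    nu2 u v = mink (sigma z (ydir z) (ydir z) u v) (b u v) /\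
    lambda u v = mink (sigma z (xdir z) (ydir z) u v) (b u v) /\
    mu u v = mink (sigma z (xdir z) (ydir z) u v) (l u v) /\
    gamma1 u v = - dir (ydir z) (fun s t => ln (sqrt (fE z s t))) u v /\
    gamma2 u v = - dir (xdir z) (fun s t => ln (sqrt (fG z s t))) u v /\
    beta1 u v = mink (nabla' (xdir z) b u v) (l u v) /\
    beta2 u v = mink (nabla' (ydir z) b u v) (l u v).

Definition surface_with_data (D : R * R -> Prop) (u0 v0 : R)
    (p0 x0 y0 b0 l0 : R4)
    (gamma1 gamma2 nu1 nu2 lambda mu beta1 beta2 : R -> R -> R)
    (z : R -> R -> R4) : Prop :=
  smooth4_on D z /\
  spacelike D z /\
  principal D z /\
  (forall u v, D (u, v) -> 0 < mink (Hvec z u v) (Hvec z u v)) /\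
  z u0 v0 = p0 /\
  geometric_functions D z gamma1 gamma2 nu1 nu2 lambda mu beta1 beta2 /\
  geometric_frame z u0 v0 x0 y0 b0 l0.

(* Main.v *)
Require Import Defs.
From Stdlib Require Import Reals Lra Lia Ranalysis5 ClassicalEpsilon.
From Coquelicot Require Import Coquelicot.
Open Scope R_scope.

(** A surface whose parameters are principal and whose mean curvature vector is
    spacelike carries the frame x, y, b, l, and the geometric functions are the
    coefficients of the derivatives of this frame: with P = sqrt E, Q = sqrt G,

      x_u = P (gamma1 y + nu1 b),               x_v = Q (- gamma2 y + lambda b - mu l),
      y_u = P (- gamma1 x + lambda b - mu l),   y_v = Q (gamma2 x + nu2 b),
      b_u = P (- nu1 x - lambda y - beta1 l),   b_v = Q (- lambda x - nu2 y - beta2 l),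
      l_u = P (- mu y - beta1 b),               l_v = Q (- mu x - beta2 b),

    together with z_u = P x and z_v = Q y.  The proof goes through this linear
    system, called [adapted_frame] below.

    Existence.  The equality of the mixed derivatives of z, x, y, b, l is exactly
    the list of the structure equations: the two equations for the derivatives of
    P and Q, those of Gauss, Codazzi (two) and Ricci, and the two for mu_u and
    mu_v, which are the definitions of rE and rG ([frame_matrix_compat]).  A linear
    system X_u = A X, X_v = B X with this compatibility has a solution near every
    point ([total_system_local_solution], by Picard iteration in two variables).
    The coefficient matrices lie in the Lie algebra of the Lorentz group, so the
    frame, orthonormal at one point, is orthonormal everywhere: the quantity
    [pairing] is conserved.  Finally the geometry of z is read off from the frame
    ([frame_surface_with_data]); the sign of nu1 + nu2 makes b the direction of
    the mean curvature vector and not its opposite, which is one of the reasons for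
    passing to a small square.

    Uniqueness.  Any surface with the given geometric functions has an adapted
    frame, first with its own P and Q ([surface_adapted_frame_sqrt]).  The
    component along l of x_uv = x_vu and of y_uv = y_vu then expresses mu_u and
    mu_v through P and Q ([surface_mu]), which forces P = rE and Q = rG.  So two
    such surfaces have frames that solve the same system with the same initial
    value, and the pairing of one frame with the other, again conserved, shows that
    the frames, hence the surfaces, agree ([adapted_frame_rigid]). *)

(** * Smooth functions on an open set of the plane *)

(** The C^n classes, kept apart from [smooth_on] because closure under products,
    inverses and differential equations is proved by induction on n. *)
Definition class_on (D : R * R -> Prop) (n : nat) (f : R -> R -> R) : Prop :=
  forall u v, D (u, v) -> ex_diff_n f n u v.

Lemma open_locally_2d (D : R * R -> Prop) (u v : R) :
  open D -> D (u, v) -> locally_2d (fun s t => D (s, t)) u v.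
Proof.
  intros HD Huv. apply locally_2d_locally.
  refine (filter_imp _ _ _ (HD _ Huv)). now intros [s t].
Qed.

Lemma open_locally_u (D : R * R -> Prop) (u v : R) :
  open D -> D (u, v) -> locally u (fun s => D (s, v)).
Proof.
  intros HD Huv. exact (locally_2d_1d_const_y _ _ _ (open_locally_2d D u v HD Huv)).
Qed.

Lemma open_locally_v (D : R * R -> Prop) (u v : R) :
  open D -> D (u, v) -> locally v (fun t => D (u, t)).
Proof.
  intros HD Huv. exact (locally_2d_1d_const_x _ _ _ (open_locally_2d D u v HD Huv)).
Qed.

Lemma is_derive_Rmult (f g : R -> R) (x a b : R) :
  is_derive f x a -> is_derive g x b ->
  is_derive (fun t => f t * g t) x (a * g x + f x * b).
Proof.
  intros Hf Hg.
  exact (is_derive_mult f g x a b Hf Hg (fun n m => Rmult_comm n m)).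
Qed.

Lemma is_derive_Rplus (f g : R -> R) (x a b : R) :
  is_derive f x a -> is_derive g x b -> is_derive (fun t => f t + g t) x (a + b).
Proof. intros Hf Hg. exact (is_derive_plus f g x a b Hf Hg). Qed.

Lemma ex_diff_n_continuity f n u v : ex_diff_n f n u v -> continuity_2d_pt f u v.
Proof. destruct n; simpl; tauto. Qed.

Section Smooth.

Context (D : R * R -> Prop) (HD : open D).

Lemma class_on_ext n f g :
  (forall u v, D (u, v) -> f u v = g u v) -> class_on D n f -> class_on D n g.
Proof.
  intros Hfg Hf u v Huv.
  apply ex_diff_n_ext_loc with f; [|now apply Hf].
  destruct (open_locally_2d D u v HD Huv) as [d Hd].
  exists d. intros s t Hs Ht. apply Hfg, Hd; assumption.
Qed.

Lemma class_on_le n m f : (m <= n)%nat -> class_on D n f -> class_on D m f.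
Proof. intros Hmn Hf u v Huv. apply ex_diff_n_m with n; auto. Qed.

(** Every membership in a higher class is obtained this way: exhibit the partial
    derivatives and show that they lie in the class below. *)
Lemma class_on_S n f fu fv :
  (forall u v, D (u, v) -> continuity_2d_pt f u v) ->
  (forall u v, D (u, v) -> is_derive (fun s => f s v) u (fu u v)) ->
  (forall u v, D (u, v) -> is_derive (fun t => f u t) v (fv u v)) ->
  class_on D n fu -> class_on D n fv -> class_on D (S n) f.
Proof.
  intros Hc Hu Hv Cu Cv u v Huv. split; [now apply Hc|].
  split; [eexists; now apply Hu|]. split; [eexists; now apply Hv|].
  split.
  - apply (class_on_ext n fu); auto. intros s t Hst. symmetry.
    apply is_derive_unique. now apply Hu.
  - apply (class_on_ext n fv); auto. intros s t Hst. symmetry.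
    apply is_derive_unique. now apply Hv.
Qed.

Lemma class_on_is_du n f u v :
  class_on D (S n) f -> D (u, v) -> is_derive (fun s => f s v) u (du f u v).
Proof. intros Hf Huv. apply Derive_correct. apply (Hf u v Huv). Qed.

Lemma class_on_is_dv n f u v :
  class_on D (S n) f -> D (u, v) -> is_derive (fun t => f u t) v (dv f u v).
Proof. intros Hf Huv. apply (Derive_correct (fun t => f u t)). apply (Hf u v Huv). Qed.

Lemma class_on_du n f : class_on D (S n) f -> class_on D n (du f).
Proof. intros Hf u v Huv. apply (Hf u v Huv). Qed.

Lemma class_on_dv n f : class_on D (S n) f -> class_on D n (dv f).
Proof. intros Hf u v Huv. apply (Hf u v Huv). Qed.

Lemma class_on_continuity n f u v :
  class_on D n f -> D (u, v) -> continuity_2d_pt f u v.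
Proof. intros Hf Huv. apply ex_diff_n_continuity with n; auto. Qed.

Lemma class_on_const n (c : R) : class_on D n (fun _ _ => c).
Proof.
  revert c. induction n as [|n IH]; intros c.
  - intros u v _. split; [apply continuity_2d_pt_const|exact I].
  - apply class_on_S with (fun _ _ => 0) (fun _ _ => 0); auto; intros.
    + apply continuity_2d_pt_const.
    + apply @is_derive_const.
    + apply @is_derive_const.
Qed.

Lemma class_on_plus n f g :
  class_on D n f -> class_on D n g -> class_on D n (fun u v => f u v + g u v).
Proof.
  revert f g. induction n as [|n IH]; intros f g Hf Hg.
  - intros u v Huv. split; [|exact I].
    apply continuity_2d_pt_plus; [now apply (Hf u v Huv)|now apply (Hg u v Huv)].
  - apply class_on_S with (fun u v => du f u v + du g u v)
      (fun u v => dv f u v + dv g u v).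
    + intros u v Huv. apply continuity_2d_pt_plus; eapply class_on_continuity; eauto.
    + intros u v Huv. apply (is_derive_Rplus (fun s => f s v) (fun s => g s v));
        eapply class_on_is_du; eauto.
    + intros u v Huv. apply (is_derive_Rplus (fun s => f u s) (fun s => g u s));
        eapply class_on_is_dv; eauto.
    + apply IH; now apply class_on_du.
    + apply IH; now apply class_on_dv.
Qed.

Lemma class_on_mult n f g :
  class_on D n f -> class_on D n g -> class_on D n (fun u v => f u v * g u v).
Proof.
  revert f g. induction n as [|n IH]; intros f g Hf Hg.
  - intros u v Huv. split; [|exact I].
    apply continuity_2d_pt_mult; [now apply (Hf u v Huv)|now apply (Hg u v Huv)].
  - assert (Hf' := class_on_le (S n) n f (Nat.le_succ_diag_r n) Hf).
    assert (Hg' := class_on_le (S n) n g (Nat.le_succ_diag_r n) Hg).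
    apply class_on_S with (fun u v => du f u v * g u v + f u v * du g u v)
      (fun u v => dv f u v * g u v + f u v * dv g u v).
    + intros u v Huv. apply continuity_2d_pt_mult; eapply class_on_continuity; eauto.
    + intros u v Huv. apply (is_derive_Rmult (fun s => f s v) (fun s => g s v));
        eapply class_on_is_du; eauto.
    + intros u v Huv. apply (is_derive_Rmult (fun s => f u s) (fun s => g u s));
        eapply class_on_is_dv; eauto.
    + apply class_on_plus; apply IH; auto; now apply class_on_du.
    + apply class_on_plus; apply IH; auto; now apply class_on_dv.
Qed.

(** The derivative - f' / f^2 contains 1/f again, now in the class below, so the
    induction closes; the same happens for the square root. *)
Lemma class_on_inv n f :
  (forall u v, D (u, v) -> f u v <> 0) ->
  class_on D n f -> class_on D n (fun u v => / f u v).
Proof.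
  intros H0. induction n as [|n IH]; intros Hf.
  - intros u v Huv. split; [|exact I].
    apply continuity_2d_pt_inv; [now apply (Hf u v Huv)|auto].
  - assert (Hi := IH (class_on_le (S n) n f (Nat.le_succ_diag_r n) Hf)).
    apply class_on_S with (fun u v => -1 * (du f u v * (/ f u v * / f u v)))
      (fun u v => -1 * (dv f u v * (/ f u v * / f u v))).
    + intros u v Huv. apply continuity_2d_pt_inv; auto.
      eapply class_on_continuity; eauto.
    + intros u v Huv.
      replace (-1 * _) with (- du f u v / f u v ^ 2) by (field; auto).
      apply (is_derive_inv (fun s => f s v)); auto. eapply class_on_is_du; eauto.
    + intros u v Huv.
      replace (-1 * _) with (- dv f u v / f u v ^ 2) by (field; auto).
      apply (is_derive_inv (fun s => f u s)); auto. eapply class_on_is_dv; eauto.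
    + repeat apply class_on_mult; auto using class_on_const, class_on_du.
    + repeat apply class_on_mult; auto using class_on_const, class_on_dv.
Qed.

Lemma class_on_sqrt n f :
  (forall u v, D (u, v) -> 0 < f u v) ->
  class_on D n f -> class_on D n (fun u v => sqrt (f u v)).
Proof.
  intros H0. 
  assert (Hc : forall u v, D (u, v) -> continuity_2d_pt f u v ->
    continuity_2d_pt (fun u v => sqrt (f u v)) u v).
  { intros u v Huv Hf. apply (continuity_1d_2d_pt_comp sqrt); auto.
    apply continuity_pt_sqrt. left; auto. }
  induction n as [|n IH]; intros Hf.
  - intros u v Huv. split; [|exact I]. apply Hc; auto. now apply (Hf u v Huv).
  - assert (Hi := IH (class_on_le (S n) n f (Nat.le_succ_diag_r n) Hf)).
    assert (Hj : class_on D n (fun u v => / sqrt (f u v))).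
    { apply class_on_inv; auto. intros u v Huv. apply Rgt_not_eq, sqrt_lt_R0; auto. }
    apply class_on_S with (fun u v => / 2 * (du f u v * / sqrt (f u v)))
      (fun u v => / 2 * (dv f u v * / sqrt (f u v))).
    + intros u v Huv. apply Hc; auto. eapply class_on_continuity; eauto.
    + intros u v Huv. assert (H := sqrt_lt_R0 _ (H0 u v Huv)).
      replace (/ 2 * _) with (du f u v / (2 * sqrt (f u v))) by (field; lra).
      apply (is_derive_sqrt (fun s => f s v)); auto. eapply class_on_is_du; eauto.
    + intros u v Huv. assert (H := sqrt_lt_R0 _ (H0 u v Huv)).
      replace (/ 2 * _) with (dv f u v / (2 * sqrt (f u v))) by (field; lra).
      apply (is_derive_sqrt (fun s => f u s)); auto. eapply class_on_is_dv; eauto.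
    + repeat apply class_on_mult; auto using class_on_const, class_on_du.
    + repeat apply class_on_mult; auto using class_on_const, class_on_dv.
Qed.

Lemma smooth_ext f g :
  (forall u v, D (u, v) -> f u v = g u v) -> smooth_on D f -> smooth_on D g.
Proof. intros H Hf n. apply (class_on_ext n f g H). exact (Hf n). Qed.

Lemma smooth_const (c : R) : smooth_on D (fun _ _ => c).
Proof. intros n. apply class_on_const. Qed.

Lemma smooth_plus f g :
  smooth_on D f -> smooth_on D g -> smooth_on D (fun u v => f u v + g u v).
Proof. intros Hf Hg n. apply class_on_plus; [exact (Hf n)|exact (Hg n)]. Qed.

Lemma smooth_mult f g :
  smooth_on D f -> smooth_on D g -> smooth_on D (fun u v => f u v * g u v).
Proof. intros Hf Hg n. apply class_on_mult; [exact (Hf n)|exact (Hg n)]. Qed.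

Lemma smooth_opp f : smooth_on D f -> smooth_on D (fun u v => - f u v).
Proof.
  intros Hf. apply (smooth_ext (fun u v => -1 * f u v)); [intros; ring|].
  apply smooth_mult; auto using smooth_const.
Qed.

Lemma smooth_minus f g :
  smooth_on D f -> smooth_on D g -> smooth_on D (fun u v => f u v - g u v).
Proof. intros Hf Hg. apply smooth_plus; auto using smooth_opp. Qed.

Lemma smooth_inv f :
  (forall u v, D (u, v) -> f u v <> 0) ->
  smooth_on D f -> smooth_on D (fun u v => / f u v).
Proof. intros H0 Hf n. apply class_on_inv; [assumption|exact (Hf n)]. Qed.

Lemma smooth_div f g :
  (forall u v, D (u, v) -> g u v <> 0) ->
  smooth_on D f -> smooth_on D g -> smooth_on D (fun u v => f u v / g u v).
Proof. intros H0 Hf Hg. apply smooth_mult; auto using smooth_inv. Qed.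

Lemma smooth_sqrt f :
  (forall u v, D (u, v) -> 0 < f u v) ->
  smooth_on D f -> smooth_on D (fun u v => sqrt (f u v)).
Proof. intros H0 Hf n. apply class_on_sqrt; [assumption|exact (Hf n)]. Qed.

Lemma smooth_du f : smooth_on D f -> smooth_on D (du f).
Proof. intros Hf n. apply class_on_du. exact (Hf (S n)). Qed.

Lemma smooth_dv f : smooth_on D f -> smooth_on D (dv f).
Proof. intros Hf n. apply class_on_dv. exact (Hf (S n)). Qed.

Lemma smooth_is_du f u v :
  smooth_on D f -> D (u, v) -> is_derive (fun s => f s v) u (du f u v).
Proof. intros Hf Huv. apply (class_on_is_du 0); [exact (Hf 1%nat)|assumption]. Qed.

Lemma smooth_is_dv f u v :
  smooth_on D f -> D (u, v) -> is_derive (fun t => f u t) v (dv f u v).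
Proof. intros Hf Huv. apply (class_on_is_dv 0); [exact (Hf 1%nat)|assumption]. Qed.

Lemma smooth_continuity f u v :
  smooth_on D f -> D (u, v) -> continuity_2d_pt f u v.
Proof. intros Hf Huv. apply (Hf 0%nat u v Huv). Qed.

Lemma smooth_schwarz f u v :
  smooth_on D f -> D (u, v) -> du (dv f) u v = dv (du f) u v.
Proof.
  intros Hf Huv. apply Schwarz.
  - destruct (open_locally_2d D u v HD Huv) as [d Hd].
    exists d. intros s t Hs Ht. specialize (Hd s t Hs Ht).
    destruct (Hf 2%nat s t Hd) as (_ & E1 & E2 & (_ & _ & E3 & _) & (_ & E4 & _)).
    auto.
  - destruct (Hf 2%nat u v Huv) as (_ & _ & _ & _ & (_ & _ & _ & H & _)).
    exact (proj1 H).
  - destruct (Hf 2%nat u v Huv) as (_ & _ & _ & (_ & _ & _ & _ & H) & _).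
    exact (proj1 H).
Qed.

Lemma du_ext f g u v :
  (forall s t, D (s, t) -> f s t = g s t) -> D (u, v) -> du f u v = du g u v.
Proof.
  intros H Huv. apply Derive_ext_loc.
  refine (filter_imp _ _ _ (open_locally_u D u v HD Huv)). intros s; apply H.
Qed.

Lemma dv_ext f g u v :
  (forall s t, D (s, t) -> f s t = g s t) -> D (u, v) -> dv f u v = dv g u v.
Proof.
  intros H Huv. apply (Derive_ext_loc (fun t => f u t) (fun t => g u t)).
  refine (filter_imp _ _ _ (open_locally_v D u v HD Huv)). intros s; apply H.
Qed.

End Smooth.

(** * Open squares *)

Definition square (u0 v0 r : R) (p : R * R) : Prop :=
  Rabs (fst p - u0) < r /\ Rabs (snd p - v0) < r.

Lemma square_open u0 v0 r : open (square u0 v0 r).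
Proof.
  intros [u v] [Hu Hv]. simpl in Hu, Hv.
  assert (Hd : 0 < Rmin (r - Rabs (u - u0)) (r - Rabs (v - v0)))
    by (apply Rmin_pos; lra).
  exists (mkposreal _ Hd). intros [s t] [Hs Ht]. 
  change (Rabs (s - u) < Rmin (r - Rabs (u - u0)) (r - Rabs (v - v0))) in Hs.
  change (Rabs (t - v) < Rmin (r - Rabs (u - u0)) (r - Rabs (v - v0))) in Ht.
  assert (H1 := Rmin_l (r - Rabs (u - u0)) (r - Rabs (v - v0))).
  assert (H2 := Rmin_r (r - Rabs (u - u0)) (r - Rabs (v - v0))).
  split; simpl.
  - replace (s - u0) with ((s - u) + (u - u0)) by ring.
    eapply Rle_lt_trans; [apply Rabs_triang|lra].
  - replace (t - v0) with ((t - v) + (v - v0)) by ring.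
    eapply Rle_lt_trans; [apply Rabs_triang|lra].
Qed.

Lemma square_center u0 v0 r : 0 < r -> square u0 v0 r (u0, v0).
Proof. intros Hr. split; simpl; rewrite Rminus_diag, Rabs_R0; exact Hr. Qed.

Lemma square_in_open (D : R * R -> Prop) u0 v0 :
  open D -> D (u0, v0) ->
  exists r, 0 < r /\ forall p, square u0 v0 r p -> D p.
Proof.
  intros HD H0. destruct (open_locally_2d D u0 v0 HD H0) as [d Hd].
  exists d. split; [apply cond_pos|]. intros [u v] [Hu Hv]. now apply Hd.
Qed.

Lemma Rabs_segment a b c r t :
  0 <= t <= 1 -> Rabs (a - c) < r -> Rabs (b - c) < r ->
  Rabs (a + t * (b - a) - c) < r.
Proof.
  intros Ht Ha Hb. apply Rabs_def2 in Ha. apply Rabs_def2 in Hb.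
  assert (H : forall k m, 0 < k -> 0 < m -> 0 < (1 - t) * k + t * m).
  { intros k m Hk Hm. destruct (Rle_lt_dec t (1 / 2)); nra. }
  apply Rabs_def1.
  - assert (H1 := H (r - (a - c)) (r - (b - c))). lra.
  - assert (H1 := H (r + (a - c)) (r + (b - c))). lra.
Qed.

(** Along the segment from a point of U to a point of V, the indicator of U would
    have zero derivative everywhere if U and V were disjoint on the square, and
    yet take the values 1 and 0. *)
Lemma square_connected u0 v0 r : plane_connected (square u0 v0 r).
Proof.
  intros U V HU HV Hcov [[pu pv] [Sp Up]] [[qu qv] [Sq Vq]].
  apply NNPP. intros Hno.
  assert (Hdis : forall p, square u0 v0 r p -> U p -> V p -> False)
    by (intros p H1 H2 H3; apply Hno; now exists p).
  pose (g := fun t => (pu + t * (qu - pu), pv + t * (qv - pv))).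
  pose (f := fun t => if excluded_middle_informative (U (g t)) then 1 else 0).
  assert (Hg : forall t, continuous g t).
  { intros t. apply (continuous_comp_2 (fun t => pu + t * (qu - pu))
      (fun t => pv + t * (qv - pv)) (fun a b => (a, b)) t).
    - apply (ex_derive_continuous (fun t => pu + t * (qu - pu))). auto_derive. auto.
    - apply (ex_derive_continuous (fun t => pv + t * (qv - pv))). auto_derive. auto.
    - intros P HP. refine (filter_imp _ _ _ HP). now intros [? ?]. }
  assert (HS : forall t, 0 <= t <= 1 -> square u0 v0 r (g t)).
  { intros t Ht. destruct Sp, Sq. split; apply Rabs_segment; assumption. }
  assert (Hd : forall t, 0 <= t <= 1 -> is_derive f t 0).
  { intros t Ht.
    assert (Hloc : forall W, open W -> W (g t) ->
      locally t (fun s => square u0 v0 r (g s) /\ W (g s))).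
    { intros W HW Wt. apply filter_and; apply Hg.
      - exact (square_open u0 v0 r _ (HS t Ht)).
      - exact (HW _ Wt). }
    destruct (Hcov _ (HS t Ht)) as [Ut | Vt].
    - apply (is_derive_ext_loc (fun _ => 1)); [|apply @is_derive_const].
      refine (filter_imp _ _ _ (Hloc U HU Ut)). intros s [Ss Us]. unfold f.
      now destruct (excluded_middle_informative (U (g s))).
    - apply (is_derive_ext_loc (fun _ => 0)); [|apply @is_derive_const].
      refine (filter_imp _ _ _ (Hloc V HV Vt)). intros s [Ss Vs]. unfold f.
      destruct (excluded_middle_informative (U (g s))) as [Us|]; [|reflexivity].
      now destruct (Hdis (g s)). }
  assert (H01 : f 0 <> f 1).
  { unfold f, g.
    replace (pu + 0 * (qu - pu), pv + 0 * (qv - pv)) with (pu, pv) by (f_equal; ring).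
    replace (pu + 1 * (qu - pu), pv + 1 * (qv - pv)) with (qu, qv) by (f_equal; ring).
    destruct (excluded_middle_informative (U (pu, pv))) as [_|n]; [|contradiction].
    destruct (excluded_middle_informative (U (qu, qv))) as [Uq|_]; [|lra].
    now destruct (Hdis (qu, qv)). }
  destruct (MVT_gen f 0 1 (fun _ => 0)) as [c [_ Hc]]; [| |lra];
    rewrite Rmin_left, Rmax_right by lra.
  - intros t Ht. apply Hd. lra.
  - intros t Ht. apply continuity_pt_filterlim, (ex_derive_continuous f).
    eexists. now apply Hd.
Qed.

Lemma square_domain u0 v0 r : 0 < r -> plane_domain (square u0 v0 r).
Proof.
  intros Hr. split; [|split].
  - exists (u0, v0). now apply square_center.
  - apply square_open.
  - apply square_connected.
Qed.

(** The point (u, v) is reached from the centre along an L-shaped path; for this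
    reason the bound on the u-derivative is only required on the axis v = v0. *)
Lemma square_bounded_variation u0 v0 r (f fu fv : R -> R -> R) M1 M2 u v :
  (forall s t, square u0 v0 r (s, t) ->
    is_derive (fun x => f x t) s (fu s t) /\ is_derive (fun y => f s y) t (fv s t)) ->
  (forall s, Rabs (s - u0) < r -> Rabs (fu s v0) <= M1) ->
  (forall t, Rabs (t - v0) < r -> Rabs (fv u t) <= M2) ->
  square u0 v0 r (u, v) ->
  Rabs (f u v - f u0 v0) <= r * (M1 + M2).
Proof.
  intros Hd HM1 HM2 [Hu Hv]. simpl in Hu, Hv.
  assert (Hr : 0 < r) by (apply Rle_lt_trans with (2 := Hu), Rabs_pos).
  assert (H1 : Rabs (f u v0 - f u0 v0) <= M1 * Rabs (u - u0)).
  { apply (bounded_variation (fun s => f s v0) (fun s => fu s v0)).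
    intros s Hs. split; [|apply HM1; lra].
    apply Hd. split; simpl; [lra|]. now rewrite Rminus_diag, Rabs_R0. }
  assert (H2 : Rabs (f u v - f u v0) <= M2 * Rabs (v - v0)).
  { apply (bounded_variation (fun t => f u t) (fun t => fv u t)).
    intros s Hs. split; [|apply HM2; lra].
    apply Hd. split; simpl; lra. }
  assert (P1 : 0 <= M1).
  { apply Rle_trans with (2 := HM1 u Hu), Rabs_pos. }
  assert (P2 : 0 <= M2).
  { apply Rle_trans with (2 := HM2 v Hv), Rabs_pos. }
  replace (f u v - f u0 v0) with ((f u v - f u v0) + (f u v0 - f u0 v0)) by ring.
  eapply Rle_trans; [apply Rabs_triang|]. nra.
Qed.

(** This is how conserved quantities are used, in place of uniqueness theorems for
    differential equations. *)
Lemma square_constant u0 v0 r (f : R -> R -> R) u v :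
  (forall s t, square u0 v0 r (s, t) ->
    is_derive (fun x => f x t) s 0 /\ is_derive (fun y => f s y) t 0) ->
  square u0 v0 r (u, v) -> f u v = f u0 v0.
Proof.
  intros Hd Huv.
  assert (H := square_bounded_variation u0 v0 r f (fun _ _ => 0) (fun _ _ => 0)
    0 0 u v Hd).
  assert (H' : Rabs (f u v - f u0 v0) <= r * (0 + 0))
    by (apply H; auto; intros; rewrite Rabs_R0; lra).
  rewrite Rplus_0_r, Rmult_0_r in H'.
  apply Rminus_diag_uniq. destruct (Req_dec (f u v - f u0 v0) 0) as [e|n]; [exact e|].
  apply Rabs_pos_lt in n. lra.
Qed.

(** * Linear total differential systems *)

(** The indices are 0, ..., N, so the vectors have N + 1 entries. *)
Definition mv (N : nat) (M : nat -> nat -> R) (y : nat -> R) (i : nat) : R :=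
  sum_f_R0 (fun j => M i j * y j) N.

Lemma mv_minus N M y y' i :
  mv N M (fun j => y j - y' j) i = mv N M y i - mv N M y' i.
Proof.
  unfold mv. rewrite <- minus_sum. apply sum_eq. intros j _. ring.
Qed.

Lemma mv_bound N M y i K m :
  (forall j, (j <= N)%nat -> Rabs (M i j) <= K) ->
  (forall j, (j <= N)%nat -> Rabs (y j) <= m) ->
  Rabs (mv N M y i) <= INR (S N) * K * m.
Proof.
  intros HM Hy. unfold mv.
  assert (H : forall n, (n <= N)%nat ->
    Rabs (sum_f_R0 (fun j => M i j * y j) n) <= INR (S n) * (K * m)).
  { assert (T : forall j, (j <= N)%nat -> Rabs (M i j * y j) <= K * m).
    { intros j Hj. rewrite Rabs_mult.
      apply Rmult_le_compat; auto using Rabs_pos. }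
    induction n as [|n IH]; intros Hn; simpl sum_f_R0.
    - simpl INR. rewrite Rmult_1_l. auto.
    - rewrite S_INR. eapply Rle_trans; [apply Rabs_triang|].
      assert (H1 := IH ltac:(lia)). assert (H2 := T (S n) Hn). lra. }
  rewrite Rmult_assoc. now apply H.
Qed.

Lemma is_derive_mv N (M M' : nat -> nat -> R -> R) (y y' : nat -> R -> R) i x :
  (forall j, (j <= N)%nat -> is_derive (M i j) x (M' i j x)) ->
  (forall j, (j <= N)%nat -> is_derive (y j) x (y' j x)) ->
  is_derive (fun t => mv N (fun i j => M i j t) (fun j => y j t) i) x
    (mv N (fun i j => M' i j x) (fun j => y j x) i
     + mv N (fun i j => M i j x) (fun j => y' j x) i).
Proof.
  intros HM Hy. unfold mv. rewrite <- plus_sum.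
  induction N as [|n IH]; simpl sum_f_R0.
  - apply is_derive_Rmult; auto.
  - apply is_derive_Rplus.
    + apply IH; intros; auto.
    + apply is_derive_Rmult; auto.
Qed.

Lemma continuity_2d_mv N (M : nat -> nat -> R -> R -> R) (y : nat -> R -> R -> R) i u v :
  (forall j, (j <= N)%nat -> continuity_2d_pt (M i j) u v) ->
  (forall j, (j <= N)%nat -> continuity_2d_pt (y j) u v) ->
  continuity_2d_pt (fun u v => mv N (fun i j => M i j u v) (fun j => y j u v) i) u v.
Proof.
  intros HM Hy. unfold mv. induction N as [|n IH]; simpl sum_f_R0.
  - apply continuity_2d_pt_mult; auto.
  - apply continuity_2d_pt_plus.
    + apply IH; intros; auto.
    + apply continuity_2d_pt_mult; auto.
Qed.

Lemma continuity_2d_continuous_u f u v :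
  continuity_2d_pt f u v -> continuous (fun s => f s v) u.
Proof.
  intros H. apply continuity_pt_filterlim. intros eps Heps.
  destruct (H (mkposreal eps Heps)) as [d Hd]. exists d.
  split; [apply cond_pos|]. intros s [_ Hs]. apply Hd; [exact Hs|].
  rewrite Rminus_diag, Rabs_R0. apply cond_pos.
Qed.

Lemma continuity_2d_continuous_v f u v :
  continuity_2d_pt f u v -> continuous (fun t => f u t) v.
Proof.
  intros H. apply continuity_pt_filterlim. intros eps Heps.
  destruct (H (mkposreal eps Heps)) as [d Hd]. exists d.
  split; [apply cond_pos|]. intros s [_ Hs]. apply Hd; [|exact Hs].
  rewrite Rminus_diag, Rabs_R0. apply cond_pos.
Qed.

Lemma continuity_2d_slice f u v :
  forall v0, continuity_2d_pt f u v0 -> continuity_2d_pt (fun s _ => f s v0) u v.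
Proof.
  intros v0 H eps. destruct (H eps) as [d Hd]. exists d.
  intros s t Hs _. apply Hd; [exact Hs|].
  rewrite Rminus_diag, Rabs_R0. apply cond_pos.
Qed.

Lemma Rabs_between a b t :
  Rmin a b <= t <= Rmax a b -> Rabs (t - a) <= Rabs (b - a).
Proof.
  unfold Rmin, Rmax. destruct (Rle_dec a b); intros Ht.
  - rewrite !Rabs_pos_eq; lra.
  - rewrite !Rabs_left1; lra.
Qed.

(** ** Integrals depending on a parameter *)

Section Integrals.

Context (u0 v0 r : R).
Local Notation S := (square u0 v0 r).

Lemma is_derive_integral (h : R -> R) c x :
  (forall t, Rabs (t - c) < r -> continuous h t) -> Rabs (x - c) < r ->
  is_derive (fun y => RInt h c y) x (h x).
Proof.
  intros Hh Hx. apply is_derive_RInt with c; [|now apply Hh].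
  assert (Hd : 0 < r - Rabs (x - c)) by lra.
  exists (mkposreal _ Hd). intros y Hy.
  change (Rabs (y - x) < r - Rabs (x - c)) in Hy.
  apply RInt_correct, (ex_RInt_continuous (V := R_CompleteNormedModule)).
  intros z Hz. apply Hh. apply Rabs_between in Hz.
  apply Rle_lt_trans with (1 := Hz).
  replace (y - c) with ((y - x) + (x - c)) by ring.
  eapply Rle_lt_trans; [apply Rabs_triang|lra].
Qed.

Definition integral_v (f : R -> R -> R) (u v : R) : R := RInt (f u) v0 v.

Lemma integral_v_is_dv f u v :
  (forall s t, S (s, t) -> continuity_2d_pt f s t) -> S (u, v) ->
  is_derive (fun t => integral_v f u t) v (f u v).
Proof.
  intros Hf [Hu Hv]. simpl in Hu, Hv.
  apply (is_derive_integral (f u)); [|exact Hv].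
  intros t Ht. apply continuity_2d_continuous_v, Hf. split; assumption.
Qed.

(** In u, continuity of the integrand on a compact segment is uniform; in v, the
    integral is differentiable. *)
Lemma integral_v_continuity f u v :
  (forall s t, S (s, t) -> continuity_2d_pt f s t) -> S (u, v) ->
  continuity_2d_pt (integral_v f) u v.
Proof.
  intros Hf HS. assert (HS' := HS). destruct HS' as [Hu Hv]. simpl in Hu, Hv.
  assert (Hr : 0 < r) by (apply Rle_lt_trans with (2 := Hu), Rabs_pos).
  (* halfway between |v - v0| and r: room for moving v inside the square *)
  set (rho := (Rabs (v - v0) + r) / 2).
  intros eps.
  assert (He1 : 0 < eps / (4 * r)).
  { apply Rdiv_lt_0_compat; [apply cond_pos|lra]. }
  destruct (uniform_continuity_2d_1d' f (v0 - rho) (v0 + rho) u) with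
    (eps := mkposreal _ He1) as [d1 Hd1].
  { intros t Ht. apply Hf. split; simpl; [exact Hu|].
    apply Rle_lt_trans with rho; [apply Rabs_le; lra|unfold rho; lra]. }
  assert (Hc : continuity_pt (integral_v f u) v).
  { apply continuity_pt_filterlim, (ex_derive_continuous (integral_v f u)).
    eexists. now apply integral_v_is_dv. }
  destruct (Hc (eps / 2)) as [d2 [Hd2 Hc2]].
  { apply is_pos_div_2. }
  assert (Hcl : forall t, Rabs (v - t) < d2 -> Rabs (integral_v f u t - integral_v f u v) < eps / 2).
  { intros t Ht. destruct (Req_dec v t) as [<-|n].
    - rewrite Rminus_diag, Rabs_R0. apply is_pos_div_2.
    - apply (Hc2 t). split; [split; [exact I|exact n]|]. rewrite Rabs_minus_sym in Ht. exact Ht. }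
  set (d := Rmin d1 (Rmin d2 (Rmin (rho - Rabs (v - v0)) (r - Rabs (u - u0))))).
  assert (Hd : 0 < d).
  { repeat apply Rmin_pos; try apply cond_pos; try assumption; unfold rho; lra. }
  exists (mkposreal d Hd). simpl. intros s t Hs Ht.
  assert (B1 : d <= d1) by apply Rmin_l.
  assert (B2 : d <= d2) by (eapply Rle_trans; [apply Rmin_r|apply Rmin_l]).
  assert (B3 : d <= rho - Rabs (v - v0))
    by (eapply Rle_trans; [apply Rmin_r|eapply Rle_trans; [apply Rmin_r|apply Rmin_l]]).
  assert (B4 : d <= r - Rabs (u - u0))
    by (eapply Rle_trans; [apply Rmin_r|eapply Rle_trans; [apply Rmin_r|apply Rmin_r]]).
  assert (Hs' : Rabs (s - u0) < r).
  { replace (s - u0) with ((s - u) + (u - u0)) by ring.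
    eapply Rle_lt_trans; [apply Rabs_triang|lra]. }
  assert (Ht' : Rabs (t - v0) < rho).
  { replace (t - v0) with ((t - v) + (v - v0)) by ring.
    eapply Rle_lt_trans; [apply Rabs_triang|lra]. }
  assert (Hrho : rho < r) by (unfold rho; lra).
  replace (integral_v f s t - integral_v f u v) with
    ((integral_v f s t - integral_v f u t) + (integral_v f u t - integral_v f u v)) by ring.
  eapply Rle_lt_trans; [apply Rabs_triang|].
  assert (E1 : Rabs (integral_v f s t - integral_v f u t) <= eps / (4 * r) * Rabs (t - v0)).
  { replace (integral_v f s t - integral_v f u t) with
      ((integral_v f s t - integral_v f u t) - (integral_v f s v0 - integral_v f u v0))
      by (unfold integral_v; rewrite !RInt_point; unfold zero; simpl; ring).
    apply (bounded_variation (fun x => integral_v f s x - integral_v f u x)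
      (fun x => f s x - f u x)).
    intros x Hx. split.
    - apply (is_derive_minus (integral_v f s) (integral_v f u));
        apply integral_v_is_dv; auto; split; simpl; lra.
    - assert (Hx' : Rabs (x - v0) < rho) by lra. apply Rabs_def2 in Hx'.
      left. apply Rabs_def2 in Hs.
      apply (Hd1 x u x s); try lra.
      rewrite Rminus_diag, Rabs_R0. apply cond_pos. }
  assert (E2 : Rabs (integral_v f u t - integral_v f u v) < eps / 2).
  { apply Hcl. rewrite Rabs_minus_sym. lra. }
  assert (E3 : eps / (4 * r) * Rabs (t - v0) <= eps / 4).
  { replace (eps / 4) with (eps / (4 * r) * r) by (field; lra).
    apply Rmult_le_compat_l; lra. }
  assert (P := cond_pos eps). lra.
Qed.

Lemma integral_v_is_du f fu u v :
  (forall s t, S (s, t) -> continuity_2d_pt f s t) ->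
  (forall s t, S (s, t) -> is_derive (fun x => f x t) s (fu s t)) ->
  (forall s t, S (s, t) -> continuity_2d_pt fu s t) -> S (u, v) ->
  is_derive (fun s => integral_v f s v) u (integral_v fu u v).
Proof.
  intros Hf Hd Hfu HS. assert (HS' := HS). destruct HS' as [Hu Hv]. simpl in Hu, Hv.
  assert (Hloc := open_locally_u _ u v0 (square_open u0 v0 r)).
  assert (Hin : forall s t, Rabs (s - u0) < r -> Rmin v0 v <= t <= Rmax v0 v -> S (s, t)).
  { intros s t Hs Ht. split; simpl; [exact Hs|].
    apply Rabs_between in Ht. lra. }
  assert (Hlu : locally u (fun s => Rabs (s - u0) < r)).
  { refine (filter_imp _ _ _ (Hloc _)).
    - intros s [Hs _]. exact Hs.
    - split; simpl; [exact Hu|]. rewrite Rminus_diag, Rabs_R0.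
      apply Rle_lt_trans with (2 := Hu), Rabs_pos. }
  replace (integral_v fu u v) with (RInt (fun t => Derive (fun s => f s t) u) v0 v).
  - apply is_derive_RInt_param.
    + refine (filter_imp _ _ _ Hlu). intros s Hs t Ht. eexists. apply Hd. now apply Hin.
    + intros t Ht. assert (Hut := Hin u t Hu Ht).
      apply continuity_2d_pt_ext_loc with fu; [|now apply Hfu].
      destruct (open_locally_2d S u t (square_open u0 v0 r) Hut) as [d Hd'].
      exists d. intros x y Hx Hy. symmetry. apply is_derive_unique, Hd.
      now apply Hd'.
    + refine (filter_imp _ _ _ Hlu). intros s Hs.
      apply (ex_RInt_continuous (V := R_CompleteNormedModule)). intros t Ht.
      apply (continuity_2d_continuous_v f). apply Hf. now apply Hin.
  - apply RInt_ext. intros t Ht. apply is_derive_unique, Hd. apply Hin; [exact Hu|lra].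
Qed.

End Integrals.

(** ** Geometrically convergent sequences of functions *)

Lemma half_pow_small M eps :
  0 < eps -> exists n0, forall n, (n0 <= n)%nat -> M * (1 / 2) ^ n < eps.
Proof.
  intros He.
  destruct (pow_lt_1_zero (1 / 2)) with (y := eps / (Rabs M + 1)) as [n0 Hn0].
  { rewrite Rabs_pos_eq; lra. }
  { apply Rdiv_lt_0_compat; [exact He|]. assert (P := Rabs_pos M). lra. }
  exists n0. intros n Hn. specialize (Hn0 n Hn).
  assert (P := Rabs_pos M). assert (Q := pow_le (1 / 2) n ltac:(lra)).
  rewrite Rabs_pos_eq in Hn0 by exact Q.
  apply (Rmult_lt_compat_l (Rabs M + 1)) in Hn0; [|lra].
  replace ((Rabs M + 1) * (eps / (Rabs M + 1))) with eps in Hn0 by (field; lra).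
  assert (R1 := Rle_abs M). nra.
Qed.

Lemma quarter_le_half n : 0 < (1 / 4) ^ n <= (1 / 2) ^ n.
Proof. split; [apply pow_lt; lra|apply pow_incr; lra]. Qed.

Lemma geometric_limit (a : nat -> R) (C : R) :
  (forall n, Rabs (a (S n) - a n) <= C * (1 / 4) ^ S n) ->
  forall n, Rabs (real (Lim_seq a) - a n) <= C * (1 / 4) ^ n.
Proof.
  intros Ha.
  assert (HC : 0 <= C).
  { assert (H := Rle_trans _ _ _ (Rabs_pos _) (Ha 0%nat)). simpl in H. lra. }
  assert (Hk : forall n k, Rabs (a (n + k)%nat - a n) <=
    C / 3 * ((1 / 4) ^ n - (1 / 4) ^ (n + k))).
  { intros n k. induction k as [|k IH].
    - rewrite Nat.add_0_r, !Rminus_diag, Rabs_R0. lra.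
    - replace (a (n + S k)%nat - a n) with
        ((a (S (n + k)) - a (n + k)%nat) + (a (n + k)%nat - a n))
        by (rewrite Nat.add_succ_r; ring).
      eapply Rle_trans; [apply Rabs_triang|].
      assert (H := Ha (n + k)%nat). rewrite Nat.add_succ_r. simpl pow in *. lra. }
  assert (Hk' : forall n k, Rabs (a (n + k)%nat - a n) <= C * (1 / 4) ^ n).
  { intros n k. eapply Rle_trans; [apply Hk|].
    destruct (quarter_le_half n) as [P _]. destruct (quarter_le_half (n + k)) as [Q _].
    nra. }
  assert (Hcv : ex_finite_lim_seq a).
  { apply ex_lim_seq_cauchy_corr. intros eps.
    destruct (half_pow_small (2 * C) eps (cond_pos eps)) as [n0 Hn0].
    exists n0. intros n m Hn Hm.
    assert (H := Hn0 n0 (Nat.le_refl n0)).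
    destruct (quarter_le_half n0) as [P Q].
    assert (H1 := Hk' n0 (n - n0)%nat). assert (H2 := Hk' n0 (m - n0)%nat).
    replace (n0 + (n - n0))%nat with n in H1 by lia.
    replace (n0 + (m - n0))%nat with m in H2 by lia.
    replace (a n - a m) with ((a n - a n0) - (a m - a n0)) by ring.
    eapply Rle_lt_trans; [apply Rabs_triang|]. rewrite Rabs_Ropp. nra. }
  intros n. apply Lim_seq_correct' in Hcv.
  assert (H : is_lim_seq (fun k => Rabs (a (k + n)%nat - a n))
    (Rabs (real (Lim_seq a) - a n))).
  { apply (is_lim_seq_abs _ (Finite (real (Lim_seq a) - a n))).
    apply is_lim_seq_minus'; [|apply is_lim_seq_const].
    now apply (is_lim_seq_incr_n a n (Finite (real (Lim_seq a)))). }
  apply (is_lim_seq_le _ (fun _ => C * (1 / 4) ^ n) (Finite _) (Finite _)) with (2 := H).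
  - intros k. rewrite Nat.add_comm. apply Hk'.
  - apply is_lim_seq_const.
Qed.

Lemma derive_uniform_limit (f : nat -> R -> R) (f' : nat -> R -> R) (g g' : R -> R)
    (x d M1 M2 : R) :
  0 < d ->
  (forall n y, Rabs (y - x) < d -> is_derive (f n) y (f' n y)) ->
  (forall n y, Rabs (y - x) < d -> Rabs (g y - f n y) <= M1 * (1 / 2) ^ n) ->
  (forall n y, Rabs (y - x) < d -> Rabs (g' y - f' n y) <= M2 * (1 / 2) ^ n) ->
  (forall y, Rabs (y - x) < d -> continuous g' y) ->
  is_derive g x (g' x).
Proof.
  intros Hd Hf Hg Hg' Hc. apply is_derive_Reals.
  apply (derivable_pt_lim_CVU f f' g g' x x (mkposreal d Hd)).
  - unfold Boule. rewrite Rminus_diag, Rabs_R0. exact Hd.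
  - intros y n Hy. apply is_derive_Reals. now apply Hf.
  - intros y Hy eps Heps. destruct (half_pow_small M1 eps Heps) as [n0 Hn0].
    exists n0. intros n Hn. unfold Rdist. rewrite Rabs_minus_sym.
    eapply Rle_lt_trans; [now apply Hg|now apply Hn0].
  - intros eps Heps. destruct (half_pow_small M2 eps Heps) as [n0 Hn0].
    exists n0. intros n y Hn Hy. eapply Rle_lt_trans; [now apply Hg'|now apply Hn0].
  - intros y Hy. apply continuity_pt_filterlim. now apply Hc.
Qed.

Lemma continuity_2d_uniform_limit (D : R * R -> Prop) (f : nat -> R -> R -> R)
    (g : R -> R -> R) (M : R) :
  open D ->
  (forall n u v, D (u, v) -> continuity_2d_pt (f n) u v) ->
  (forall n u v, D (u, v) -> Rabs (g u v - f n u v) <= M * (1 / 2) ^ n) ->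
  forall u v, D (u, v) -> continuity_2d_pt g u v.
Proof.
  intros HD Hf Hg u v Huv eps.
  assert (He : 0 < eps / 3) by (assert (P := cond_pos eps); lra).
  destruct (half_pow_small M (eps / 3) He) as [n Hn].
  specialize (Hn n (Nat.le_refl n)).
  destruct (open_locally_2d D u v HD Huv) as [d1 Hd1].
  destruct (Hf n u v Huv (mkposreal _ He)) as [d2 Hd2]. simpl in Hd2.
  assert (Hd : 0 < Rmin d1 d2) by (apply Rmin_pos; apply cond_pos).
  exists (mkposreal _ Hd). simpl. intros s t Hs Ht.
  assert (B1 := Rmin_l d1 d2). assert (B2 := Rmin_r d1 d2).
  assert (E1 := Hg n s t (Hd1 s t ltac:(lra) ltac:(lra))).
  assert (E2 := Hd2 s t ltac:(lra) ltac:(lra)).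
  assert (E3 := Hg n u v Huv). rewrite Rabs_minus_sym in E3.
  replace (g s t - g u v) with
    ((g s t - f n s t) + ((f n s t - f n u v) + (f n u v - g u v))) by ring.
  eapply Rle_lt_trans; [apply Rabs_triang|].
  assert (T := Rabs_triang (f n s t - f n u v) (f n u v - g u v)). lra.
Qed.

(** ** Picard iteration in two variables *)

Section Picard.

Context (N : nat) (A B Av Bu : nat -> nat -> R -> R -> R) (u0 v0 r K : R).

Local Notation Sq := (square u0 v0 r).

Definition mulv (M : nat -> nat -> R -> R -> R) (X : nat -> R -> R -> R)
  (i : nat) (u v : R) : R := mv N (fun i j => M i j u v) (fun j => X j u v) i.

Context (Hr : 0 < r).
Context (cA : forall i j u v, (i <= N)%nat -> (j <= N)%nat -> Sq (u, v) ->
  continuity_2d_pt (A i j) u v).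
Context (cB : forall i j u v, (i <= N)%nat -> (j <= N)%nat -> Sq (u, v) ->
  continuity_2d_pt (B i j) u v).
Context (cBu : forall i j u v, (i <= N)%nat -> (j <= N)%nat -> Sq (u, v) ->
  continuity_2d_pt (Bu i j) u v).
Context (dBu : forall i j u v, (i <= N)%nat -> (j <= N)%nat -> Sq (u, v) ->
  is_derive (fun s => B i j s v) u (Bu i j u v)).
Context (dAv : forall i j u v, (i <= N)%nat -> (j <= N)%nat -> Sq (u, v) ->
  is_derive (fun t => A i j u t) v (Av i j u v)).
Context (bA : forall i j u v, (i <= N)%nat -> (j <= N)%nat -> Sq (u, v) ->
  Rabs (A i j u v) <= K).
Context (bB : forall i j u v, (i <= N)%nat -> (j <= N)%nat -> Sq (u, v) ->
  Rabs (B i j u v) <= K).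
Context (bAv : forall i j u v, (i <= N)%nat -> (j <= N)%nat -> Sq (u, v) ->
  Rabs (Av i j u v) <= K).
Context (contr : r * (INR (S N) * K) <= 1 / 8).
Context (compat : forall i u v (y : nat -> R), (i <= N)%nat -> Sq (u, v) ->
  let m (M : nat -> nat -> R -> R -> R) := mv N (fun i j => M i j u v) in
  m Av y i + m A (m B y) i = m Bu y i + m B (m A y) i).

Context (c : nat -> R).

(** The iterates integrate the u-equation along the axis v = v0 and then the
    v-equation along vertical segments.  The second component is the u-derivative
    of the first, obtained by differentiation under the integral sign; it is what
    the u-equation off the axis is about. *)
Fixpoint picard (n : nat) : (nat -> R -> R -> R) * (nat -> R -> R -> R) :=
  match n with
  | O => (fun i _ _ => c i, fun _ _ _ => 0)
  | S n =>
    let (X, U) := picard n in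
    (fun i u v => c i + RInt (fun s => mulv A X i s v0) u0 u
                  + integral_v v0 (mulv B X i) u v,
     fun i u v => mulv A X i u v0
                  + integral_v v0 (fun s t => mulv Bu X i s t + mulv B U i s t) u v)
  end.

Definition pX n := fst (picard n).
Definition pU n := snd (picard n).

Lemma pX_S n i u v :
  pX (S n) i u v = c i + RInt (fun s => mulv A (pX n) i s v0) u0 u
                  + integral_v v0 (mulv B (pX n) i) u v.
Proof. unfold pX; simpl. now destruct (picard n). Qed.

Lemma pU_S n i u v :
  pU (S n) i u v = mulv A (pX n) i u v0
    + integral_v v0 (fun s t => mulv Bu (pX n) i s t + mulv B (pU n) i s t) u v.
Proof. unfold pU, pX; simpl. now destruct (picard n). Qed.

Lemma mulv_continuity M X i u v :
  (forall i j u v, (i <= N)%nat -> (j <= N)%nat -> Sq (u, v) ->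
     continuity_2d_pt (M i j) u v) ->
  (forall j u v, (j <= N)%nat -> Sq (u, v) -> continuity_2d_pt (X j) u v) ->
  (i <= N)%nat -> Sq (u, v) -> continuity_2d_pt (mulv M X i) u v.
Proof. intros HM HX Hi Huv. apply continuity_2d_mv; auto. Qed.

Lemma axis_in_square u v : Sq (u, v) -> Sq (u, v0).
Proof.
  intros [Hu _]. split; simpl; [exact Hu|]. now rewrite Rminus_diag, Rabs_R0.
Qed.

Lemma picard_regular n :
  (forall i u v, (i <= N)%nat -> Sq (u, v) -> continuity_2d_pt (pX n i) u v) /\
  (forall i u v, (i <= N)%nat -> Sq (u, v) -> continuity_2d_pt (pU n i) u v) /\
  (forall i u v, (i <= N)%nat -> Sq (u, v) ->
     is_derive (fun s => pX n i s v) u (pU n i u v)).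
Proof.
  induction n as [|n (IX & IU & ID)].
  - split; [|split]; intros.
    + exact (continuity_2d_pt_const u v (c i)).
    + exact (continuity_2d_pt_const u v 0).
    + exact (is_derive_const (c i) u).
  - assert (cF : forall i u v, (i <= N)%nat -> Sq (u, v) ->
      continuity_2d_pt (mulv B (pX n) i) u v)
      by (intros; apply mulv_continuity; auto).
    assert (cG : forall i u v, (i <= N)%nat -> Sq (u, v) ->
      continuity_2d_pt (mulv A (pX n) i) u v)
      by (intros; apply mulv_continuity; auto).
    assert (cFu : forall i u v, (i <= N)%nat -> Sq (u, v) ->
      continuity_2d_pt (fun s t => mulv Bu (pX n) i s t + mulv B (pU n) i s t) u v)
      by (intros; apply continuity_2d_pt_plus; apply mulv_continuity; auto).
    assert (dG : forall i u v, (i <= N)%nat -> Sq (u, v) ->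
      is_derive (fun s => RInt (fun s => mulv A (pX n) i s v0) u0 s) u
        (mulv A (pX n) i u v0)).
    { intros i u v Hi Huv.
      apply (is_derive_integral r (fun s => mulv A (pX n) i s v0)); [|apply Huv].
      intros s Hs. apply continuity_2d_continuous_u, cG; auto.
      apply (axis_in_square s v). split; [exact Hs|apply Huv]. }
    split; [|split]; intros i u v Hi Huv.
    + apply continuity_2d_pt_ext with (1 := fun s t => eq_sym (pX_S n i s t)).
      apply continuity_2d_pt_plus; [apply continuity_2d_pt_plus|].
      * apply continuity_2d_pt_const.
      * apply (continuity_1d_2d_pt_comp
          (fun s => RInt (fun s => mulv A (pX n) i s v0) u0 s) (fun s _ => s));
          [|apply continuity_2d_pt_id1].
        apply continuity_pt_filterlim.
        apply (ex_derive_continuous (fun s => RInt (fun s => mulv A (pX n) i s v0) u0 s)).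
        eexists. now apply (dG i u v).
      * apply (integral_v_continuity u0 v0 r); auto.
    + apply continuity_2d_pt_ext with (1 := fun s t => eq_sym (pU_S n i s t)).
      apply continuity_2d_pt_plus.
      * apply (continuity_2d_slice (mulv A (pX n) i)). apply cG; auto.
        now apply (axis_in_square u v).
      * apply (integral_v_continuity u0 v0 r); auto.
    + apply is_derive_ext with (1 := fun s => eq_sym (pX_S n i s v)).
      rewrite pU_S. apply is_derive_Rplus.
      * rewrite <- (Rplus_0_l (mulv A (pX n) i u v0)). apply is_derive_Rplus.
        -- apply @is_derive_const.
        -- now apply (dG i u v).
      * apply (integral_v_is_du u0 v0 r (mulv B (pX n) i)); auto.
        intros s t Hst. apply (is_derive_mv N (fun i j s => B i j s t)
          (fun i j s => Bu i j s t) (fun j s => pX n j s t) (fun j s => pU n j s t));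
          auto.
Qed.

Lemma picard_is_dv n i u v :
  (i <= N)%nat -> Sq (u, v) ->
  is_derive (fun t => pX (S n) i u t) v (mulv B (pX n) i u v).
Proof.
  intros Hi Huv. destruct (picard_regular n) as (IX & _ & _).
  apply is_derive_ext with (1 := fun t => eq_sym (pX_S n i u t)).
  rewrite <- (Rplus_0_l (mulv B _ _ _ _)). apply is_derive_Rplus.
  - apply @is_derive_const.
  - apply (integral_v_is_dv u0 v0 r); auto. intros. apply mulv_continuity; auto.
Qed.

Lemma picard_U_is_dv n i u v :
  (i <= N)%nat -> Sq (u, v) ->
  is_derive (fun t => pU (S n) i u t) v
    (mulv Bu (pX n) i u v + mulv B (pU n) i u v).
Proof.
  intros Hi Huv. destruct (picard_regular n) as (IX & IU & _).
  apply is_derive_ext with (1 := fun t => eq_sym (pU_S n i u t)).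
  rewrite <- (Rplus_0_l (mulv Bu _ _ _ _ + _)). apply is_derive_Rplus.
  - apply @is_derive_const.
  - apply (integral_v_is_dv u0 v0 r
      (fun s t => mulv Bu (pX n) i s t + mulv B (pU n) i s t)); auto.
    intros. apply continuity_2d_pt_plus; apply mulv_continuity; auto.
Qed.

Lemma picard_U_axis n i u :
  pU (S n) i u v0 = mulv A (pX n) i u v0.
Proof.
  rewrite pU_S. unfold integral_v. rewrite RInt_point. apply Rplus_0_r.
Qed.

Lemma picard_center n i : pX n i u0 v0 = c i.
Proof.
  destruct n as [|n]; [reflexivity|].
  rewrite pX_S. unfold integral_v. rewrite !RInt_point. unfold zero; simpl. ring.
Qed.

Lemma mulv_minus M X Y i u v :
  mulv M X i u v - mulv M Y i u v = mulv M (fun j s t => X j s t - Y j s t) i u v.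
Proof. unfold mulv. now rewrite mv_minus. Qed.

Lemma mulv_bound M X i u v m :
  (forall i j u v, (i <= N)%nat -> (j <= N)%nat -> Sq (u, v) -> Rabs (M i j u v) <= K) ->
  (forall j, (j <= N)%nat -> Rabs (X j u v) <= m) ->
  (i <= N)%nat -> Sq (u, v) -> Rabs (mulv M X i u v) <= INR (S N) * K * m.
Proof. intros HM HX Hi Huv. apply mv_bound; auto. Qed.

Let L := INR (S N) * K.

Context (C : R) (bc : forall i, (i <= N)%nat -> Rabs (c i) <= C).

Lemma picard_const_pos : 0 <= C /\ 0 <= L.
Proof.
  split.
  - apply Rle_trans with (2 := bc 0%nat (Nat.le_0_l N)), Rabs_pos.
  - apply Rmult_le_pos; [apply pos_INR|].
    apply Rle_trans with (2 := bA 0%nat 0%nat u0 v0 (Nat.le_0_l N) (Nat.le_0_l N)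
      (square_center u0 v0 r Hr)), Rabs_pos.
Qed.

(** The two legs of the path contribute a factor r L <= 1/8 each. *)
Lemma picard_contracts n i u v :
  (i <= N)%nat -> Sq (u, v) ->
  Rabs (pX (S n) i u v - pX n i u v) <= C * (1 / 4) ^ S n.
Proof.
  destruct picard_const_pos as [HC HL]. fold L in contr.
  assert (step : forall (dY : nat -> R -> R -> R) m, 0 <= m ->
    (forall j u v, (j <= N)%nat -> Sq (u, v) -> Rabs (dY j u v) <= m) ->
    forall (f fu fv : R -> R -> R) i, (i <= N)%nat ->
    (forall s t, Sq (s, t) -> is_derive (fun x => f x t) s (fu s t)
       /\ is_derive (fun y => f s y) t (fv s t)) ->
    (forall s, fu s v0 = mulv A dY i s v0) ->
    (forall s t, fv s t = mulv B dY i s t) ->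
    f u0 v0 = 0 ->
    forall u v, Sq (u, v) -> Rabs (f u v) <= m * (1 / 4)).
  { clear i u v. intros dY m Hm HdY f fu fv i Hi Hd Hfu Hfv H0 u v Huv.
    rewrite <- (Rminus_0_r (f u v)), <- H0.
    eapply Rle_trans.
    - apply (square_bounded_variation u0 v0 r f fu fv (L * m) (L * m) u v Hd);
        [| |exact Huv].
      + intros s Hs. rewrite Hfu.
        assert (Hs' : Sq (s, v0))
          by (split; simpl; [exact Hs|now rewrite Rminus_diag, Rabs_R0]).
        apply mulv_bound; auto.
      + intros t Ht. rewrite Hfv.
        assert (Ht' : Sq (u, t)) by (split; simpl; [apply Huv|exact Ht]).
        apply mulv_bound; auto.
    - nra. }
  revert i u v. induction n as [|n IH]; intros i u v Hi Huv.
  - simpl pow. rewrite Rmult_1_r.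
    apply (step (pX 0) C HC (fun j u v Hj _ => bc j Hj)
      (fun s t => pX 1 i s t - pX 0 i s t)
      (pU 1 i) (mulv B (pX 0) i) i Hi).
    + intros s t Hst. destruct (picard_regular 1) as (_ & _ & ID). split.
      * rewrite <- (Rminus_0_r (pU 1 i s t)).
        apply (is_derive_minus (fun x => pX 1 i x t) (fun _ => c i)); auto.
        apply @is_derive_const.
      * rewrite <- (Rminus_0_r (mulv B _ _ _ _)).
        apply (is_derive_minus (fun y => pX 1 i s y) (fun _ => c i)).
        -- now apply picard_is_dv.
        -- apply @is_derive_const.
    + intros s. apply picard_U_axis.
    + reflexivity.
    + rewrite !picard_center. ring.
    + exact Huv.
  - replace (C * (1 / 4) ^ S (S n)) with (C * (1 / 4) ^ S n * (1 / 4)) by (simpl; ring).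
    apply (step (fun j s t => pX (S n) j s t - pX n j s t)
      (C * (1 / 4) ^ S n)) with
      (f := fun s t => pX (S (S n)) i s t - pX (S n) i s t)
      (fu := fun s t => pU (S (S n)) i s t - pU (S n) i s t)
      (fv := fun s t => mulv B (pX (S n)) i s t - mulv B (pX n) i s t) (i := i); auto.
    + apply Rmult_le_pos; [exact HC|]. apply pow_le. lra.
    + intros s t Hst. split.
      * apply (is_derive_minus (fun x => pX (S (S n)) i x t) (fun x => pX (S n) i x t));
          apply picard_regular; auto.
      * apply (is_derive_minus (fun x => pX (S (S n)) i s x) (fun x => pX (S n) i s x));
          apply picard_is_dv; auto.
    + intros s. rewrite !picard_U_axis. apply mulv_minus.
    + intros s t. apply mulv_minus.
    + rewrite !picard_center. ring.
Qed.

(** The heart of the matter: the iteration imposes the u-equation on the axis only,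
    and compatibility propagates it.  For W_n = (X_n)_u - A X_n one finds
    (W_(n+1))_v = B W_n - A_v (X_(n+1) - X_n), all other terms cancelling by the
    compatibility condition, so that W_n tends to 0 with the increments X_(n+1) - X_n.
    The constant 4 (L + 1) C dominates the initial defect L C and leaves room for
    the contribution (L + 1) C (1/4)^(n+1) of the increments. *)
Lemma picard_defect n i u v :
  (i <= N)%nat -> Sq (u, v) ->
  Rabs (pU n i u v - mulv A (pX n) i u v) <= 4 * (L + 1) * C * (1 / 2) ^ n.
Proof.
  destruct picard_const_pos as [HC HL]. fold L in contr.
  revert i u v. induction n as [|n IH]; intros i u v Hi Huv.
  - simpl pow. change (pU 0 i u v) with 0. rewrite Rminus_0_l, Rabs_Ropp.
    eapply Rle_trans; [apply mulv_bound with (m := C); auto|]. fold L. nra.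
  - set (W := fun j s t => pU n j s t - mulv A (pX n) j s t).
    set (dX := fun j s t => pX (S n) j s t - pX n j s t).
    set (w := fun s t => pU (S n) i s t - mulv A (pX (S n)) i s t).
    change (Rabs (w u v) <= 4 * (L + 1) * C * (1 / 2) ^ S n).
    assert (Haxis : Rabs (w u v0) <= L * (C * (1 / 4) ^ S n)).
    { unfold w. rewrite picard_U_axis, mulv_minus.
      assert (Huv0 := axis_in_square u v Huv).
      apply mulv_bound; auto.
      intros j Hj. rewrite Rabs_minus_sym. now apply picard_contracts. }
    assert (Hdv : forall t, Sq (u, t) -> is_derive (fun y => w u y) t
      (mulv B W i u t - mulv Av dX i u t)).
    { intros t Ht.
      replace (mulv B W i u t - mulv Av dX i u t) with
        ((mulv Bu (pX n) i u t + mulv B (pU n) i u t)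
         - (mulv Av (pX (S n)) i u t + mulv A (mulv B (pX n)) i u t)).
      - apply (is_derive_minus (fun y => pU (S n) i u y)
          (fun y => mulv A (pX (S n)) i u y)).
        + now apply picard_U_is_dv.
        + apply (is_derive_mv N (fun i j t => A i j u t) (fun i j t => Av i j u t)
            (fun j t => pX (S n) j u t) (fun j t => mulv B (pX n) j u t)); auto.
          intros j Hj. now apply picard_is_dv.
      - assert (Hc := compat i u t (fun j => pX n j u t) Hi Ht). cbv zeta in Hc.
        change (mulv Av (pX n) i u t + mulv A (mulv B (pX n)) i u t
          = mulv Bu (pX n) i u t + mulv B (mulv A (pX n)) i u t) in Hc.
        unfold W, dX. rewrite <- !mulv_minus. lra. }
    assert (Hvar : Rabs (w u v - w u v0) <=
      (L * (4 * (L + 1) * C * (1 / 2) ^ n) + L * (C * (1 / 4) ^ S n)) * Rabs (v - v0)).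
    { apply (bounded_variation (fun y => w u y)
        (fun t => mulv B W i u t - mulv Av dX i u t)).
      intros t Ht. assert (Hut : Sq (u, t)).
      { split; simpl; [apply Huv|]. apply Rle_lt_trans with (1 := Ht), Huv. }
      split; [now apply Hdv|].
      eapply Rle_trans; [apply Rabs_triang|]. rewrite Rabs_Ropp.
      apply Rplus_le_compat; apply mulv_bound; auto; intros j Hj.
      - now apply IH.
      - now apply picard_contracts. }
    destruct (quarter_le_half n) as [P4 P2].
    assert (Hv : Rabs (v - v0) < r) by apply Huv.
    replace (w u v) with (w u v0 + (w u v - w u v0)) by ring.
    eapply Rle_trans; [apply Rabs_triang|]. simpl pow in *.
    assert (Hv0 := Rabs_pos (v - v0)).
    set (q := (1 / 2) ^ n) in *. set (p := (1 / 4) ^ n) in *.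
    assert (E1 : L * Rabs (v - v0) <= 1 / 8) by nra.
    assert (E2 : 0 <= (L + 1) * C * q) by (apply Rmult_le_pos; [nra|lra]).
    assert (E3 : L * C * p <= (L + 1) * C * q).
    { apply Rmult_le_compat; nra. }
    assert (E4 : C * p <= (L + 1) * C * q).
    { apply Rmult_le_compat; nra. }
    assert (E5 : 0 <= C * p) by nra.
    assert (E6 : L * Rabs (v - v0) * (4 * ((L + 1) * C * q)) <= 1 / 8 * (4 * ((L + 1) * C * q)))
      by (apply Rmult_le_compat_r; lra).
    assert (E7 : L * Rabs (v - v0) * (C * p) <= 1 / 8 * (C * p))
      by (apply Rmult_le_compat_r; lra).
    lra.
Qed.

Definition picard_limit (i : nat) (u v : R) : R :=
  real (Lim_seq (fun n => pX n i u v)).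

Lemma picard_limit_approx n i u v :
  (i <= N)%nat -> Sq (u, v) ->
  Rabs (picard_limit i u v - pX n i u v) <= C * (1 / 4) ^ n.
Proof.
  intros Hi Huv. apply (geometric_limit (fun n => pX n i u v)).
  intros m. now apply picard_contracts.
Qed.

Lemma picard_limit_approx_half n i u v :
  (i <= N)%nat -> Sq (u, v) ->
  Rabs (picard_limit i u v - pX n i u v) <= C * (1 / 2) ^ n.
Proof.
  intros Hi Huv. eapply Rle_trans; [now apply picard_limit_approx|].
  apply Rmult_le_compat_l; [apply picard_const_pos|apply quarter_le_half].
Qed.

Lemma picard_limit_continuity i u v :
  (i <= N)%nat -> Sq (u, v) -> continuity_2d_pt (picard_limit i) u v.
Proof.
  intros Hi. apply (continuity_2d_uniform_limit Sq (fun n => pX n i) _ C).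
  - apply square_open.
  - intros n s t Hst. now apply picard_regular.
  - intros n s t Hst. now apply picard_limit_approx_half.
Qed.

Lemma square_radius u v : Sq (u, v) ->
  exists d, 0 < d /\ (forall s, Rabs (s - u) < d -> Sq (s, v)) /\
    (forall t, Rabs (t - v) < d -> Sq (u, t)).
Proof.
  intros H. destruct (square_in_open Sq u v (square_open u0 v0 r) H) as [d [Hd Hin]].
  exists d. split; [exact Hd|]. split; intros x Hx; apply Hin; split; simpl;
    rewrite ?Rminus_diag, ?Rabs_R0; auto.
Qed.

Lemma picard_limit_is_dv i u v :
  (i <= N)%nat -> Sq (u, v) ->
  is_derive (fun t => picard_limit i u t) v (mulv B picard_limit i u v).
Proof.
  intros Hi Huv. destruct (square_radius u v Huv) as (d & Hd & _ & Hin).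
  destruct picard_const_pos as [HC HL].
  apply (derive_uniform_limit (fun n t => pX (S n) i u t)
    (fun n t => mulv B (pX n) i u t) (fun t => picard_limit i u t)
    (fun t => mulv B picard_limit i u t) v d C (L * C) Hd).
  - intros n t Ht. apply picard_is_dv; auto.
  - intros n t Ht. eapply Rle_trans; [apply picard_limit_approx_half; auto|].
    simpl. assert (P := pow_le (1 / 2) n ltac:(lra)). nra.
  - intros n t Ht. rewrite mulv_minus, Rmult_assoc.
    apply mulv_bound; auto. intros j Hj. apply picard_limit_approx_half; auto.
  - intros t Ht. apply continuity_2d_continuous_v, mulv_continuity; auto.
    intros. now apply picard_limit_continuity.
Qed.

Lemma picard_limit_is_du i u v :
  (i <= N)%nat -> Sq (u, v) ->
  is_derive (fun s => picard_limit i s v) u (mulv A picard_limit i u v).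
Proof.
  intros Hi Huv. destruct (square_radius u v Huv) as (d & Hd & Hin & _).
  destruct picard_const_pos as [HC HL].
  apply (derive_uniform_limit (fun n s => pX n i s v)
    (fun n s => pU n i s v) (fun s => picard_limit i s v)
    (fun s => mulv A picard_limit i s v) u d C (L * C + 4 * (L + 1) * C) Hd).
  - intros n s Hs. apply picard_regular; auto.
  - intros n s Hs. apply picard_limit_approx_half; auto.
  - intros n s Hs.
    replace (mulv A picard_limit i s v - pU n i s v) with
      ((mulv A picard_limit i s v - mulv A (pX n) i s v)
       - (pU n i s v - mulv A (pX n) i s v)) by ring.
    eapply Rle_trans; [apply Rabs_triang|]. rewrite Rabs_Ropp, Rmult_plus_distr_r.
    apply Rplus_le_compat; [|apply picard_defect; auto].
    rewrite mulv_minus, Rmult_assoc.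
    apply mulv_bound; auto. intros j Hj. apply picard_limit_approx_half; auto.
  - intros s Hs. apply continuity_2d_continuous_u, mulv_continuity; auto.
    intros. now apply picard_limit_continuity.
Qed.

Lemma picard_limit_center i : picard_limit i u0 v0 = c i.
Proof.
  unfold picard_limit. rewrite (Lim_seq_ext _ (fun _ => c i)).
  - now rewrite Lim_seq_const.
  - intros n. apply picard_center.
Qed.

End Picard.

Lemma continuity_2d_locally_bounded f u0 v0 :
  continuity_2d_pt f u0 v0 ->
  exists d, 0 < d /\ forall u v, square u0 v0 d (u, v) ->
    Rabs (f u v) <= Rabs (f u0 v0) + 1.
Proof.
  intros H. destruct (H (mkposreal 1 Rlt_0_1)) as [d Hd]. exists d.
  split; [apply cond_pos|]. intros u v [Hu Hv]. simpl in *.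
  assert (E := Hd u v Hu Hv). assert (T := Rabs_triang_inv (f u v) (f u0 v0)). lra.
Qed.

(** Finitely many bounds, each valid on its own neighbourhood, hold with one constant
    on one neighbourhood. *)
Lemma uniform_choice (P : nat -> R -> R -> Prop) (n : nat) :
  (forall i K d K' d', P i K d -> K <= K' -> d' <= d -> P i K' d') ->
  (forall i, (i <= n)%nat -> exists K d, 0 < d /\ P i K d) ->
  exists K d, 0 < d /\ forall i, (i <= n)%nat -> P i K d.
Proof.
  intros Hmono. induction n as [|n IH]; intros Hex.
  - destruct (Hex 0%nat (Nat.le_refl 0)) as (K & d & Hd & HP).
    exists K, d. split; [exact Hd|]. intros i Hi. now replace i with 0%nat by lia.
  - destruct IH as (K1 & d1 & Hd1 & HP1); [intros; apply Hex; lia|].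
    destruct (Hex (S n) (Nat.le_refl (S n))) as (K2 & d2 & Hd2 & HP2).
    exists (Rmax K1 K2), (Rmin d1 d2). split; [now apply Rmin_pos|].
    intros i Hi. destruct (Nat.eq_dec i (S n)) as [->|ne].
    + apply Hmono with K2 d2; auto using Rmax_r, Rmin_r.
    + apply Hmono with K1 d1; auto using Rmax_l, Rmin_l. apply HP1. lia.
Qed.

Lemma square_le u0 v0 r r' p : r <= r' -> square u0 v0 r p -> square u0 v0 r' p.
Proof. intros H [H1 H2]. split; lra. Qed.

Lemma class_on_mulv (D : R * R -> Prop) (HD : open D) n N
    (M : nat -> nat -> R -> R -> R) (X : nat -> R -> R -> R) i :
  (forall j, (j <= N)%nat -> class_on D n (M i j)) ->
  (forall j, (j <= N)%nat -> class_on D n (X j)) ->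
  class_on D n (mulv N M X i).
Proof.
  intros HM HX. unfold mulv, mv. induction N as [|k IH]; simpl sum_f_R0.
  - apply class_on_mult; auto.
  - apply (class_on_plus D HD n (fun u v => sum_f_R0 (fun j => M i j u v * X j u v) k)
      (fun u v => M i (S k) u v * X (S k) u v)).
    + apply IH; auto.
    + apply class_on_mult; auto.
Qed.

(** ** Local solvability *)

Definition solves_on (D : R * R -> Prop) (N : nat) (A B : nat -> nat -> R -> R -> R)
    (X : nat -> R -> R -> R) : Prop :=
  forall i u v, (i <= N)%nat -> D (u, v) ->
    continuity_2d_pt (X i) u v /\
    is_derive (fun s => X i s v) u (mulv N A X i u v) /\
    is_derive (fun t => X i u t) v (mulv N B X i u v).

(** Bootstrapping: the derivatives of a C^n solution are products of smooth
    coefficients with the solution, hence C^n. *)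
Lemma solution_smooth (D : R * R -> Prop) (HD : open D) N A B X :
  (forall i j, (i <= N)%nat -> (j <= N)%nat -> smooth_on D (A i j)) ->
  (forall i j, (i <= N)%nat -> (j <= N)%nat -> smooth_on D (B i j)) ->
  solves_on D N A B X -> forall i, (i <= N)%nat -> smooth_on D (X i).
Proof.
  intros HA HB HX i Hi n. revert i Hi.
  change (forall i, (i <= N)%nat -> class_on D n (X i)).
  induction n as [|n IH]; intros i Hi.
  - intros u v Huv. split; [|exact I]. now apply HX.
  - apply class_on_S with (mulv N A X i) (mulv N B X i); auto.
    + intros u v Huv. now apply HX.
    + intros u v Huv. now apply HX.
    + intros u v Huv. now apply HX.
    + apply class_on_mulv; auto. intros j Hj. exact (HA i j Hi Hj n).
    + apply class_on_mulv; auto. intros j Hj. exact (HB i j Hi Hj n).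
Qed.

(** Frobenius theorem for linear systems.  The compatibility condition
    A_v + A B = B_u + B A is stated applied to an arbitrary vector.  The size of
    the square depends on bounds for the coefficients and not on the initial
    value. *)
Theorem total_system_local_solution (D : R * R -> Prop) (HD : open D) (N : nat)
    (A B : nat -> nat -> R -> R -> R) (u0 v0 : R) :
  D (u0, v0) ->
  (forall i j, (i <= N)%nat -> (j <= N)%nat -> smooth_on D (A i j)) ->
  (forall i j, (i <= N)%nat -> (j <= N)%nat -> smooth_on D (B i j)) ->
  (forall i u v (y : nat -> R), (i <= N)%nat -> D (u, v) ->
     let m (M : nat -> nat -> R -> R -> R) := mv N (fun i j => M i j u v) in
     m (fun i j => dv (A i j)) y i + m A (m B y) i
     = m (fun i j => du (B i j)) y i + m B (m A y) i) ->
  exists r0, 0 < r0 /\ forall r, 0 < r <= r0 ->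
    (forall p, square u0 v0 r p -> D p) /\
    forall c : nat -> R, exists X : nat -> R -> R -> R,
      (forall i, X i u0 v0 = c i) /\ solves_on (square u0 v0 r) N A B X.
Proof.
  intros H0 HA HB Hcompat.
  destruct (square_in_open D u0 v0 HD H0) as (rD & HrD & HinD).
  destruct (uniform_choice (fun i K d => forall j, (j <= N)%nat ->
    forall u v, square u0 v0 d (u, v) -> Rabs (A i j u v) <= K /\
      Rabs (B i j u v) <= K /\ Rabs (dv (A i j) u v) <= K) N) as (K & d & Hd & Hbd).
  { intros i K d K' d' H HK Hd' j Hj u v Huv.
    destruct (H j Hj u v (square_le _ _ _ _ _ Hd' Huv)) as (? & ? & ?). lra. }
  { intros i Hi. apply (uniform_choice (fun j K d =>
    forall u v, square u0 v0 d (u, v) -> Rabs (A i j u v) <= K /\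
      Rabs (B i j u v) <= K /\ Rabs (dv (A i j) u v) <= K) N).
    { intros j K d K' d' H HK Hd' u v Huv.
      destruct (H u v (square_le _ _ _ _ _ Hd' Huv)) as (? & ? & ?). lra. }
    intros j Hj.
    destruct (continuity_2d_locally_bounded (A i j) u0 v0) as (d1 & Hd1 & E1).
    { now apply (smooth_continuity D (A i j)); auto. }
    destruct (continuity_2d_locally_bounded (B i j) u0 v0) as (d2 & Hd2 & E2).
    { now apply (smooth_continuity D (B i j)); auto. }
    destruct (continuity_2d_locally_bounded (dv (A i j)) u0 v0) as (d3 & Hd3 & E3).
    { apply (smooth_continuity D); auto using smooth_dv. }
    exists (Rabs (A i j u0 v0) + Rabs (B i j u0 v0) + Rabs (dv (A i j) u0 v0) + 1).
    exists (Rmin d1 (Rmin d2 d3)). split; [repeat apply Rmin_pos; assumption|].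
    intros u v Huv.
    assert (B1 : Rmin d1 (Rmin d2 d3) <= d1) by apply Rmin_l.
    assert (B2 : Rmin d1 (Rmin d2 d3) <= d2)
      by (eapply Rle_trans; [apply Rmin_r|apply Rmin_l]).
    assert (B3 : Rmin d1 (Rmin d2 d3) <= d3)
      by (eapply Rle_trans; [apply Rmin_r|apply Rmin_r]).
    assert (F1 := E1 u v (square_le _ _ _ _ _ B1 Huv)).
    assert (F2 := E2 u v (square_le _ _ _ _ _ B2 Huv)).
    assert (F3 := E3 u v (square_le _ _ _ _ _ B3 Huv)).
    assert (P1 := Rabs_pos (A i j u0 v0)). assert (P2 := Rabs_pos (B i j u0 v0)).
    assert (P3 := Rabs_pos (dv (A i j) u0 v0)). lra. }
  assert (HK : 0 <= K).
  { destruct (Hbd 0%nat (Nat.le_0_l N) 0%nat (Nat.le_0_l N) u0 v0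
      (square_center u0 v0 d Hd)) as [H _].
    eapply Rle_trans; [apply Rabs_pos|exact H]. }
  set (L := INR (S N) * K).
  assert (HL : 0 <= L) by (apply Rmult_le_pos; [apply pos_INR|exact HK]).
  (* the last bound makes the iteration contract: r L <= 1/8 *)
  set (r0 := Rmin rD (Rmin d (1 / (8 * (L + 1))))).
  assert (Hr0 : 0 < r0).
  { repeat apply Rmin_pos; auto. apply Rdiv_lt_0_compat; lra. }
  exists r0. split; [exact Hr0|]. intros r [Hr Hrle].
  assert (B1 : r <= rD) by (eapply Rle_trans; [exact Hrle|apply Rmin_l]).
  assert (B2 : r <= d)
    by (eapply Rle_trans; [exact Hrle|eapply Rle_trans; [apply Rmin_r|apply Rmin_l]]).
  assert (B3 : r <= 1 / (8 * (L + 1)))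
    by (eapply Rle_trans; [exact Hrle|eapply Rle_trans; [apply Rmin_r|apply Rmin_r]]).
  assert (contr : r * L <= 1 / 8).
  { apply Rle_trans with (1 / (8 * (L + 1)) * (L + 1)).
    - apply Rmult_le_compat; lra.
    - apply Req_le. field. lra. }
  assert (HS : forall p, square u0 v0 r p -> D p)
    by (intros p Hp; apply HinD, (square_le _ _ _ _ _ B1 Hp)).
  split; [exact HS|]. intros c.
  destruct (uniform_choice (fun i C _ => Rabs (c i) <= C) N) as (C & _ & _ & HC).
  { intros; lra. }
  { intros i _. exists (Rabs (c i)), 1. lra. }
  set (Av := fun i j => dv (A i j)). set (Bu := fun i j => du (B i j)).
  assert (cA : forall i j u v, (i <= N)%nat -> (j <= N)%nat -> square u0 v0 r (u, v) ->
    continuity_2d_pt (A i j) u v)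
    by (intros; apply (smooth_continuity D); auto).
  assert (cB : forall i j u v, (i <= N)%nat -> (j <= N)%nat -> square u0 v0 r (u, v) ->
    continuity_2d_pt (B i j) u v)
    by (intros; apply (smooth_continuity D); auto).
  assert (cBu : forall i j u v, (i <= N)%nat -> (j <= N)%nat -> square u0 v0 r (u, v) ->
    continuity_2d_pt (Bu i j) u v)
    by (intros; apply (smooth_continuity D); auto; apply smooth_du; auto).
  assert (dBu : forall i j u v, (i <= N)%nat -> (j <= N)%nat -> square u0 v0 r (u, v) ->
    is_derive (fun s => B i j s v) u (Bu i j u v))
    by (intros; apply (smooth_is_du D); auto).
  assert (dAv : forall i j u v, (i <= N)%nat -> (j <= N)%nat -> square u0 v0 r (u, v) ->
    is_derive (fun t => A i j u t) v (Av i j u v))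
    by (intros; apply (smooth_is_dv D); auto).
  assert (bnd : forall i j u v, (i <= N)%nat -> (j <= N)%nat -> square u0 v0 r (u, v) ->
    Rabs (A i j u v) <= K /\ Rabs (B i j u v) <= K /\ Rabs (Av i j u v) <= K).
  { intros i j u v Hi Hj Huv. apply (Hbd i Hi j Hj). now apply square_le with r. }
  assert (compat : forall i u v (y : nat -> R), (i <= N)%nat -> square u0 v0 r (u, v) ->
    let m (M : nat -> nat -> R -> R -> R) := mv N (fun i j => M i j u v) in
    m Av y i + m A (m B y) i = m Bu y i + m B (m A y) i)
    by (intros i u v y Hi Huv; apply Hcompat; auto).
  exists (picard_limit N A B Bu u0 v0 c). split.
  - intros i. apply picard_limit_center.
  - intros i u v Hi Huv. split; [|split].
    + apply picard_limit_continuity with (r := r) (K := K) (C := C); auto;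
        intros; now apply bnd.
    + apply picard_limit_is_du with (Av := Av) (r := r) (K := K) (C := C); auto;
        intros; now apply bnd.
    + apply picard_limit_is_dv with (r := r) (K := K) (C := C); auto;
        intros; now apply bnd.
Qed.

(** * Orthonormal frames of Minkowski space *)

Lemma R4_eq (p q : R4) :
  pr1 p = pr1 q -> pr2 p = pr2 q -> pr3 p = pr3 q -> pr4 p = pr4 q -> p = q.
Proof.
  destruct p as [[[p1 p2] p3] p4], q as [[[q1 q2] q3] q4]. unfold pr1, pr2, pr3, pr4.
  simpl. now intros -> -> -> ->.
Qed.

Lemma mink_pr p q :
  mink p q = pr1 p * pr1 q + pr2 p * pr2 q + pr3 p * pr3 q - pr4 p * pr4 q.
Proof. now destruct p as [[[p1 p2] p3] p4], q as [[[q1 q2] q3] q4]. Qed.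

Lemma mink_comm p q : mink p q = mink q p.
Proof. rewrite !mink_pr. ring. Qed.

Lemma mink_vadd_l p q w : mink (vadd p q) w = mink p w + mink q w.
Proof. rewrite !mink_pr. unfold vadd, pr1, pr2, pr3, pr4. simpl. ring. Qed.

Lemma mink_vscal_l k p w : mink (vscal k p) w = k * mink p w.
Proof. rewrite !mink_pr. unfold vscal, pr1, pr2, pr3, pr4. simpl. ring. Qed.

Lemma mink_vadd_r p q w : mink w (vadd p q) = mink w p + mink w q.
Proof. now rewrite mink_comm, mink_vadd_l, (mink_comm p), (mink_comm q). Qed.

Lemma mink_vscal_r k p w : mink w (vscal k p) = k * mink w p.
Proof. now rewrite mink_comm, mink_vscal_l, (mink_comm p). Qed.

Definition vcomb (a b c d : R) (x y z w : R4) : R4 :=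
  vadd (vadd (vscal a x) (vscal b y)) (vadd (vscal c z) (vscal d w)).

Lemma mink_vcomb_l a b c d x y z w n :
  mink (vcomb a b c d x y z w) n =
  a * mink x n + b * mink y n + c * mink z n + d * mink w n.
Proof. unfold vcomb. rewrite !mink_vadd_l, !mink_vscal_l. ring. Qed.

(** Cramer's rule: each coordinate of r, multiplied by the determinant, is a
    combination of the four products with cofactors as coefficients. *)
Lemma det4_orthogonal_zero (a b c d r : R4) :
  det4 a b c d <> 0 ->
  mink r a = 0 -> mink r b = 0 -> mink r c = 0 -> mink r d = 0 -> r = (0, 0, 0, 0).
Proof.
  destruct a as [[[a1 a2] a3] a4], b as [[[b1 b2] b3] b4], c as [[[c1 c2] c3] c4],
    d as [[[d1 d2] d3] d4], r as [[[r1 r2] r3] r4].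
  unfold mink, det4. set (det := _ - _). intros Hdet Ha Hb Hc Hd.
  assert (E : forall k, k * det = 0 -> k = 0).
  { intros k Hk. apply Rmult_integral in Hk. tauto. }
  assert (r1 = 0 /\ r2 = 0 /\ r3 = 0 /\ r4 = 0) as (-> & -> & -> & ->); [|reflexivity].
  repeat split; apply E; unfold det.
  - transitivity (
      (r1 * a1 + r2 * a2 + r3 * a3 - r4 * a4) * det3 b2 b3 b4 c2 c3 c4 d2 d3 d4
      - (r1 * b1 + r2 * b2 + r3 * b3 - r4 * b4) * det3 a2 a3 a4 c2 c3 c4 d2 d3 d4
      + (r1 * c1 + r2 * c2 + r3 * c3 - r4 * c4) * det3 a2 a3 a4 b2 b3 b4 d2 d3 d4
      - (r1 * d1 + r2 * d2 + r3 * d3 - r4 * d4) * det3 a2 a3 a4 b2 b3 b4 c2 c3 c4).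
    + unfold det3. ring.
    + rewrite Ha, Hb, Hc, Hd. ring.
  - transitivity (
      - (r1 * a1 + r2 * a2 + r3 * a3 - r4 * a4) * det3 b1 b3 b4 c1 c3 c4 d1 d3 d4
      + (r1 * b1 + r2 * b2 + r3 * b3 - r4 * b4) * det3 a1 a3 a4 c1 c3 c4 d1 d3 d4
      - (r1 * c1 + r2 * c2 + r3 * c3 - r4 * c4) * det3 a1 a3 a4 b1 b3 b4 d1 d3 d4
      + (r1 * d1 + r2 * d2 + r3 * d3 - r4 * d4) * det3 a1 a3 a4 b1 b3 b4 c1 c3 c4).
    + unfold det3. ring.
    + rewrite Ha, Hb, Hc, Hd. ring.
  - transitivity (
      (r1 * a1 + r2 * a2 + r3 * a3 - r4 * a4) * det3 b1 b2 b4 c1 c2 c4 d1 d2 d4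
      - (r1 * b1 + r2 * b2 + r3 * b3 - r4 * b4) * det3 a1 a2 a4 c1 c2 c4 d1 d2 d4
      + (r1 * c1 + r2 * c2 + r3 * c3 - r4 * c4) * det3 a1 a2 a4 b1 b2 b4 d1 d2 d4
      - (r1 * d1 + r2 * d2 + r3 * d3 - r4 * d4) * det3 a1 a2 a4 b1 b2 b4 c1 c2 c4).
    + unfold det3. ring.
    + rewrite Ha, Hb, Hc, Hd. ring.
  - transitivity (
      (r1 * a1 + r2 * a2 + r3 * a3 - r4 * a4) * det3 b1 b2 b3 c1 c2 c3 d1 d2 d3
      - (r1 * b1 + r2 * b2 + r3 * b3 - r4 * b4) * det3 a1 a2 a3 c1 c2 c3 d1 d2 d3
      + (r1 * c1 + r2 * c2 + r3 * c3 - r4 * c4) * det3 a1 a2 a3 b1 b2 b3 d1 d2 d3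
      - (r1 * d1 + r2 * d2 + r3 * d3 - r4 * d4) * det3 a1 a2 a3 b1 b2 b3 c1 c2 c3).
    + unfold det3. ring.
    + rewrite Ha, Hb, Hc, Hd. ring.
Qed.

(** Independence of the rows is the preceding lemma for the transposed matrix, in
    which the sign of the metric turns up in the last column. *)
Lemma det4_independent (a b c d : R4) (s1 s2 s3 s4 : R) :
  det4 a b c d <> 0 -> vcomb s1 s2 s3 s4 a b c d = (0, 0, 0, 0) ->
  s1 = 0 /\ s2 = 0 /\ s3 = 0 /\ s4 = 0.
Proof.
  intros Hdet H.
  assert (E : (s1, s2, s3, s4) = (0, 0, 0, 0)).
  { apply (det4_orthogonal_zero (pr1 a, pr1 b, pr1 c, - pr1 d)
      (pr2 a, pr2 b, pr2 c, - pr2 d) (pr3 a, pr3 b, pr3 c, - pr3 d)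
      (pr4 a, pr4 b, pr4 c, - pr4 d)).
    - replace (det4 _ _ _ _) with (- det4 a b c d); [lra|].
      destruct a as [[[a1 a2] a3] a4], b as [[[b1 b2] b3] b4],
        c as [[[c1 c2] c3] c4], d as [[[d1 d2] d3] d4].
      unfold det4, det3, pr1, pr2, pr3, pr4; simpl. ring.
    - apply (f_equal pr1) in H. revert H. unfold mink, vcomb, vadd, vscal, pr1; simpl. lra.
    - apply (f_equal pr2) in H. revert H. unfold mink, vcomb, vadd, vscal, pr2; simpl. lra.
    - apply (f_equal pr3) in H. revert H. unfold mink, vcomb, vadd, vscal, pr3; simpl. lra.
    - apply (f_equal pr4) in H. revert H. unfold mink, vcomb, vadd, vscal, pr4; simpl. lra. }
  injection E. auto.
Qed.

Lemma frame_expansion x y b l w :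
  oriented_orthonormal x y b l ->
  w = vcomb (mink w x) (mink w y) (mink w b) (- mink w l) x y b l.
Proof.
  intros (xx & yy & bb & ll & xy & xb & xl & yb & yl & bl & Hdet).
  set (w' := vcomb _ _ _ _ _ _ _ _).
  assert (H : vadd w (vscal (-1) w') = (0, 0, 0, 0)).
  { apply (det4_orthogonal_zero x y b l).
    - unfold positively_oriented in Hdet. lra.
    - unfold w'. rewrite mink_vadd_l, mink_vscal_l, mink_vcomb_l,
        (mink_comm y x), (mink_comm b x), (mink_comm l x), xx, xy, xb, xl. ring.
    - unfold w'. rewrite mink_vadd_l, mink_vscal_l, mink_vcomb_l,
        (mink_comm b y), (mink_comm l y), yy, xy, yb, yl. ring.
    - unfold w'. rewrite mink_vadd_l, mink_vscal_l, mink_vcomb_l,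
        (mink_comm l b), bb, xb, yb, bl. ring.
    - unfold w'. rewrite mink_vadd_l, mink_vscal_l, mink_vcomb_l,
        ll, xl, yl, bl. ring. }
  apply R4_eq;
    [apply (f_equal pr1) in H|apply (f_equal pr2) in H|
     apply (f_equal pr3) in H|apply (f_equal pr4) in H];
    unfold vadd, vscal, pr1, pr2, pr3, pr4 in *; simpl in *; lra.
Qed.

Lemma frame_ext x y b l w w' :
  oriented_orthonormal x y b l ->
  mink w x = mink w' x -> mink w y = mink w' y ->
  mink w b = mink w' b -> mink w l = mink w' l -> w = w'.
Proof.
  intros Ho H1 H2 H3 H4.
  rewrite (frame_expansion x y b l w Ho), (frame_expansion x y b l w' Ho).
  now rewrite H1, H2, H3, H4.
Qed.

(** The determinant of the metric is -1.  Consequently the determinant of a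
    positively oriented orthonormal frame is not only positive but equal to 1. *)
Lemma det4_gram a b c d :
  det4 a b c d ^ 2 =
  - det4 (mink a a, mink a b, mink a c, mink a d) (mink b a, mink b b, mink b c, mink b d)
      (mink c a, mink c b, mink c c, mink c d) (mink d a, mink d b, mink d c, mink d d).
Proof.
  destruct a as [[[a1 a2] a3] a4], b as [[[b1 b2] b3] b4], c as [[[c1 c2] c3] c4],
    d as [[[d1 d2] d3] d4].
  unfold det4, det3, mink. ring.
Qed.

Lemma oriented_orthonormal_det x y b l :
  oriented_orthonormal x y b l -> det4 x y b l = 1.
Proof.
  intros (xx & yy & bb & ll & xy & xb & xl & yb & yl & bl & Hdet).
  assert (H := det4_gram x y b l).
  rewrite (mink_comm y x), (mink_comm b x), (mink_comm l x), (mink_comm b y),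
    (mink_comm l y), (mink_comm l b), xx, yy, bb, ll, xy, xb, xl, yb, yl, bl in H.
  unfold positively_oriented in Hdet.
  assert (E : det4 x y b l ^ 2 = 1) by (rewrite H; unfold det4, det3; ring).
  nra.
Qed.

(** The timelike vector product, normalized so that it completes x, y, b to a
    positively oriented frame. *)
Definition cross (x y b : R4) : R4 :=
  (- det4 x y b (1, 0, 0, 0), - det4 x y b (0, 1, 0, 0),
   - det4 x y b (0, 0, 1, 0), det4 x y b (0, 0, 0, 1)).

Lemma mink_cross x y b w : mink (cross x y b) w = - det4 x y b w.
Proof.
  destruct x as [[[x1 x2] x3] x4], y as [[[y1 y2] y3] y4], b as [[[b1 b2] b3] b4],
    w as [[[w1 w2] w3] w4].
  unfold cross, mink, det4, det3. ring.
Qed.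

(** Hence l is a polynomial in x, y, b: it is as smooth as they are, and it is fixed
    by them at the base point. *)
Lemma frame_timelike_cross x y b l :
  oriented_orthonormal x y b l -> l = cross x y b.
Proof.
  intros Ho. assert (Hdet := oriented_orthonormal_det x y b l Ho).
  assert (Hrep : det4 x y b x = 0 /\ det4 x y b y = 0 /\ det4 x y b b = 0).
  { destruct x as [[[x1 x2] x3] x4], y as [[[y1 y2] y3] y4], b as [[[b1 b2] b3] b4].
    unfold det4, det3. repeat split; ring. }
  destruct Hrep as (D1 & D2 & D3).
  apply (frame_ext x y b l _ _ Ho); rewrite mink_cross;
    destruct Ho as (xx & yy & bb & ll & xy & xb & xl & yb & yl & bl & _).
  - rewrite mink_comm, D1, xl. ring.
  - rewrite mink_comm, D2, yl. ring.
  - rewrite mink_comm, D3, bl. ring.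
  - rewrite ll, Hdet. ring.
Qed.

(** For two frames F, F' (matrices whose rows are the frame vectors) this is the
    bilinear form of F^T eta F', up to lowering indices; for F' = F orthonormal it is the metric.  Being
    invariant when both frames undergo the same motion, it yields orthonormality
    and uniqueness at once. *)
Definition pairing (x y b l x' y' b' l' n m : R4) : R :=
  mink n x * mink m x' + mink n y * mink m y' + mink n b * mink m b'
  - mink n l * mink m l'.

Lemma mink_nondegenerate w w' : (forall m, mink m w = mink m w') -> w = w'.
Proof.
  intros H.
  assert (H1 := H (1, 0, 0, 0)). assert (H2 := H (0, 1, 0, 0)).
  assert (H3 := H (0, 0, 1, 0)). assert (H4 := H (0, 0, 0, 1)).
  rewrite !mink_pr in H1, H2, H3, H4. unfold pr1, pr2, pr3, pr4 in *.
  simpl in *. apply R4_eq; unfold pr1, pr2, pr3, pr4; lra.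
Qed.

Lemma pairing_vcomb x y b l x' y' b' l' n m :
  pairing x y b l x' y' b' l' n m =
  mink n (vcomb (mink m x') (mink m y') (mink m b') (- mink m l') x y b l).
Proof.
  rewrite (mink_comm n (vcomb _ _ _ _ _ _ _ _)), mink_vcomb_l.
  unfold pairing. rewrite (mink_comm x n), (mink_comm y n), (mink_comm b n), (mink_comm l n).
  ring.
Qed.

Lemma orthonormal_pairing x y b l n m :
  oriented_orthonormal x y b l -> pairing x y b l x y b l n m = mink n m.
Proof. intros Ho. now rewrite pairing_vcomb, <- (frame_expansion x y b l m Ho). Qed.

Lemma vcomb_minus a1 a2 a3 a4 b1 b2 b3 b4 x y b l :
  vcomb a1 a2 a3 a4 x y b l = vcomb b1 b2 b3 b4 x y b l ->
  vcomb (a1 - b1) (a2 - b2) (a3 - b3) (a4 - b4) x y b l = (0, 0, 0, 0).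
Proof.
  intros H.
  assert (H1 := f_equal pr1 H). assert (H2 := f_equal pr2 H).
  assert (H3 := f_equal pr3 H). assert (H4 := f_equal pr4 H).
  unfold vcomb, vadd, vscal, pr1, pr2, pr3, pr4 in *; simpl in *.
  apply R4_eq; unfold pr1, pr2, pr3, pr4; simpl; lra.
Qed.

(** F^T eta F = eta implies F eta F^T = eta, since a left inverse of a square matrix
    is a right inverse. *)
Lemma pairing_orthonormal x y b l :
  0 < det4 x y b l ->
  (forall n m, pairing x y b l x y b l n m = mink n m) -> oriented_orthonormal x y b l.
Proof.
  intros Hdet Hp.
  assert (Hm : forall m e1 e2 e3 e4, m = vcomb e1 e2 e3 e4 x y b l ->
    mink m x = e1 /\ mink m y = e2 /\ mink m b = e3 /\ - mink m l = e4).
  { intros m e1 e2 e3 e4 Hme.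
    assert (E : vcomb (mink m x) (mink m y) (mink m b) (- mink m l) x y b l
      = vcomb e1 e2 e3 e4 x y b l).
    { rewrite <- Hme. apply mink_nondegenerate. intros n.
      now rewrite <- pairing_vcomb. }
    apply vcomb_minus, det4_independent in E; [lra|lra]. }
  assert (V : forall e1 e2 e3 e4 m, pr1 m = pr1 (vcomb e1 e2 e3 e4 x y b l) ->
    pr2 m = pr2 (vcomb e1 e2 e3 e4 x y b l) -> pr3 m = pr3 (vcomb e1 e2 e3 e4 x y b l) ->
    pr4 m = pr4 (vcomb e1 e2 e3 e4 x y b l) -> m = vcomb e1 e2 e3 e4 x y b l)
    by (intros; now apply R4_eq).
  destruct (Hm x 1 0 0 0) as (xx & xy & xb & xl).
  { apply V; unfold vcomb, vadd, vscal, pr1, pr2, pr3, pr4; simpl; ring. }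
  destruct (Hm y 0 1 0 0) as (_ & yy & yb & yl).
  { apply V; unfold vcomb, vadd, vscal, pr1, pr2, pr3, pr4; simpl; ring. }
  destruct (Hm b 0 0 1 0) as (_ & _ & bb & bl).
  { apply V; unfold vcomb, vadd, vscal, pr1, pr2, pr3, pr4; simpl; ring. }
  destruct (Hm l 0 0 0 1) as (_ & _ & _ & ll).
  { apply V; unfold vcomb, vadd, vscal, pr1, pr2, pr3, pr4; simpl; ring. }
  unfold oriented_orthonormal, positively_oriented. repeat split; lra.
Qed.

Lemma pairing_unique x y b l x' y' b' l' :
  oriented_orthonormal x y b l ->
  (forall n m, pairing x y b l x' y' b' l' n m = mink n m) ->
  x' = x /\ y' = y /\ b' = b /\ l' = l.
Proof.
  intros Ho Hp.
  assert (Hdet : det4 x y b l <> 0)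
    by (rewrite (oriented_orthonormal_det x y b l Ho); lra).
  assert (E : forall m, mink m x' = mink m x /\ mink m y' = mink m y /\
    mink m b' = mink m b /\ mink m l' = mink m l).
  { intros m.
    assert (H : vcomb (mink m x') (mink m y') (mink m b') (- mink m l') x y b l
      = vcomb (mink m x) (mink m y) (mink m b) (- mink m l) x y b l).
    { apply mink_nondegenerate. intros n. rewrite <- !pairing_vcomb, Hp.
      now rewrite orthonormal_pairing. }
    apply vcomb_minus, det4_independent in H; [lra|exact Hdet]. }
  repeat split; apply mink_nondegenerate; apply E.
Qed.

(** * Differentiation of vector-valued functions *)

Definition is_derive4 (W : R -> R4) (t : R) (w : R4) : Prop :=
  is_derive (fun s => pr1 (W s)) t (pr1 w) /\
  is_derive (fun s => pr2 (W s)) t (pr2 w) /\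
  is_derive (fun s => pr3 (W s)) t (pr3 w) /\
  is_derive (fun s => pr4 (W s)) t (pr4 w).

Lemma is_derive_eq (f : R -> R) (x a b : R) : is_derive f x a -> a = b -> is_derive f x b.
Proof. now intros H <-. Qed.

Lemma is_derive_Rminus (f g : R -> R) (x a b : R) :
  is_derive f x a -> is_derive g x b -> is_derive (fun t => f t - g t) x (a - b).
Proof. intros Hf Hg. exact (is_derive_minus f g x a b Hf Hg). Qed.

Lemma is_derive4_mink W V t w v :
  is_derive4 W t w -> is_derive4 V t v ->
  is_derive (fun s => mink (W s) (V s)) t (mink w (V t) + mink (W t) v).
Proof.
  intros (W1 & W2 & W3 & W4) (V1 & V2 & V3 & V4).
  apply is_derive_ext with (1 := fun s => eq_sym (mink_pr (W s) (V s))).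
  eapply is_derive_eq.
  - apply is_derive_Rminus; [apply is_derive_Rplus; [apply is_derive_Rplus|]|];
      apply is_derive_Rmult; eassumption.
  - rewrite !mink_pr. ring.
Qed.

Lemma is_derive4_const n t : is_derive4 (fun _ => n) t (0, 0, 0, 0).
Proof. split; [|split; [|split]]; apply @is_derive_const. Qed.

Lemma is_derive4_mink_const n W t w :
  is_derive4 W t w -> is_derive (fun s => mink n (W s)) t (mink n w).
Proof.
  intros H. eapply is_derive_eq.
  - apply (is_derive4_mink (fun _ => n) W t _ w (is_derive4_const n t) H).
  - rewrite !mink_pr. unfold pr1, pr2, pr3, pr4; simpl. ring.
Qed.

Lemma is_derive4_vscal f W t d w :
  is_derive f t d -> is_derive4 W t w ->
  is_derive4 (fun s => vscal (f s) (W s)) t (vadd (vscal d (W t)) (vscal (f t) w)).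
Proof.
  intros Hf (W1 & W2 & W3 & W4).
  split; [|split; [|split]]; unfold vadd, vscal, pr1, pr2, pr3, pr4; simpl;
    apply is_derive_Rmult; assumption.
Qed.

(** The frame moves by an element of the Lie algebra of the Lorentz group; the six
    parameters are the products x'y, x'b, x'l, y'b, y'l, b'l. *)
Definition moves (X Y B L : R -> R4) (t a p q s m k : R) : Prop :=
  is_derive4 X t (vcomb 0 a p (- q) (X t) (Y t) (B t) (L t)) /\
  is_derive4 Y t (vcomb (- a) 0 s (- m) (X t) (Y t) (B t) (L t)) /\
  is_derive4 B t (vcomb (- p) (- s) 0 (- k) (X t) (Y t) (B t) (L t)) /\
  is_derive4 L t (vcomb (- q) (- m) (- k) 0 (X t) (Y t) (B t) (L t)).

Lemma mink_vcomb_r a b c d x y z w n :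
  mink n (vcomb a b c d x y z w) =
  a * mink n x + b * mink n y + c * mink n z + d * mink n w.
Proof.
  rewrite mink_comm, mink_vcomb_l.
  now rewrite (mink_comm x), (mink_comm y), (mink_comm z), (mink_comm w).
Qed.

(** Skewness of the motion with respect to the metric makes the terms cancel in
    pairs. *)
Lemma moves_pairing X Y B L X' Y' B' L' t a p q s m k n n' :
  moves X Y B L t a p q s m k -> moves X' Y' B' L' t a p q s m k ->
  is_derive (fun t => pairing (X t) (Y t) (B t) (L t) (X' t) (Y' t) (B' t) (L' t) n n')
    t 0.
Proof.
  intros (HX & HY & HB & HL) (HX' & HY' & HB' & HL').
  apply (is_derive4_mink_const n) in HX, HY, HB, HL.
  apply (is_derive4_mink_const n') in HX', HY', HB', HL'.
  unfold pairing. eapply is_derive_eq.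
  - apply is_derive_Rminus; [apply is_derive_Rplus; [apply is_derive_Rplus|]|];
      apply is_derive_Rmult; eassumption.
  - rewrite !mink_vcomb_r. ring.
Qed.

Lemma is_derive4_du4 W u v w : is_derive4 (fun s => W s v) u w -> du4 W u v = w.
Proof.
  intros (H1 & H2 & H3 & H4). destruct w as [[[w1 w2] w3] w4].
  unfold du4, du. f_equal; [f_equal; [f_equal|]|]; now apply is_derive_unique.
Qed.

Lemma is_derive4_dv4 W u v w : is_derive4 (fun t => W u t) v w -> dv4 W u v = w.
Proof.
  intros (H1 & H2 & H3 & H4). destruct w as [[[w1 w2] w3] w4].
  unfold dv4, dv. f_equal; [f_equal; [f_equal|]|];
    [now apply (is_derive_unique (fun t => pr1 (W u t)))
    |now apply (is_derive_unique (fun t => pr2 (W u t)))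
    |now apply (is_derive_unique (fun t => pr3 (W u t)))
    |now apply (is_derive_unique (fun t => pr4 (W u t)))].
Qed.

Section Smooth4.

Context (D : R * R -> Prop) (HD : open D).

Lemma smooth4_is_du4 W u v :
  smooth4_on D W -> D (u, v) -> is_derive4 (fun s => W s v) u (du4 W u v).
Proof.
  intros (H1 & H2 & H3 & H4) Huv.
  split; [|split; [|split]]; unfold du4, pr1, pr2, pr3, pr4; simpl;
    [exact (smooth_is_du D _ u v H1 Huv)|exact (smooth_is_du D _ u v H2 Huv)
    |exact (smooth_is_du D _ u v H3 Huv)|exact (smooth_is_du D _ u v H4 Huv)].
Qed.

Lemma smooth4_is_dv4 W u v :
  smooth4_on D W -> D (u, v) -> is_derive4 (fun t => W u t) v (dv4 W u v).
Proof.
  intros (H1 & H2 & H3 & H4) Huv.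
  split; [|split; [|split]]; unfold dv4, pr1, pr2, pr3, pr4; simpl;
    [exact (smooth_is_dv D _ u v H1 Huv)|exact (smooth_is_dv D _ u v H2 Huv)
    |exact (smooth_is_dv D _ u v H3 Huv)|exact (smooth_is_dv D _ u v H4 Huv)].
Qed.

Lemma du4_ext W V u v :
  (forall s t, D (s, t) -> W s t = V s t) -> D (u, v) -> du4 W u v = du4 V u v.
Proof.
  intros H Huv. unfold du4.
  f_equal; [f_equal; [f_equal|]|]; apply (du_ext D HD); auto; intros s t Hst;
    now rewrite H.
Qed.

Lemma dv4_ext W V u v :
  (forall s t, D (s, t) -> W s t = V s t) -> D (u, v) -> dv4 W u v = dv4 V u v.
Proof.
  intros H Huv. unfold dv4.
  f_equal; [f_equal; [f_equal|]|]; apply (dv_ext D HD); auto; intros s t Hst;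
    now rewrite H.
Qed.

Lemma smooth4_ext W V :
  (forall u v, D (u, v) -> W u v = V u v) -> smooth4_on D W -> smooth4_on D V.
Proof.
  intros H (H1 & H2 & H3 & H4).
  split; [|split; [|split]];
    [eapply smooth_ext with (3 := H1)|eapply smooth_ext with (3 := H2)
    |eapply smooth_ext with (3 := H3)|eapply smooth_ext with (3 := H4)]; auto;
    intros u v Huv; simpl; now rewrite H.
Qed.

Lemma smooth4_vadd W V :
  smooth4_on D W -> smooth4_on D V -> smooth4_on D (fun u v => vadd (W u v) (V u v)).
Proof.
  intros (W1 & W2 & W3 & W4) (V1 & V2 & V3 & V4).
  split; [|split; [|split]]; unfold vadd, pr1, pr2, pr3, pr4; simpl;
    now apply smooth_plus.
Qed.

Lemma smooth4_vscal f W :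
  smooth_on D f -> smooth4_on D W -> smooth4_on D (fun u v => vscal (f u v) (W u v)).
Proof.
  intros Hf (W1 & W2 & W3 & W4).
  split; [|split; [|split]]; unfold vscal, pr1, pr2, pr3, pr4; simpl;
    now apply smooth_mult.
Qed.

Lemma smooth4_du4 W : smooth4_on D W -> smooth4_on D (du4 W).
Proof.
  intros (W1 & W2 & W3 & W4).
  split; [|split; [|split]]; unfold du4, pr1, pr2, pr3, pr4; simpl;
    [exact (smooth_du D _ W1)|exact (smooth_du D _ W2)
    |exact (smooth_du D _ W3)|exact (smooth_du D _ W4)].
Qed.

Lemma smooth4_dv4 W : smooth4_on D W -> smooth4_on D (dv4 W).
Proof.
  intros (W1 & W2 & W3 & W4).
  split; [|split; [|split]]; unfold dv4, pr1, pr2, pr3, pr4; simpl;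
    [exact (smooth_dv D _ W1)|exact (smooth_dv D _ W2)
    |exact (smooth_dv D _ W3)|exact (smooth_dv D _ W4)].
Qed.

Lemma smooth_mink W V :
  smooth4_on D W -> smooth4_on D V -> smooth_on D (fun u v => mink (W u v) (V u v)).
Proof.
  intros (W1 & W2 & W3 & W4) (V1 & V2 & V3 & V4).
  apply (smooth_ext D HD) with (1 := fun u v _ => eq_sym (mink_pr (W u v) (V u v))).
  apply smooth_minus; auto. apply smooth_plus; auto. apply smooth_plus; auto.
  all: now apply smooth_mult.
Qed.

Lemma smooth4_const w : smooth4_on D (fun _ _ => w).
Proof. split; [|split; [|split]]; now apply smooth_const. Qed.

Lemma smooth_det4 W1 W2 W3 W4 :
  smooth4_on D W1 -> smooth4_on D W2 -> smooth4_on D W3 -> smooth4_on D W4 ->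
  smooth_on D (fun u v => det4 (W1 u v) (W2 u v) (W3 u v) (W4 u v)).
Proof.
  intros (A1 & A2 & A3 & A4) (B1 & B2 & B3 & B4) (C1 & C2 & C3 & C4) (E1 & E2 & E3 & E4).
  assert (S3 : forall f1 f2 f3 g1 g2 g3 h1 h2 h3,
    smooth_on D f1 -> smooth_on D f2 -> smooth_on D f3 ->
    smooth_on D g1 -> smooth_on D g2 -> smooth_on D g3 ->
    smooth_on D h1 -> smooth_on D h2 -> smooth_on D h3 ->
    smooth_on D (fun u v => det3 (f1 u v) (f2 u v) (f3 u v) (g1 u v) (g2 u v) (g3 u v)
      (h1 u v) (h2 u v) (h3 u v))).
  { intros. unfold det3.
    repeat first [apply (smooth_minus D HD) | apply (smooth_plus D HD)
      | apply (smooth_mult D HD)]; assumption. }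
  apply (smooth_ext D HD) with (fun u v =>
    pr1 (W1 u v) * det3 (pr2 (W2 u v)) (pr3 (W2 u v)) (pr4 (W2 u v))
      (pr2 (W3 u v)) (pr3 (W3 u v)) (pr4 (W3 u v))
      (pr2 (W4 u v)) (pr3 (W4 u v)) (pr4 (W4 u v))
    - pr2 (W1 u v) * det3 (pr1 (W2 u v)) (pr3 (W2 u v)) (pr4 (W2 u v))
      (pr1 (W3 u v)) (pr3 (W3 u v)) (pr4 (W3 u v))
      (pr1 (W4 u v)) (pr3 (W4 u v)) (pr4 (W4 u v))
    + pr3 (W1 u v) * det3 (pr1 (W2 u v)) (pr2 (W2 u v)) (pr4 (W2 u v))
      (pr1 (W3 u v)) (pr2 (W3 u v)) (pr4 (W3 u v))
      (pr1 (W4 u v)) (pr2 (W4 u v)) (pr4 (W4 u v))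
    - pr4 (W1 u v) * det3 (pr1 (W2 u v)) (pr2 (W2 u v)) (pr3 (W2 u v))
      (pr1 (W3 u v)) (pr2 (W3 u v)) (pr3 (W3 u v))
      (pr1 (W4 u v)) (pr2 (W4 u v)) (pr3 (W4 u v))).
  - intros u v _.
    now destruct (W1 u v) as [[[? ?] ?] ?], (W2 u v) as [[[? ?] ?] ?],
      (W3 u v) as [[[? ?] ?] ?], (W4 u v) as [[[? ?] ?] ?].
  - apply (smooth_minus D HD); [apply (smooth_plus D HD); [apply (smooth_minus D HD)|]|];
      apply (smooth_mult D HD); auto.
Qed.

Lemma smooth4_cross X Y B :
  smooth4_on D X -> smooth4_on D Y -> smooth4_on D B ->
  smooth4_on D (fun u v => cross (X u v) (Y u v) (B u v)).
Proof.
  intros HX HY HB.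
  split; [|split; [|split]]; unfold cross, pr1, pr2, pr3, pr4; simpl;
    try apply (smooth_opp D HD); apply smooth_det4; auto using smooth4_const.
Qed.

Lemma du4_vscal f W u v :
  smooth_on D f -> smooth4_on D W -> D (u, v) ->
  du4 (fun s t => vscal (f s t) (W s t)) u v =
  vadd (vscal (du f u v) (W u v)) (vscal (f u v) (du4 W u v)).
Proof.
  intros Hf HW Huv. apply is_derive4_du4.
  apply (is_derive4_vscal (fun s => f s v) (fun s => W s v)).
  - now apply (smooth_is_du D f).
  - now apply smooth4_is_du4.
Qed.

Lemma dv4_vscal f W u v :
  smooth_on D f -> smooth4_on D W -> D (u, v) ->
  dv4 (fun s t => vscal (f s t) (W s t)) u v =
  vadd (vscal (dv f u v) (W u v)) (vscal (f u v) (dv4 W u v)).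
Proof.
  intros Hf HW Huv. apply is_derive4_dv4.
  apply (is_derive4_vscal (fun t => f u t) (fun t => W u t)).
  - now apply (smooth_is_dv D f).
  - now apply smooth4_is_dv4.
Qed.

Lemma smooth4_schwarz W u v :
  smooth4_on D W -> D (u, v) -> du4 (dv4 W) u v = dv4 (du4 W) u v.
Proof.
  intros (W1 & W2 & W3 & W4) Huv.
  assert (E := fun f Hf => smooth_schwarz D HD f u v Hf Huv).
  assert (E1 := E _ W1). assert (E2 := E _ W2). assert (E3 := E _ W3). assert (E4 := E _ W4).
  unfold du4 at 1, dv4 at 5. f_equal; [f_equal; [f_equal|]|]; assumption.
Qed.

Lemma du_mink W V u v :
  smooth4_on D W -> smooth4_on D V -> D (u, v) ->
  du (fun s t => mink (W s t) (V s t)) u v =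
  mink (du4 W u v) (V u v) + mink (W u v) (du4 V u v).
Proof.
  intros HW HV Huv. apply is_derive_unique.
  apply (is_derive4_mink (fun s => W s v) (fun s => V s v)); now apply smooth4_is_du4.
Qed.

Lemma dv_mink W V u v :
  smooth4_on D W -> smooth4_on D V -> D (u, v) ->
  dv (fun s t => mink (W s t) (V s t)) u v =
  mink (dv4 W u v) (V u v) + mink (W u v) (dv4 V u v).
Proof.
  intros HW HV Huv. apply (is_derive_unique (fun t => mink (W u t) (V u t))).
  apply (is_derive4_mink (fun t => W u t) (fun t => V u t)); now apply smooth4_is_dv4.
Qed.

Lemma du_mult f g u v :
  smooth_on D f -> smooth_on D g -> D (u, v) ->
  du (fun s t => f s t * g s t) u v = du f u v * g u v + f u v * du g u v.
Proof.
  intros Hf Hg Huv. apply is_derive_unique.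
  apply (is_derive_Rmult (fun s => f s v) (fun s => g s v)); now apply (smooth_is_du D).
Qed.

Lemma dv_mult f g u v :
  smooth_on D f -> smooth_on D g -> D (u, v) ->
  dv (fun s t => f s t * g s t) u v = dv f u v * g u v + f u v * dv g u v.
Proof.
  intros Hf Hg Huv. apply (is_derive_unique (fun t => f u t * g u t)).
  apply (is_derive_Rmult (fun t => f u t) (fun t => g u t)); now apply (smooth_is_dv D).
Qed.

End Smooth4.

(** * The moving frame of a surface *)

(** The system satisfied by a surface and its geometric frame, with the derivatives
    along u and along v each given as an infinitesimal Lorentz motion. *)
Definition adapted_frame (D : R * R -> Prop)
    (P Q gamma1 gamma2 nu1 nu2 lambda mu beta1 beta2 : R -> R -> R)
    (z X Y B L : R -> R -> R4) : Prop :=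
  forall u v, D (u, v) ->
  oriented_orthonormal (X u v) (Y u v) (B u v) (L u v) /\
  du4 z u v = vscal (P u v) (X u v) /\
  dv4 z u v = vscal (Q u v) (Y u v) /\
  moves (fun s => X s v) (fun s => Y s v) (fun s => B s v) (fun s => L s v) u
    (P u v * gamma1 u v) (P u v * nu1 u v) 0
    (P u v * lambda u v) (P u v * mu u v) (P u v * beta1 u v) /\
  moves (fun t => X u t) (fun t => Y u t) (fun t => B u t) (fun t => L u t) v
    (- (Q u v * gamma2 u v)) (Q u v * lambda u v) (Q u v * mu u v)
    (Q u v * nu2 u v) 0 (Q u v * beta2 u v).

(** The pairing of the two frames is constant, equal to the metric at the centre; so
    the frames coincide, and z' - z has vanishing derivatives. *)
Lemma adapted_frame_rigid u0 v0 r P Q gamma1 gamma2 nu1 nu2 lambda mu beta1 beta2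
    z X Y B L z' X' Y' B' L' :
  0 < r ->
  smooth4_on (square u0 v0 r) z -> smooth4_on (square u0 v0 r) z' ->
  adapted_frame (square u0 v0 r) P Q gamma1 gamma2 nu1 nu2 lambda mu beta1 beta2
    z X Y B L ->
  adapted_frame (square u0 v0 r) P Q gamma1 gamma2 nu1 nu2 lambda mu beta1 beta2
    z' X' Y' B' L' ->
  z' u0 v0 = z u0 v0 -> X' u0 v0 = X u0 v0 -> Y' u0 v0 = Y u0 v0 ->
  B' u0 v0 = B u0 v0 -> L' u0 v0 = L u0 v0 ->
  forall u v, square u0 v0 r (u, v) -> z' u v = z u v.
Proof.
  intros Hr Sz Sz' HF HF' Ez EX EY EB EL.
  assert (Hc := square_center u0 v0 r Hr).
  assert (Hfr : forall u v, square u0 v0 r (u, v) -> X' u v = X u v /\ Y' u v = Y u v).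
  { intros u v Huv. destruct (HF u v Huv) as (Ho & _).
    destruct (pairing_unique _ _ _ _ (X' u v) (Y' u v) (B' u v) (L' u v) Ho) as (? & ? & _);
      [|auto].
    intros n m.
    rewrite (square_constant u0 v0 r (fun u v => pairing (X u v) (Y u v) (B u v) (L u v)
      (X' u v) (Y' u v) (B' u v) (L' u v) n m) u v); [|intros s t Hst|exact Huv].
    - rewrite EX, EY, EB, EL. apply orthonormal_pairing, (HF u0 v0 Hc).
    - destruct (HF s t Hst) as (_ & _ & _ & M1 & M2).
      destruct (HF' s t Hst) as (_ & _ & _ & M1' & M2').
      split; eapply moves_pairing; eassumption. }
  assert (Hz : forall s t, square u0 v0 r (s, t) ->
    du4 z' s t = du4 z s t /\ dv4 z' s t = dv4 z s t).
  { intros s t Hst. destruct (HF s t Hst) as (_ & -> & -> & _).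
    destruct (HF' s t Hst) as (_ & -> & -> & _).
    now destruct (Hfr s t Hst) as [-> ->]. }
  intros u v Huv. apply mink_nondegenerate. intros m. apply Rminus_diag_uniq.
  rewrite (square_constant u0 v0 r (fun u v => mink m (z' u v) - mink m (z u v)) u v);
    [rewrite Ez; ring|intros s t Hst|exact Huv].
  destruct (Hz s t Hst) as [Hu Hv]. split.
  - eapply is_derive_eq; [apply is_derive_Rminus|].
    + apply (is_derive4_mink_const m (fun s => z' s t)).
      apply (smooth4_is_du4 _ z' s t Sz' Hst).
    + apply (is_derive4_mink_const m (fun s => z s t)).
      apply (smooth4_is_du4 _ z s t Sz Hst).
    + rewrite Hu. ring.
  - eapply is_derive_eq; [apply is_derive_Rminus|].
    + apply (is_derive4_mink_const m (fun t => z' s t)).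
      apply (smooth4_is_dv4 _ z' s t Sz' Hst).
    + apply (is_derive4_mink_const m (fun t => z s t)).
      apply (smooth4_is_dv4 _ z s t Sz Hst).
    + rewrite Hv. ring.
Qed.

(** * Geometry read off from an adapted frame *)

Lemma vscal_vscal j k w : vscal j (vscal k w) = vscal (j * k) w.
Proof.
  unfold vscal, pr1, pr2, pr3, pr4; simpl. f_equal; [f_equal; [f_equal|]|]; ring.
Qed.

Lemma vscal_1 w : vscal 1 w = w.
Proof. apply R4_eq; unfold vscal, pr1, pr2, pr3, pr4; simpl; ring. Qed.

Lemma vadd_vscal_0_r v k w : vadd (vscal k v) (vscal 0 w) = vscal k v.
Proof. apply R4_eq; unfold vadd, vscal, pr1, pr2, pr3, pr4; simpl; ring. Qed.

Lemma vadd_vscal_0_l v k w : vadd (vscal 0 w) (vscal k v) = vscal k v.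
Proof. apply R4_eq; unfold vadd, vscal, pr1, pr2, pr3, pr4; simpl; ring. Qed.

Lemma nabla'_xdir z W u v :
  nabla' (xdir z) W u v = vscal (1 / sqrt (fE z u v)) (du4 W u v).
Proof. apply vadd_vscal_0_r. Qed.

Lemma nabla'_ydir z W u v :
  nabla' (ydir z) W u v = vscal (1 / sqrt (fG z u v)) (dv4 W u v).
Proof. apply vadd_vscal_0_l. Qed.

Lemma frame_x_eq z u v : frame_x z u v = vscal (1 / sqrt (fE z u v)) (du4 z u v).
Proof. apply vadd_vscal_0_r. Qed.

Lemma frame_y_eq z u v : frame_y z u v = vscal (1 / sqrt (fG z u v)) (dv4 z u v).
Proof. apply vadd_vscal_0_l. Qed.

(** In a frame, removing the tangential part amounts to keeping the b and l
    coordinates; the Gram matrix is diag (P^2, Q^2). *)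
Lemma normal_part_frame z u v w P Q x y b l :
  P <> 0 -> Q <> 0 -> oriented_orthonormal x y b l ->
  du4 z u v = vscal P x -> dv4 z u v = vscal Q y ->
  normal_part z u v w = vcomb 0 0 (mink w b) (- mink w l) x y b l.
Proof.
  intros HP HQ Ho Hu Hv. apply (frame_ext x y b l _ _ Ho);
    destruct Ho as (xx & yy & bb & ll & xy & xb & xl & yb & yl & bl & _);
    unfold normal_part, fE, fF, fG; rewrite Hu, Hv;
    rewrite ?mink_vcomb_l, ?mink_vadd_l, ?mink_vscal_l, ?mink_vscal_r,
      ?(mink_comm y x), ?(mink_comm b x), ?(mink_comm l x), ?(mink_comm b y),
      ?(mink_comm l y), ?(mink_comm l b), ?xx, ?yy, ?bb, ?ll, ?xy, ?xb, ?xl, ?yb, ?yl, ?bl;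
    field; auto.
Qed.

(** Expands inner products of combinations of the vectors of an orthonormal frame. *)
Ltac use_products Ho :=
  let xx := fresh in let yy := fresh in let bb := fresh in let ll := fresh in
  let xy := fresh in let xb := fresh in let xl := fresh in let yb := fresh in
  let yl := fresh in let bl := fresh in
  destruct Ho as (xx & yy & bb & ll & xy & xb & xl & yb & yl & bl & _);
  match type of xy with mink ?x ?y = _ =>
  match type of bl with mink ?b ?l = _ =>
  rewrite ?mink_vadd_l, ?mink_vadd_r, ?mink_vscal_l, ?mink_vscal_r,
    ?mink_vadd_l, ?mink_vadd_r, ?mink_vscal_l, ?mink_vscal_r,
    ?mink_vcomb_l, ?mink_vcomb_r, ?(mink_comm y x), ?(mink_comm b x),
    ?(mink_comm l x), ?(mink_comm b y), ?(mink_comm l y), ?(mink_comm l b),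
    ?xx, ?yy, ?bb, ?ll, ?xy, ?xb, ?xl, ?yb, ?yl, ?bl
  end end.

Section SurfaceOfFrame.

Context (D : R * R -> Prop) (HD : open D).
Context (P Q gamma1 gamma2 nu1 nu2 lambda mu beta1 beta2 : R -> R -> R).
Context (z X Y B L : R -> R -> R4).
Context (HF : adapted_frame D P Q gamma1 gamma2 nu1 nu2 lambda mu beta1 beta2 z X Y B L).
Context (SP : smooth_on D P) (SQ : smooth_on D Q).
Context (Sz : smooth4_on D z) (SX : smooth4_on D X) (SY : smooth4_on D Y).
Context (HP : forall u v, D (u, v) -> 0 < P u v) (HQ : forall u v, D (u, v) -> 0 < Q u v).
Context (HPv : forall u v, D (u, v) -> dv P u v = - gamma1 u v * P u v * Q u v).
Context (HQu : forall u v, D (u, v) -> du Q u v = - gamma2 u v * P u v * Q u v).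
Context (Hnu : forall u v, D (u, v) -> 0 < nu1 u v + nu2 u v).

Lemma frame_fE u v : D (u, v) -> fE z u v = P u v ^ 2.
Proof.
  intros Huv. destruct (HF u v Huv) as (Ho & Hu & _). unfold fE.
  rewrite Hu, mink_vscal_l, mink_vscal_r, (proj1 Ho). ring.
Qed.

Lemma frame_fG u v : D (u, v) -> fG z u v = Q u v ^ 2.
Proof.
  intros Huv. destruct (HF u v Huv) as (Ho & _ & Hv & _). unfold fG.
  rewrite Hv, mink_vscal_l, mink_vscal_r, (proj1 (proj2 Ho)). ring.
Qed.

Lemma frame_fF u v : D (u, v) -> fF z u v = 0.
Proof.
  intros Huv. destruct (HF u v Huv) as (Ho & Hu & Hv & _). unfold fF.
  destruct Ho as (_ & _ & _ & _ & xy & _).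
  rewrite Hu, Hv, mink_vscal_l, mink_vscal_r, xy. ring.
Qed.

Lemma frame_sqrt_fE u v : D (u, v) -> sqrt (fE z u v) = P u v.
Proof. intros Huv. rewrite frame_fE by exact Huv. apply sqrt_pow2. left; auto. Qed.

Lemma frame_sqrt_fG u v : D (u, v) -> sqrt (fG z u v) = Q u v.
Proof. intros Huv. rewrite frame_fG by exact Huv. apply sqrt_pow2. left; auto. Qed.

Lemma frame_x_is u v : D (u, v) -> frame_x z u v = X u v.
Proof.
  intros Huv. destruct (HF u v Huv) as (_ & Hu & _).
  rewrite frame_x_eq, frame_sqrt_fE, Hu, vscal_vscal by exact Huv.
  rewrite <- (vscal_1 (X u v)) at 2. f_equal. field. apply Rgt_not_eq, HP, Huv.
Qed.

Lemma frame_y_is u v : D (u, v) -> frame_y z u v = Y u v.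
Proof.
  intros Huv. destruct (HF u v Huv) as (_ & _ & Hv & _).
  rewrite frame_y_eq, frame_sqrt_fG, Hv, vscal_vscal by exact Huv.
  rewrite <- (vscal_1 (Y u v)) at 2. f_equal. field. apply Rgt_not_eq, HQ, Huv.
Qed.

Lemma frame_spacelike : spacelike D z.
Proof.
  intros u v Huv a c Hac. cbv zeta.
  rewrite mink_vadd_l, !mink_vadd_r, !mink_vscal_l, !mink_vscal_r.
  assert (H1 := frame_fE u v Huv). assert (H2 := frame_fF u v Huv).
  assert (H3 := frame_fG u v Huv). unfold fE, fF, fG in *.
  rewrite (mink_comm (dv4 z u v) (du4 z u v)), H1, H2, H3.
  assert (p := HP u v Huv). assert (q := HQ u v Huv).
  replace (_ + _) with ((a * P u v) ^ 2 + (c * Q u v) ^ 2) by ring.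
  assert (n1 := pow2_ge_0 (a * P u v)). assert (n2 := pow2_ge_0 (c * Q u v)).
  destruct (Req_dec a 0) as [->|Ha].
  - assert (Hc : c <> 0) by (intros ->; auto).
    assert (0 < (c * Q u v) ^ 2); [|lra].
    apply pow2_gt_0. apply Rmult_integral_contrapositive. split; lra.
  - assert (0 < (a * P u v) ^ 2); [|lra].
    apply pow2_gt_0. apply Rmult_integral_contrapositive. split; lra.
Qed.

(** Up to tangential terms, z_uu = P^2 nu1 b and z_vv = Q^2 nu2 b: both are collinear
    with b, whatever the normal frame in which M is computed. *)
Lemma frame_principal : principal D z.
Proof.
  intros u v Huv. split; [now apply frame_fF|].
  intros n1 n2 (N1 & N2 & N3 & N4 & _).
  assert (HF' := HF u v Huv).
  destruct HF' as (Ho & Hu & Hv & (MX & _) & (_ & MY & _)).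
  assert (p := HP u v Huv). assert (q := HQ u v Huv).
  unfold fM. rewrite Hu in N1, N3. rewrite Hv in N2, N4.
  rewrite mink_vscal_l in N1, N2, N3, N4.
  assert (X1 : mink (X u v) n1 = 0) by (apply Rmult_integral in N1; lra).
  assert (Y1 : mink (Y u v) n1 = 0) by (apply Rmult_integral in N2; lra).
  assert (X2 : mink (X u v) n2 = 0) by (apply Rmult_integral in N3; lra).
  assert (Y2 : mink (Y u v) n2 = 0) by (apply Rmult_integral in N4; lra).
  rewrite (du4_ext D HD (du4 z) (fun s t => vscal (P s t) (X s t)) u v), (du4_vscal D),
    (dv4_ext D HD (dv4 z) (fun s t => vscal (Q s t) (Y s t)) u v), (dv4_vscal D);
    auto; [|intros s t Hst; apply (HF s t Hst)|intros s t Hst; apply (HF s t Hst)].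
  apply is_derive4_du4 in MX. apply is_derive4_dv4 in MY. rewrite MX, MY.
  rewrite !mink_vadd_l, !mink_vscal_l, !mink_vcomb_l, X1, X2, Y1, Y2.
  set (k := 1 / _). ring.
Qed.

Lemma frame_push_x s t : D (s, t) -> push z (xdir z) s t = X s t.
Proof. apply frame_x_is. Qed.

Lemma frame_push_y s t : D (s, t) -> push z (ydir z) s t = Y s t.
Proof. apply frame_y_is. Qed.

Lemma frame_sigma u v : D (u, v) ->
  Defs.sigma z (xdir z) (xdir z) u v =
    vcomb 0 0 (nu1 u v) 0 (X u v) (Y u v) (B u v) (L u v) /\
  Defs.sigma z (xdir z) (ydir z) u v =
    vcomb 0 0 (lambda u v) (- mu u v) (X u v) (Y u v) (B u v) (L u v) /\
  Defs.sigma z (ydir z) (ydir z) u v =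
    vcomb 0 0 (nu2 u v) 0 (X u v) (Y u v) (B u v) (L u v).
Proof.
  intros Huv. assert (HF' := HF u v Huv).
  destruct HF' as (Ho & Hu & Hv & (MX & MY & _) & (_ & MY' & _)).
  assert (p := HP u v Huv). assert (q := HQ u v Huv).
  apply is_derive4_du4 in MX, MY. apply is_derive4_dv4 in MY'.
  assert (N := fun w => normal_part_frame z u v w (P u v) (Q u v)
    _ _ _ _ (Rgt_not_eq _ _ p) (Rgt_not_eq _ _ q) Ho Hu Hv).
  unfold Defs.sigma. rewrite !N, !nabla'_xdir, !nabla'_ydir.
  rewrite (du4_ext D HD (push z (xdir z)) X u v frame_push_x Huv).
  rewrite (du4_ext D HD (push z (ydir z)) Y u v frame_push_y Huv).
  rewrite (dv4_ext D HD (push z (ydir z)) Y u v frame_push_y Huv).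
  rewrite MX, MY, MY', (frame_sqrt_fE u v Huv), (frame_sqrt_fG u v Huv).
  split; [|split]; f_equal; use_products Ho; field; lra.
Qed.

Lemma frame_Hvec u v : D (u, v) ->
  Hvec z u v = vscal ((nu1 u v + nu2 u v) / 2) (B u v).
Proof.
  intros Huv. destruct (frame_sigma u v Huv) as (Sxx & _ & Syy).
  unfold Hvec, mean_curvature. rewrite Sxx, Syy.
  apply R4_eq; unfold vcomb, vadd, vscal, pr1, pr2, pr3, pr4; simpl; field.
Qed.

Lemma frame_mink_Hvec u v : D (u, v) ->
  mink (Hvec z u v) (Hvec z u v) = ((nu1 u v + nu2 u v) / 2) ^ 2.
Proof.
  intros Huv. destruct (HF u v Huv) as ((_ & _ & bb & _) & _).
  rewrite (frame_Hvec u v Huv), mink_vscal_l, mink_vscal_r, bb. ring.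
Qed.

(** Positivity of nu1 + nu2 selects b among the two unit vectors collinear with the
    mean curvature vector. *)
Lemma frame_b_is u v : D (u, v) -> frame_b z u v = B u v.
Proof.
  intros Huv. unfold frame_b. rewrite (frame_mink_Hvec u v Huv), (frame_Hvec u v Huv).
  assert (Hn := Hnu u v Huv). rewrite sqrt_pow2 by lra. rewrite vscal_vscal.
  rewrite <- (vscal_1 (B u v)) at 2. f_equal. field. lra.
Qed.

Lemma frame_geometric_frame u v : D (u, v) ->
  geometric_frame z u v (X u v) (Y u v) (B u v) (L u v).
Proof.
  intros Huv. split; [|split; [|split]]; [symmetry..|].
  - now apply frame_x_is.
  - now apply frame_y_is.
  - now apply frame_b_is.
  - apply (HF u v Huv).
Qed.

Lemma frame_geometric_functions :
  geometric_functions D z gamma1 gamma2 nu1 nu2 lambda mu beta1 beta2.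
Proof.
  exists L. intros u v Huv. cbv zeta.
  assert (p := HP u v Huv). assert (q := HQ u v Huv).
  split.
  { rewrite (frame_x_is u v Huv), (frame_y_is u v Huv), (frame_b_is u v Huv).
    now apply frame_geometric_frame. }
  destruct (frame_sigma u v Huv) as (Sxx & Sxy & Syy).
  assert (HF' := HF u v Huv).
  destruct HF' as (Ho & _ & _ & (_ & _ & MB & _) & (_ & _ & MB' & _)).
  apply is_derive4_du4 in MB. apply is_derive4_dv4 in MB'.
  rewrite Sxx, Sxy, Syy, (frame_b_is u v Huv), nabla'_xdir, nabla'_ydir.
  rewrite (du4_ext D HD (frame_b z) B u v frame_b_is Huv).
  rewrite (dv4_ext D HD (frame_b z) B u v frame_b_is Huv).
  rewrite MB, MB', (frame_sqrt_fE u v Huv), (frame_sqrt_fG u v Huv).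
  split; [|split; [|split; [|split; [|split; [|split; [|split]]]]]].
  - use_products Ho. ring.
  - use_products Ho. ring.
  - use_products Ho. ring.
  - use_products Ho. ring.
  - unfold dir, ydir; simpl.
    rewrite (dv_ext D HD (fun s t => ln (sqrt (fE z s t))) (fun s t => ln (P s t)) u v);
      [|intros s t Hst; now rewrite frame_sqrt_fE|exact Huv].
    replace (dv (fun s t => ln (P s t)) u v) with (dv P u v / P u v).
    + rewrite (HPv u v Huv), (frame_sqrt_fG u v Huv). field. lra.
    + symmetry. apply (is_derive_unique (fun t => ln (P u t))).
      apply (is_derive_comp ln (fun t => P u t)).
      * now apply is_derive_ln.
      * now apply (smooth_is_dv D).
  - unfold dir, xdir; simpl.
    rewrite (du_ext D HD (fun s t => ln (sqrt (fG z s t))) (fun s t => ln (Q s t)) u v);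
      [|intros s t Hst; now rewrite frame_sqrt_fG|exact Huv].
    replace (du (fun s t => ln (Q s t)) u v) with (du Q u v / Q u v).
    + rewrite (HQu u v Huv), (frame_sqrt_fE u v Huv). field. lra.
    + symmetry. apply (is_derive_unique (fun s => ln (Q s v))).
      apply (is_derive_comp ln (fun s => Q s v)).
      * now apply is_derive_ln.
      * now apply (smooth_is_du D).
  - use_products Ho. field. lra.
  - use_products Ho. field. lra.
Qed.

Lemma frame_surface_with_data u0 v0 :
  D (u0, v0) ->
  surface_with_data D u0 v0 (z u0 v0) (X u0 v0) (Y u0 v0) (B u0 v0) (L u0 v0)
    gamma1 gamma2 nu1 nu2 lambda mu beta1 beta2 z.
Proof.
  intros H0. split; [exact Sz|]. split; [exact frame_spacelike|].
  split; [exact frame_principal|]. split.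
  { intros u v Huv. rewrite (frame_mink_Hvec u v Huv).
    assert (Hn := Hnu u v Huv). apply pow_lt. lra. }
  split; [reflexivity|]. split; [exact frame_geometric_functions|].
  now apply frame_geometric_frame.
Qed.

End SurfaceOfFrame.

(** * The adapted frame of a surface with given geometric functions *)

Lemma mink_constant_derive (W V : R -> R4) t w v c :
  is_derive4 W t w -> is_derive4 V t v ->
  locally t (fun s => mink (W s) (V s) = c) ->
  mink w (V t) = - mink v (W t).
Proof.
  intros HW HV Hc. assert (H := is_derive4_mink W V t w v HW HV).
  assert (H0 : is_derive (fun s => mink (W s) (V s)) t 0).
  { apply (is_derive_ext_loc (fun _ => c)); [|apply @is_derive_const].
    refine (filter_imp _ _ _ Hc). now intros s ->. }
  apply is_derive_unique in H. apply is_derive_unique in H0.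
  rewrite (mink_comm v). rewrite H in H0. lra.
Qed.

(** The frame being orthonormal near t, the matrix of its derivative is skew, so the
    six products above the diagonal determine it. *)
Lemma orthonormal_moves (X Y B L : R -> R4) t x' y' b' l' :
  locally t (fun s => oriented_orthonormal (X s) (Y s) (B s) (L s)) ->
  is_derive4 X t x' -> is_derive4 Y t y' -> is_derive4 B t b' -> is_derive4 L t l' ->
  moves X Y B L t (mink x' (Y t)) (mink x' (B t)) (mink x' (L t))
    (mink y' (B t)) (mink y' (L t)) (mink b' (L t)).
Proof.
  intros Hloc HX HY HB HL. assert (Ho := locally_singleton _ _ Hloc).
  assert (C : forall W V w v c, is_derive4 W t w -> is_derive4 V t v ->
    (forall s, oriented_orthonormal (X s) (Y s) (B s) (L s) -> mink (W s) (V s) = c) ->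
    mink w (V t) = - mink v (W t)).
  { intros W V w v c HW HV Hc. apply (mink_constant_derive W V t w v c HW HV).
    refine (filter_imp _ _ _ Hloc). exact Hc. }
  assert (xx := C X X _ _ 1 HX HX ltac:(unfold oriented_orthonormal; tauto)).
  assert (yy := C Y Y _ _ 1 HY HY ltac:(unfold oriented_orthonormal; tauto)).
  assert (bb := C B B _ _ 1 HB HB ltac:(unfold oriented_orthonormal; tauto)).
  assert (ll := C L L _ _ (-1) HL HL ltac:(unfold oriented_orthonormal; tauto)).
  assert (yx := C Y X _ _ 0 HY HX ltac:(intros; rewrite mink_comm; unfold oriented_orthonormal in *; tauto)).
  assert (bx := C B X _ _ 0 HB HX ltac:(intros; rewrite mink_comm; unfold oriented_orthonormal in *; tauto)).
  assert (lx := C L X _ _ 0 HL HX ltac:(intros; rewrite mink_comm; unfold oriented_orthonormal in *; tauto)).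
  assert (by_ := C B Y _ _ 0 HB HY ltac:(intros; rewrite mink_comm; unfold oriented_orthonormal in *; tauto)).
  assert (ly := C L Y _ _ 0 HL HY ltac:(intros; rewrite mink_comm; unfold oriented_orthonormal in *; tauto)).
  assert (lb := C L B _ _ 0 HL HB ltac:(intros; rewrite mink_comm; unfold oriented_orthonormal in *; tauto)).
  unfold moves.
  match goal with |- is_derive4 X t ?a /\ is_derive4 Y t ?b /\ is_derive4 B t ?c
      /\ is_derive4 L t ?d =>
    assert (E1 : a = x'); [|assert (E2 : b = y'); [|assert (E3 : c = b');
      [|assert (E4 : d = l'); [|rewrite E1, E2, E3, E4; auto]]]]
  end; apply (frame_ext _ _ _ _ _ _ Ho); use_products Ho; lra.
Qed.

Section FrameOfSurface.

Context (D : R * R -> Prop) (HD : open D).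
Context (gamma1 gamma2 nu1 nu2 lambda mu beta1 beta2 : R -> R -> R).
Context (Smu : smooth_on D mu).
Context (z L : R -> R -> R4).
Context (Sz : smooth4_on D z) (Hsp : spacelike D z) (Hpr : principal D z).
Context (HH : forall u v, D (u, v) -> 0 < mink (Hvec z u v) (Hvec z u v)).
Context (HL : forall u v, D (u, v) ->
    let b := frame_b z in
    geometric_frame z u v (frame_x z u v) (frame_y z u v) (b u v) (L u v) /\
    nu1 u v = mink (Defs.sigma z (xdir z) (xdir z) u v) (b u v) /\
    nu2 u v = mink (Defs.sigma z (ydir z) (ydir z) u v) (b u v) /\
    lambda u v = mink (Defs.sigma z (xdir z) (ydir z) u v) (b u v) /\
    mu u v = mink (Defs.sigma z (xdir z) (ydir z) u v) (L u v) /\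
    gamma1 u v = - dir (ydir z) (fun s t => ln (sqrt (fE z s t))) u v /\
    gamma2 u v = - dir (xdir z) (fun s t => ln (sqrt (fG z s t))) u v /\
    beta1 u v = mink (nabla' (xdir z) b u v) (L u v) /\
    beta2 u v = mink (nabla' (ydir z) b u v) (L u v)).
Context (Hnu : forall u v, D (u, v) -> 0 < nu1 u v + nu2 u v).

Let P (u v : R) : R := sqrt (fE z u v).
Let Q (u v : R) : R := sqrt (fG z u v).
Let X : R -> R -> R4 := frame_x z.
Let Y : R -> R -> R4 := frame_y z.
Let B : R -> R -> R4 := frame_b z.

Lemma spacelike_fE u v : D (u, v) -> 0 < fE z u v.
Proof.
  intros Huv. assert (H := Hsp u v Huv 1 0). cbv zeta in H.
  rewrite vadd_vscal_0_r, vscal_1 in H. apply H. intros E. injection E. lra.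
Qed.

Lemma spacelike_fG u v : D (u, v) -> 0 < fG z u v.
Proof.
  intros Huv. assert (H := Hsp u v Huv 0 1). cbv zeta in H.
  rewrite vadd_vscal_0_l, vscal_1 in H. apply H. intros E. injection E. lra.
Qed.

Lemma surface_P_pos u v : D (u, v) -> 0 < P u v.
Proof. intros Huv. now apply sqrt_lt_R0, spacelike_fE. Qed.

Lemma surface_Q_pos u v : D (u, v) -> 0 < Q u v.
Proof. intros Huv. now apply sqrt_lt_R0, spacelike_fG. Qed.

Lemma surface_smooth_fE : smooth_on D (fE z).
Proof. apply (smooth_mink D HD); now apply smooth4_du4. Qed.

Lemma surface_smooth_fF : smooth_on D (fF z).
Proof. apply (smooth_mink D HD); [now apply smooth4_du4|now apply smooth4_dv4]. Qed.

Lemma surface_smooth_fG : smooth_on D (fG z).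
Proof. apply (smooth_mink D HD); now apply smooth4_dv4. Qed.

Lemma surface_smooth_P : smooth_on D P.
Proof. apply (smooth_sqrt D HD (fE z)); [apply spacelike_fE|apply surface_smooth_fE]. Qed.

Lemma surface_smooth_Q : smooth_on D Q.
Proof. apply (smooth_sqrt D HD (fG z)); [apply spacelike_fG|apply surface_smooth_fG]. Qed.

Lemma surface_smooth_inv_P : smooth_on D (fun u v => 1 / P u v).
Proof.
  apply (smooth_div D HD (fun _ _ => 1) P).
  - intros u v Huv. apply Rgt_not_eq, surface_P_pos, Huv.
  - now apply smooth_const.
  - apply surface_smooth_P.
Qed.

Lemma surface_smooth_inv_Q : smooth_on D (fun u v => 1 / Q u v).
Proof.
  apply (smooth_div D HD (fun _ _ => 1) Q).
  - intros u v Huv. apply Rgt_not_eq, surface_Q_pos, Huv.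
  - now apply smooth_const.
  - apply surface_smooth_Q.
Qed.

Lemma surface_smooth_X : smooth4_on D X.
Proof.
  apply (smooth4_ext D HD) with (1 := fun u v _ => eq_sym (frame_x_eq z u v)).
  apply (smooth4_vscal D HD); [apply surface_smooth_inv_P|now apply smooth4_du4].
Qed.

Lemma surface_smooth_Y : smooth4_on D Y.
Proof.
  apply (smooth4_ext D HD) with (1 := fun u v _ => eq_sym (frame_y_eq z u v)).
  apply (smooth4_vscal D HD); [apply surface_smooth_inv_Q|now apply smooth4_dv4].
Qed.

Lemma smooth4_normal_part W :
  smooth4_on D W -> smooth4_on D (fun u v => normal_part z u v (W u v)).
Proof.
  intros HW. assert (Zu := smooth4_du4 D z Sz). assert (Zv := smooth4_dv4 D z Sz).
  assert (SE := surface_smooth_fE). assert (SF := surface_smooth_fF).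
  assert (SG := surface_smooth_fG).
  assert (Wu := smooth_mink D HD W _ HW Zu). assert (Wv := smooth_mink D HD W _ HW Zv).
  assert (Sden : smooth_on D (fun u v => fE z u v * fG z u v - fF z u v ^ 2)).
  { apply (smooth_minus D HD (fun u v => fE z u v * fG z u v) (fun u v => fF z u v ^ 2)).
    - now apply smooth_mult.
    - apply (smooth_ext D HD (fun u v => fF z u v * fF z u v)); [intros; ring|].
      now apply smooth_mult. }
  assert (Hden : forall u v, D (u, v) -> fE z u v * fG z u v - fF z u v ^ 2 <> 0).
  { intros u v Huv. rewrite (proj1 (Hpr u v Huv)).
    assert (HE := spacelike_fE u v Huv). assert (HG := spacelike_fG u v Huv). nra. }
  assert (Sq : forall f g h k, smooth_on D f -> smooth_on D g -> smooth_on D h ->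
    smooth_on D k -> smooth_on D (fun u v => - ((f u v * g u v - h u v * k u v)
      / (fE z u v * fG z u v - fF z u v ^ 2)))).
  { intros f g h k Hf Hg Hh Hk. apply (smooth_opp D HD).
    apply (smooth_div D HD (fun u v => f u v * g u v - h u v * k u v)); auto.
    apply (smooth_minus D HD (fun u v => f u v * g u v) (fun u v => h u v * k u v));
      now apply smooth_mult. }
  unfold normal_part.
  apply (smooth4_vadd D HD W); [exact HW|]. apply (smooth4_vadd D HD).
  - apply (smooth4_vscal D HD); [|exact Zu].
    now apply (Sq (fG z) (fun u v => mink (W u v) (du4 z u v)) (fF z)
      (fun u v => mink (W u v) (dv4 z u v))).
  - apply (smooth4_vscal D HD); [|exact Zv].
    now apply (Sq (fE z) (fun u v => mink (W u v) (dv4 z u v)) (fF z)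
      (fun u v => mink (W u v) (du4 z u v))).
Qed.

Lemma surface_smooth_Hvec : smooth4_on D (Hvec z).
Proof.
  apply (smooth4_vscal D HD (fun _ _ => 1 / 2)); [now apply smooth_const|].
  apply (smooth4_vadd D HD); apply smooth4_normal_part.
  - apply (smooth4_ext D HD) with
      (1 := fun u v _ => eq_sym (nabla'_xdir z (push z (xdir z)) u v)).
    apply (smooth4_vscal D HD); [apply surface_smooth_inv_P|].
    apply smooth4_du4, surface_smooth_X.
  - apply (smooth4_ext D HD) with
      (1 := fun u v _ => eq_sym (nabla'_ydir z (push z (ydir z)) u v)).
    apply (smooth4_vscal D HD); [apply surface_smooth_inv_Q|].
    apply smooth4_dv4, surface_smooth_Y.
Qed.

Lemma surface_smooth_B : smooth4_on D B.
Proof.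
  assert (S := surface_smooth_Hvec).
  assert (S2 := smooth_mink D HD _ _ S S).
  apply (smooth4_vscal D HD (fun u v => 1 / sqrt (mink (Hvec z u v) (Hvec z u v))));
    [|exact S].
  apply (smooth_div D HD (fun _ _ => 1) (fun u v => sqrt (mink (Hvec z u v) (Hvec z u v)))).
  - intros u v Huv. apply Rgt_not_eq, sqrt_lt_R0, HH, Huv.
  - now apply smooth_const.
  - now apply smooth_sqrt.
Qed.

Lemma surface_orthonormal u v :
  D (u, v) -> oriented_orthonormal (X u v) (Y u v) (B u v) (L u v).
Proof. intros Huv. apply (HL u v Huv). Qed.

Lemma surface_smooth_L : smooth4_on D L.
Proof.
  apply (smooth4_ext D HD (fun u v => cross (X u v) (Y u v) (B u v))).
  - intros u v Huv. symmetry. apply frame_timelike_cross, surface_orthonormal, Huv.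
  - apply (smooth4_cross D HD);
      [apply surface_smooth_X|apply surface_smooth_Y|apply surface_smooth_B].
Qed.

Lemma surface_du4_z u v : D (u, v) -> du4 z u v = vscal (P u v) (X u v).
Proof.
  intros Huv. assert (p := surface_P_pos u v Huv).
  unfold X. rewrite frame_x_eq, vscal_vscal. fold (P u v).
  replace (P u v * (1 / P u v)) with 1 by (field; lra). now rewrite vscal_1.
Qed.

Lemma surface_dv4_z u v : D (u, v) -> dv4 z u v = vscal (Q u v) (Y u v).
Proof.
  intros Huv. assert (q := surface_Q_pos u v Huv).
  unfold Y. rewrite frame_y_eq, vscal_vscal. fold (Q u v).
  replace (Q u v * (1 / Q u v)) with 1 by (field; lra). now rewrite vscal_1.
Qed.

Lemma surface_gamma u v :
  D (u, v) -> dv P u v = - gamma1 u v * P u v * Q u v /\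
    du Q u v = - gamma2 u v * P u v * Q u v.
Proof.
  intros Huv. assert (p := surface_P_pos u v Huv). assert (q := surface_Q_pos u v Huv).
  destruct (HL u v Huv) as (_ & _ & _ & _ & _ & G1 & G2 & _).
  unfold dir, xdir, ydir in G1, G2. simpl in G1, G2.
  fold (P u v) in G2. fold (Q u v) in G1.
  assert (E1 : dv (fun s t => ln (sqrt (fE z s t))) u v = dv P u v / P u v).
  { apply (is_derive_unique (fun t => ln (P u t))).
    apply (is_derive_comp ln (fun t => P u t)).
    - now apply is_derive_ln.
    - now apply (smooth_is_dv D P u v surface_smooth_P). }
  assert (E2 : du (fun s t => ln (sqrt (fG z s t))) u v = du Q u v / Q u v).
  { apply (is_derive_unique (fun s => ln (Q s v))).
    apply (is_derive_comp ln (fun s => Q s v)).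
    - now apply is_derive_ln.
    - now apply (smooth_is_du D Q u v surface_smooth_Q). }
  rewrite G1, G2, E1, E2. split; field; lra.
Qed.

(** This is z_uv = z_vu.  Its products with the frame vectors express x_v through
    y_u and the derivatives of P and Q. *)
Lemma surface_mixed u v : D (u, v) ->
  vadd (vscal (dv P u v) (X u v)) (vscal (P u v) (dv4 X u v)) =
  vadd (vscal (du Q u v) (Y u v)) (vscal (Q u v) (du4 Y u v)).
Proof.
  intros Huv.
  rewrite <- (dv4_vscal D P X u v surface_smooth_P surface_smooth_X Huv).
  rewrite <- (du4_vscal D Q Y u v surface_smooth_Q surface_smooth_Y Huv).
  rewrite <- (dv4_ext D HD (du4 z) _ u v surface_du4_z Huv).
  rewrite <- (du4_ext D HD (dv4 z) _ u v surface_dv4_z Huv).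
  symmetry. now apply (smooth4_schwarz D HD).
Qed.

(** The last two equations say that x_u and y_v have no component along l.  Let
    these components be P a and Q c.  Orthogonality of the mean curvature vector and
    l gives a + c = 0, and M = 0 gives nu1 c = nu2 a, whence (nu1 + nu2) a = 0. *)
Lemma surface_second_form u v : D (u, v) ->
  mink (du4 X u v) (B u v) = P u v * nu1 u v /\
  mink (dv4 Y u v) (B u v) = Q u v * nu2 u v /\
  mink (du4 Y u v) (B u v) = P u v * lambda u v /\
  mink (du4 Y u v) (L u v) = P u v * mu u v /\
  mink (du4 B u v) (L u v) = P u v * beta1 u v /\
  mink (dv4 B u v) (L u v) = Q u v * beta2 u v /\
  mink (du4 X u v) (L u v) = 0 /\
  mink (dv4 Y u v) (L u v) = 0.
Proof.
  intros Huv. assert (p := surface_P_pos u v Huv). assert (q := surface_Q_pos u v Huv).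
  assert (Ho := surface_orthonormal u v Huv).
  assert (Hu := surface_du4_z u v Huv). assert (Hv := surface_dv4_z u v Huv).
  assert (N := fun w => normal_part_frame z u v w (P u v) (Q u v)
    _ _ _ _ (Rgt_not_eq _ _ p) (Rgt_not_eq _ _ q) Ho Hu Hv).
  destruct (HL u v Huv) as (_ & N1 & N2 & La & Mu & _ & _ & B1 & B2).
  assert (Hn := Hnu u v Huv).
  rewrite nabla'_xdir in B1. rewrite nabla'_ydir in B2.
  unfold Defs.sigma in N1, N2, La, Mu.
  rewrite nabla'_xdir in N1, La, Mu. rewrite nabla'_ydir in N2.
  fold (P u v) in N1, La, Mu, B1. fold (Q u v) in N2, B2.
  change (push z (xdir z)) with X in N1. change (push z (ydir z)) with Y in N2, La, Mu.
  change (frame_b z) with B in N1, N2, La, B1, B2.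
  rewrite N in N1, N2, La, Mu.
  assert (Hxl : 1 / P u v * mink (du4 X u v) (L u v)
    + 1 / Q u v * mink (dv4 Y u v) (L u v) = 0).
  { assert (Hb : mink (B u v) (L u v) = 0) by apply Ho.
    unfold B, frame_b in Hb. rewrite mink_vscal_l in Hb.
    apply Rmult_integral in Hb. destruct Hb as [Hb|Hb].
    { exfalso. assert (Hs := sqrt_lt_R0 _ (HH u v Huv)).
      apply Rinv_0_lt_compat in Hs. lra. }
    unfold Hvec, mean_curvature, Defs.sigma in Hb.
    rewrite nabla'_xdir, nabla'_ydir, !N in Hb.
    fold (P u v) in Hb. fold (Q u v) in Hb.
    change (push z (xdir z)) with X in Hb. change (push z (ydir z)) with Y in Hb.
    revert Hb. use_products Ho. lra. }
  assert (HM : P u v * mink (du4 X u v) (B u v) * (Q u v * mink (dv4 Y u v) (L u v))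
    - P u v * mink (du4 X u v) (L u v) * (Q u v * mink (dv4 Y u v) (B u v)) = 0).
  { assert (Hf : normal_frame z u v (B u v) (L u v)).
    { unfold normal_frame. rewrite Hu, Hv. use_products (surface_orthonormal u v Huv).
      repeat split; try ring.
      unfold positively_oriented.
      replace (det4 _ _ _ _) with (P u v * Q u v * det4 (X u v) (Y u v) (B u v) (L u v)).
      - rewrite (oriented_orthonormal_det _ _ _ _ Ho). nra.
      - destruct (X u v) as [[[? ?] ?] ?], (Y u v) as [[[? ?] ?] ?],
          (B u v) as [[[? ?] ?] ?], (L u v) as [[[? ?] ?] ?].
        unfold vscal, det4, det3, pr1, pr2, pr3, pr4; simpl. ring. }
    assert (HM := proj2 (Hpr u v Huv) _ _ Hf). unfold fM in HM.
    apply Rmult_integral in HM. destruct HM as [HM|HM].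
    { exfalso. revert HM. apply Rgt_not_eq. apply Rdiv_lt_0_compat; [lra|].
      apply sqrt_lt_R0. rewrite (proj1 (Hpr u v Huv)).
      assert (HE := spacelike_fE u v Huv). assert (HG := spacelike_fG u v Huv). nra. }
    rewrite (du4_ext D HD (du4 z) (fun s t => vscal (P s t) (X s t)) u v surface_du4_z Huv),
      (dv4_ext D HD (dv4 z) (fun s t => vscal (Q s t) (Y s t)) u v surface_dv4_z Huv) in HM.
    rewrite (du4_vscal D P X u v surface_smooth_P surface_smooth_X Huv),
      (dv4_vscal D Q Y u v surface_smooth_Q surface_smooth_Y Huv) in HM.
    revert HM. use_products Ho. lra. }
  assert (E1 : mink (du4 X u v) (B u v) = P u v * nu1 u v).
  { rewrite N1. use_products Ho. field. lra. }
  assert (E2 : mink (dv4 Y u v) (B u v) = Q u v * nu2 u v).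
  { rewrite N2. use_products Ho. field. lra. }
  assert (E3 : mink (dv4 Y u v) (L u v) = - (Q u v / P u v * mink (du4 X u v) (L u v))).
  { replace (mink (dv4 Y u v) (L u v)) with
      (Q u v * ((1 / P u v * mink (du4 X u v) (L u v)
        + 1 / Q u v * mink (dv4 Y u v) (L u v)) - 1 / P u v * mink (du4 X u v) (L u v)))
      by (field; lra).
    rewrite Hxl. field. lra. }
  assert (E4 : mink (du4 X u v) (L u v) = 0).
  { rewrite E1, E2, E3 in HM.
    assert (K : P u v * (Q u v * Q u v) * (nu1 u v + nu2 u v) * mink (du4 X u v) (L u v) = 0).
    { replace 0 with (- 0) by ring. rewrite <- HM. field. lra. }
    apply Rmult_integral in K. destruct K as [K|K]; [|exact K].
    exfalso. revert K. apply Rgt_not_eq. repeat apply Rmult_gt_0_compat; lra. }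
  split; [exact E1|]. split; [exact E2|]. split; [|split; [|split; [|split; [|split]]]].
  - rewrite La. use_products Ho. field. lra.
  - rewrite Mu. use_products Ho. field. lra.
  - rewrite B1, mink_vscal_l. field. lra.
  - rewrite B2, mink_vscal_l. field. lra.
  - exact E4.
  - rewrite E3, E4. ring.
Qed.

Lemma surface_adapted_frame_sqrt :
  adapted_frame D P Q gamma1 gamma2 nu1 nu2 lambda mu beta1 beta2 z X Y B L.
Proof.
  intros u v Huv. split; [now apply surface_orthonormal|].
  split; [now apply surface_du4_z|]. split; [now apply surface_dv4_z|].
  assert (p := surface_P_pos u v Huv). assert (q := surface_Q_pos u v Huv).
  destruct (surface_second_form u v Huv) as (E1 & E2 & E3 & E4 & E5 & E6 & E7 & E8).
  assert (Ho := surface_orthonormal u v Huv).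
  assert (Hm := surface_mixed u v Huv).
  destruct (surface_gamma u v Huv) as [G1 G2].
  assert (dXu := smooth4_is_du4 D X u v surface_smooth_X Huv).
  assert (dYu := smooth4_is_du4 D Y u v surface_smooth_Y Huv).
  assert (dBu := smooth4_is_du4 D B u v surface_smooth_B Huv).
  assert (dLu := smooth4_is_du4 D L u v surface_smooth_L Huv).
  assert (dXv := smooth4_is_dv4 D X u v surface_smooth_X Huv).
  assert (dYv := smooth4_is_dv4 D Y u v surface_smooth_Y Huv).
  assert (dBv := smooth4_is_dv4 D B u v surface_smooth_B Huv).
  assert (dLv := smooth4_is_dv4 D L u v surface_smooth_L Huv).
  assert (Lu : locally u (fun s => oriented_orthonormal (X s v) (Y s v) (B s v) (L s v))).
  { refine (filter_imp _ _ _ (open_locally_u D u v HD Huv)).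
    intros s. apply surface_orthonormal. }
  assert (Lv : locally v (fun t => oriented_orthonormal (X u t) (Y u t) (B u t) (L u t))).
  { refine (filter_imp _ _ _ (open_locally_v D u v HD Huv)).
    intros t. apply surface_orthonormal. }
  assert (xxv : mink (dv4 X u v) (X u v) = 0).
  { assert (H := mink_constant_derive _ _ v _ _ 1 dXv dXv). cbv beta in H.
    rewrite H at 1; [|refine (filter_imp _ _ _ Lv); intros t Ht; apply Ht].
    assert (H' := H ltac:(refine (filter_imp _ _ _ Lv); intros t Ht; apply Ht)). lra. }
  assert (yyu : mink (du4 Y u v) (Y u v) = 0).
  { assert (H := mink_constant_derive _ _ u _ _ 1 dYu dYu). cbv beta in H.
    assert (H' := H ltac:(refine (filter_imp _ _ _ Lu); intros t Ht; apply Ht)). lra. }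
  assert (xyu : mink (du4 X u v) (Y u v) = - mink (du4 Y u v) (X u v)).
  { apply (mink_constant_derive _ _ u _ _ 0 dXu dYu).
    refine (filter_imp _ _ _ Lu). intros t Ht. apply Ht. }
  assert (Hmd := fun w => f_equal (fun k => mink k w) Hm). cbv beta in Hmd.
  assert (M1 := Hmd (X u v)). assert (M2 := Hmd (Y u v)).
  assert (M3 := Hmd (B u v)). assert (M4 := Hmd (L u v)).
  assert (A1 : mink (du4 X u v) (Y u v) = P u v * gamma1 u v).
  { rewrite xyu. revert M1. use_products Ho. rewrite xxv, G1. intros M1.
    apply (Rmult_eq_reg_l (Q u v)); [|lra]. lra. }
  assert (A2 : mink (dv4 X u v) (Y u v) = - (Q u v * gamma2 u v)).
  { revert M2. use_products Ho. rewrite yyu, G2. intros M2.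
    apply (Rmult_eq_reg_l (P u v)); [|lra]. lra. }
  assert (A3 : mink (dv4 X u v) (B u v) = Q u v * lambda u v).
  { revert M3. use_products Ho. rewrite E3. intros M3.
    apply (Rmult_eq_reg_l (P u v)); [|lra]. lra. }
  assert (A4 : mink (dv4 X u v) (L u v) = Q u v * mu u v).
  { revert M4. use_products Ho. rewrite E4. intros M4.
    apply (Rmult_eq_reg_l (P u v)); [|lra]. lra. }
  split.
  - rewrite <- A1, <- E1, <- E3, <- E4, <- E5, <- E7.
    now apply (orthonormal_moves (fun s => X s v) (fun s => Y s v) (fun s => B s v)
      (fun s => L s v) u _ _ _ (du4 L u v)).
  - rewrite <- A2, <- A3, <- A4, <- E2, <- E6, <- E8.
    now apply (orthonormal_moves (fun t => X u t) (fun t => Y u t) (fun t => B u t)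
      (fun t => L u t) v _ _ _ (dv4 L u v)).
Qed.

(** The functions x_u l = 0 and x_v l = Q mu are differentiated along v and u, and
    the mixed second derivatives of x eliminated; likewise for y_u l = P mu and
    y_v l = 0.  The derivatives of P and Q that appear are known from gamma1 and
    gamma2. *)
Lemma surface_mu u v : D (u, v) ->
  du mu u v = P u v * (2 * mu u v * gamma2 u v + nu1 u v * beta2 u v
    - lambda u v * beta1 u v) /\
  dv mu u v = Q u v * (2 * mu u v * gamma1 u v - lambda u v * beta2 u v
    + nu2 u v * beta1 u v).
Proof.
  intros Huv.
  assert (p := surface_P_pos u v Huv). assert (q := surface_Q_pos u v Huv).
  destruct (surface_gamma u v Huv) as [G1 G2].
  assert (SX := surface_smooth_X). assert (SY := surface_smooth_Y).
  assert (SL := surface_smooth_L).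
  assert (T : forall s t, D (s, t) ->
    mink (du4 X s t) (L s t) = 0 /\ mink (dv4 X s t) (L s t) = Q s t * mu s t /\
    mink (du4 Y s t) (L s t) = P s t * mu s t /\ mink (dv4 Y s t) (L s t) = 0).
  { intros s t Hst.
    destruct (surface_adapted_frame_sqrt s t Hst) as (Ho & _ & _ & (MX & MY & _) & (MX' & MY' & _)).
    apply is_derive4_du4 in MX, MY. apply is_derive4_dv4 in MX', MY'.
    rewrite MX, MY, MX', MY'.
    split; [|split; [|split]]; use_products Ho; ring. }
  assert (D1 : mink (dv4 (du4 X) u v) (L u v) + mink (du4 X u v) (dv4 L u v) = 0).
  { rewrite <- (dv_mink D (du4 X) L u v (smooth4_du4 D X SX) SL Huv).
    rewrite (dv_ext D HD _ (fun _ _ => 0) u v (fun s t H => proj1 (T s t H)) Huv).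
    exact (Derive_const 0 v). }
  assert (D2 : mink (du4 (dv4 X) u v) (L u v) + mink (dv4 X u v) (du4 L u v)
    = du Q u v * mu u v + Q u v * du mu u v).
  { rewrite <- (du_mink D (dv4 X) L u v (smooth4_dv4 D X SX) SL Huv).
    rewrite (du_ext D HD _ (fun s t => Q s t * mu s t) u v
      (fun s t H => proj1 (proj2 (T s t H))) Huv).
    apply (du_mult D); auto using surface_smooth_Q. }
  assert (D3 : mink (dv4 (du4 Y) u v) (L u v) + mink (du4 Y u v) (dv4 L u v)
    = dv P u v * mu u v + P u v * dv mu u v).
  { rewrite <- (dv_mink D (du4 Y) L u v (smooth4_du4 D Y SY) SL Huv).
    rewrite (dv_ext D HD _ (fun s t => P s t * mu s t) u v
      (fun s t H => proj1 (proj2 (proj2 (T s t H)))) Huv).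
    apply (dv_mult D); auto using surface_smooth_P. }
  assert (D4 : mink (du4 (dv4 Y) u v) (L u v) + mink (dv4 Y u v) (du4 L u v) = 0).
  { rewrite <- (du_mink D (dv4 Y) L u v (smooth4_dv4 D Y SY) SL Huv).
    rewrite (du_ext D HD _ (fun _ _ => 0) u v
      (fun s t H => proj2 (proj2 (proj2 (T s t H)))) Huv).
    exact (Derive_const 0 u). }
  rewrite (smooth4_schwarz D HD X u v SX Huv) in D2.
  rewrite (smooth4_schwarz D HD Y u v SY Huv) in D4.
  destruct (surface_adapted_frame_sqrt u v Huv) as
    (Ho & _ & _ & (MX & MY & _ & ML) & (MX' & MY' & _ & ML')).
  apply is_derive4_du4 in MX, MY, ML. apply is_derive4_dv4 in MX', MY', ML'.
  rewrite G2, MX', ML in D2. rewrite MX, ML' in D1.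
  rewrite G1, MY, ML' in D3. rewrite MY', ML in D4.
  revert D1 D2 D3 D4. use_products Ho. intros D1 D2 D3 D4. split.
  - apply (Rmult_eq_reg_l (Q u v)); [|lra]. lra.
  - apply (Rmult_eq_reg_l (P u v)); [|lra]. lra.
Qed.

(** The coefficients of P and Q in the formulas for mu_u and mu_v do not vanish, so
    P and Q are determined by the geometric functions. *)
Lemma surface_adapted_frame (rE rG : R -> R -> R) :
  (forall u v, D (u, v) ->
     let d := 2 * mu u v * gamma2 u v + nu1 u v * beta2 u v - lambda u v * beta1 u v in
     d <> 0 /\ rE u v = du mu u v / d) ->
  (forall u v, D (u, v) ->
     let d := 2 * mu u v * gamma1 u v - lambda u v * beta2 u v + nu2 u v * beta1 u v in
     d <> 0 /\ rG u v = dv mu u v / d) ->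
  adapted_frame D rE rG gamma1 gamma2 nu1 nu2 lambda mu beta1 beta2 z X Y B L.
Proof.
  intros HE HG u v Huv.
  destruct (HE u v Huv) as [dE EE]. destruct (HG u v Huv) as [dG EG].
  destruct (surface_mu u v Huv) as [Mu Mv].
  replace (rE u v) with (P u v); [replace (rG u v) with (Q u v)|].
  - now apply surface_adapted_frame_sqrt.
  - rewrite EG, Mv. field. exact dG.
  - rewrite EE, Mu. field. exact dE.
Qed.

End FrameOfSurface.

(** * Existence of an adapted frame *)

(** Coefficients of the system for one Cartesian coordinate of z, x, y, b, l, in this
    order (indices 0 to 4): the rows 1 to 4 are those of [moves]. *)
Definition frame_matrix (e1 e2 a p q s m k : R -> R -> R) (i j : nat) : R -> R -> R :=
  match i, j with
  | 0%nat, 1%nat => e1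
  | 0%nat, 2%nat => e2
  | 1%nat, 2%nat => a
  | 1%nat, 3%nat => p
  | 1%nat, 4%nat => fun u v => - q u v
  | 2%nat, 1%nat => fun u v => - a u v
  | 2%nat, 3%nat => s
  | 2%nat, 4%nat => fun u v => - m u v
  | 3%nat, 1%nat => fun u v => - p u v
  | 3%nat, 2%nat => fun u v => - s u v
  | 3%nat, 4%nat => fun u v => - k u v
  | 4%nat, 1%nat => fun u v => - q u v
  | 4%nat, 2%nat => fun u v => - m u v
  | 4%nat, 3%nat => fun u v => - k u v
  | _, _ => fun _ _ => 0
  end.

Lemma du_opp f u v : du (fun s t => - f s t) u v = - du f u v.
Proof. exact (Derive_opp (fun s => f s v) u). Qed.

Lemma dv_opp f u v : dv (fun s t => - f s t) u v = - dv f u v.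
Proof. exact (Derive_opp (fun t => f u t) v). Qed.

Lemma du_0 u v : du (fun _ _ => 0) u v = 0.
Proof. exact (Derive_const 0 u). Qed.

Lemma dv_0 u v : dv (fun _ _ => 0) u v = 0.
Proof. exact (Derive_const 0 v). Qed.

Lemma frame_matrix_smooth (D : R * R -> Prop) (HD : open D) e1 e2 a p q s m k i j :
  smooth_on D e1 -> smooth_on D e2 -> smooth_on D a -> smooth_on D p ->
  smooth_on D q -> smooth_on D s -> smooth_on D m -> smooth_on D k ->
  smooth_on D (frame_matrix e1 e2 a p q s m k i j).
Proof.
  intros. unfold frame_matrix.
  do 5 (destruct i as [|i]; [do 5 (destruct j as [|j];
    [first [assumption | apply (smooth_opp D HD); assumption
      | apply (smooth_const D HD)]|]); apply (smooth_const D HD)|]).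
  apply (smooth_const D HD).
Qed.

(** The compatibility condition entry by entry: four equations for the row of z and
    the six entries above the diagonal of the skew part. *)
Lemma frame_matrix_compat e1 e2 a p q s m k e1' e2' a' p' q' s' m' k' u v :
  dv e1 u v - e2 u v * a' u v = du e1' u v - e2' u v * a u v ->
  dv e2 u v + e1 u v * a' u v = du e2' u v + e1' u v * a u v ->
  e1 u v * p' u v + e2 u v * s' u v = e1' u v * p u v + e2' u v * s u v ->
  e1 u v * q' u v + e2 u v * m' u v = e1' u v * q u v + e2' u v * m u v ->
  dv a u v - p u v * s' u v + q u v * m' u v =
    du a' u v - p' u v * s u v + q' u v * m u v ->
  dv p u v + a u v * s' u v + q u v * k' u v =
    du p' u v + a' u v * s u v + q' u v * k u v ->
  dv q u v + a u v * m' u v + p u v * k' u v =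
    du q' u v + a' u v * m u v + p' u v * k u v ->
  dv s u v - a u v * p' u v + m u v * k' u v =
    du s' u v - a' u v * p u v + m' u v * k u v ->
  dv m u v - a u v * q' u v + s u v * k' u v =
    du m' u v - a' u v * q u v + s' u v * k u v ->
  dv k u v - p u v * q' u v - s u v * m' u v =
    du k' u v - p' u v * q u v - s' u v * m u v ->
  let A := frame_matrix e1 e2 a p q s m k in
  let B := frame_matrix e1' e2' a' p' q' s' m' k' in
  forall i (y : nat -> R), (i <= 4)%nat ->
  let mul (M : nat -> nat -> R -> R -> R) := mv 4 (fun i j => M i j u v) in
  mul (fun i j => dv (A i j)) y i + mul A (mul B y) i
  = mul (fun i j => du (B i j)) y i + mul B (mul A y) i.
Proof.
  intros H1 H2 H3 H4 H5 H6 H7 H8 H9 H10 A B i y Hi mul. unfold mul, mv.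
  assert (Y3 := f_equal (Rmult (y 3%nat)) H3).
  assert (Y4 := f_equal (Rmult (y 4%nat)) H4).
  assert (H1' : dv e1 u v = du e1' u v - e2' u v * a u v + e2 u v * a' u v) by lra.
  assert (H2' : dv e2 u v = du e2' u v + e1' u v * a u v - e1 u v * a' u v) by lra.
  assert (H5' : dv a u v = du a' u v - p' u v * s u v + q' u v * m u v
    + p u v * s' u v - q u v * m' u v) by lra.
  assert (H6' : dv p u v = du p' u v + a' u v * s u v + q' u v * k u v
    - a u v * s' u v - q u v * k' u v) by lra.
  assert (H7' : dv q u v = du q' u v + a' u v * m u v + p' u v * k u v
    - a u v * m' u v - p u v * k' u v) by lra.
  assert (H8' : dv s u v = du s' u v - a' u v * p u v + m' u v * k u v
    + a u v * p' u v - m u v * k' u v) by lra.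
  assert (H9' : dv m u v = du m' u v - a' u v * q u v + s' u v * k u v
    + a u v * q' u v - s u v * k' u v) by lra.
  assert (H10' : dv k u v = du k' u v - p' u v * q u v - s' u v * m u v
    + p u v * q' u v + s u v * m' u v) by lra.
  do 5 (destruct i as [|i]; [cbn [sum_f_R0 frame_matrix A B];
    rewrite ?dv_opp, ?du_opp, ?dv_0, ?du_0;
    rewrite ?H1', ?H2', ?H5', ?H6', ?H7', ?H8', ?H9', ?H10';
    first [ring | lra]|]).
  lia.
Qed.

Lemma continuity_2d_positive_near f u0 v0 :
  continuity_2d_pt f u0 v0 -> 0 < f u0 v0 ->
  exists d, 0 < d /\ forall u v, square u0 v0 d (u, v) -> 0 < f u v.
Proof.
  intros Hc Hf. destruct (Hc (mkposreal _ Hf)) as [d Hd]. exists d.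
  split; [apply cond_pos|]. intros u v [Hu Hv]. simpl in *.
  assert (H := Hd u v Hu Hv). apply Rabs_def2 in H. lra.
Qed.

Lemma smooth_on_subset (D D' : R * R -> Prop) f :
  (forall p, D' p -> D p) -> smooth_on D f -> smooth_on D' f.
Proof. intros H Hf n u v Huv. apply Hf, H, Huv. Qed.

Lemma smooth4_on_subset (D D' : R * R -> Prop) W :
  (forall p, D' p -> D p) -> smooth4_on D W -> smooth4_on D' W.
Proof.
  intros H (H1 & H2 & H3 & H4).
  split; [|split; [|split]]; eapply smooth_on_subset; eassumption.
Qed.

Ltac components :=
  repeat match goal with x := _ |- _ => subst x end;
  apply R4_eq; unfold vcomb, vadd, vscal, mulv, mv, pr1, pr2, pr3, pr4; simpl; ring.

(** The four Cartesian coordinates are solved for separately.  The square is then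
    shrunk so that the determinant of the frame stays positive, which together with
    the conservation of the pairing gives orthonormality. *)
Lemma adapted_frame_local_existence (D : R * R -> Prop) (HD : open D)
    (P Q gamma1 gamma2 nu1 nu2 lambda mu beta1 beta2 : R -> R -> R)
    (u0 v0 : R) (p0 x0 y0 b0 l0 : R4) :
  D (u0, v0) ->
  smooth_on D P -> smooth_on D Q ->
  smooth_on D gamma1 -> smooth_on D gamma2 -> smooth_on D nu1 -> smooth_on D nu2 ->
  smooth_on D lambda -> smooth_on D mu -> smooth_on D beta1 -> smooth_on D beta2 ->
  (forall u v, D (u, v) -> 0 < P u v) -> (forall u v, D (u, v) -> 0 < Q u v) ->
  (forall u v, D (u, v) -> dv P u v = - gamma1 u v * P u v * Q u v) ->
  (forall u v, D (u, v) -> du Q u v = - gamma2 u v * P u v * Q u v) ->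
  (forall u v, D (u, v) ->
     du mu u v = P u v * (2 * mu u v * gamma2 u v + nu1 u v * beta2 u v
       - lambda u v * beta1 u v) /\
     dv mu u v = Q u v * (2 * mu u v * gamma1 u v - lambda u v * beta2 u v
       + nu2 u v * beta1 u v)) ->
  (forall u v, D (u, v) ->
     nu1 u v * nu2 u v - lambda u v ^ 2 + mu u v ^ 2 =
       1 / P u v * du gamma2 u v + 1 / Q u v * dv gamma1 u v
       - (gamma1 u v ^ 2 + gamma2 u v ^ 2)) ->
  (forall u v, D (u, v) ->
     2 * lambda u v * gamma2 u v - mu u v * beta1 u v
       - (nu1 u v - nu2 u v) * gamma1 u v =
       1 / P u v * du lambda u v - 1 / Q u v * dv nu1 u v) ->
  (forall u v, D (u, v) ->
     2 * lambda u v * gamma1 u v - mu u v * beta2 u v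
       + (nu1 u v - nu2 u v) * gamma2 u v =
       - (1 / P u v) * du nu2 u v + 1 / Q u v * dv lambda u v) ->
  (forall u v, D (u, v) ->
     gamma1 u v * beta1 u v - gamma2 u v * beta2 u v
       + (nu1 u v - nu2 u v) * mu u v =
       - (1 / P u v) * du beta2 u v + 1 / Q u v * dv beta1 u v) ->
  oriented_orthonormal x0 y0 b0 l0 ->
  exists r z X Y B L, 0 < r /\ (forall p, square u0 v0 r p -> D p) /\
    smooth4_on (square u0 v0 r) z /\ smooth4_on (square u0 v0 r) X /\
    smooth4_on (square u0 v0 r) Y /\
    adapted_frame (square u0 v0 r) P Q gamma1 gamma2 nu1 nu2 lambda mu beta1 beta2
      z X Y B L /\
    z u0 v0 = p0 /\ X u0 v0 = x0 /\ Y u0 v0 = y0 /\ B u0 v0 = b0 /\ L u0 v0 = l0.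
Proof.
  intros H0 SP SQ Sg1 Sg2 Sn1 Sn2 Sla Smu Sb1 Sb2 HP HQ HPv HQu Hmu HGauss HC1 HC2 HRicci Ho0.
  set (zero := fun _ _ : R => 0).
  set (A := frame_matrix P zero (fun u v => P u v * gamma1 u v) (fun u v => P u v * nu1 u v)
    zero (fun u v => P u v * lambda u v) (fun u v => P u v * mu u v)
    (fun u v => P u v * beta1 u v)).
  set (M := frame_matrix zero Q (fun u v => - (Q u v * gamma2 u v))
    (fun u v => Q u v * lambda u v) (fun u v => Q u v * mu u v)
    (fun u v => Q u v * nu2 u v) zero (fun u v => Q u v * beta2 u v)).
  assert (S0 : smooth_on D zero) by exact (smooth_const D HD 0).
  assert (SA : forall i j, smooth_on D (A i j)).
  { intros. apply (frame_matrix_smooth D HD); auto; now apply (smooth_mult D HD). }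
  assert (SM : forall i j, smooth_on D (M i j)).
  { intros. apply (frame_matrix_smooth D HD); auto;
      try apply (smooth_opp D HD); now apply (smooth_mult D HD). }
  destruct (total_system_local_solution D HD 4 A M u0 v0 H0) as (r1 & Hr1 & Hsol); auto.
  { intros i u v y Hi Huv. apply frame_matrix_compat; [..|exact Hi];
      unfold zero; rewrite ?dv_0, ?du_0, ?du_opp, ?(dv_mult D), ?(du_mult D) by auto;
      rewrite ?(HPv u v Huv), ?(HQu u v Huv), ?(proj1 (Hmu u v Huv)),
        ?(proj2 (Hmu u v Huv));
      assert (p := HP u v Huv); assert (q := HQ u v Huv); try ring.
    - assert (G : P u v * Q u v *
        (nu1 u v * nu2 u v - lambda u v ^ 2 + mu u v ^ 2) =
        Q u v * du gamma2 u v + P u v * dv gamma1 u v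
        - P u v * Q u v * (gamma1 u v ^ 2 + gamma2 u v ^ 2))
        by (rewrite (HGauss u v Huv); field; lra). lra.
    - assert (G : P u v * Q u v * (2 * lambda u v * gamma2 u v - mu u v * beta1 u v
        - (nu1 u v - nu2 u v) * gamma1 u v) =
        Q u v * du lambda u v - P u v * dv nu1 u v)
        by (rewrite (HC1 u v Huv); field; lra). lra.
    - assert (G : P u v * Q u v * (2 * lambda u v * gamma1 u v - mu u v * beta2 u v
        + (nu1 u v - nu2 u v) * gamma2 u v) =
        - Q u v * du nu2 u v + P u v * dv lambda u v)
        by (rewrite (HC2 u v Huv); field; lra). lra.
    - assert (G : P u v * Q u v * (gamma1 u v * beta1 u v - gamma2 u v * beta2 u v
        + (nu1 u v - nu2 u v) * mu u v) =
        - Q u v * du beta2 u v + P u v * dv beta1 u v)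
        by (rewrite (HRicci u v Huv); field; lra). lra. }
  destruct (Hsol r1 ltac:(lra)) as [Hin1 Hex].
  set (init := fun (k : R4 -> R) (i : nat) => match i with
    | 0%nat => k p0 | 1%nat => k x0 | 2%nat => k y0 | 3%nat => k b0 | _ => k l0 end).
  destruct (Hex (init pr1)) as (F1 & I1 & E1).
  destruct (Hex (init pr2)) as (F2 & I2 & E2).
  destruct (Hex (init pr3)) as (F3 & I3 & E3).
  destruct (Hex (init pr4)) as (F4 & I4 & E4).
  set (W := fun i u v => (F1 i u v, F2 i u v, F3 i u v, F4 i u v) : R4).
  assert (HS1 := square_open u0 v0 r1).
  assert (SW : forall i, (i <= 4)%nat -> smooth4_on (square u0 v0 r1) (W i)).
  { intros i Hi.
    assert (SA' : forall i j, (i <= 4)%nat -> (j <= 4)%nat ->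
      smooth_on (square u0 v0 r1) (A i j)) by (intros; eapply smooth_on_subset; eauto).
    assert (SM' : forall i j, (i <= 4)%nat -> (j <= 4)%nat ->
      smooth_on (square u0 v0 r1) (M i j)) by (intros; eapply smooth_on_subset; eauto).
    split; [|split; [|split]].
    - exact (solution_smooth _ HS1 4 A M F1 SA' SM' E1 i Hi).
    - exact (solution_smooth _ HS1 4 A M F2 SA' SM' E2 i Hi).
    - exact (solution_smooth _ HS1 4 A M F3 SA' SM' E3 i Hi).
    - exact (solution_smooth _ HS1 4 A M F4 SA' SM' E4 i Hi). }
  assert (HW0 : W 0%nat u0 v0 = p0 /\ W 1%nat u0 v0 = x0 /\ W 2%nat u0 v0 = y0 /\
    W 3%nat u0 v0 = b0 /\ W 4%nat u0 v0 = l0).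
  { unfold W. rewrite !I1, !I2, !I3, !I4.
    repeat split; apply R4_eq; reflexivity. }
  destruct HW0 as (W0 & W1 & W2 & W3 & W4).
  assert (Hdet0 : 0 < det4 (W 1%nat u0 v0) (W 2%nat u0 v0) (W 3%nat u0 v0) (W 4%nat u0 v0)).
  { rewrite W1, W2, W3, W4. apply Ho0. }
  destruct (continuity_2d_positive_near
    (fun u v => det4 (W 1%nat u v) (W 2%nat u v) (W 3%nat u v) (W 4%nat u v)) u0 v0)
    as (r2 & Hr2 & Hdet); [|exact Hdet0|].
  { apply (smooth_continuity (square u0 v0 r1)); [|now apply square_center].
    apply (smooth_det4 _ HS1); apply SW; lia. }
  set (r := Rmin r1 r2).
  assert (Hr : 0 < r) by now apply Rmin_pos.
  assert (In1 : forall p, square u0 v0 r p -> square u0 v0 r1 p)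
    by (intros p; apply square_le, Rmin_l).
  assert (In2 : forall p, square u0 v0 r p -> square u0 v0 r2 p)
    by (intros p; apply square_le, Rmin_r).
  exists r, (W 0%nat), (W 1%nat), (W 2%nat), (W 3%nat), (W 4%nat).
  split; [exact Hr|]. split; [auto|].
  assert (SW' : forall i, (i <= 4)%nat -> smooth4_on (square u0 v0 r) (W i)).
  { intros i Hi. eapply smooth4_on_subset; [exact In1|now apply SW]. }
  split; [apply SW'; lia|]. split; [apply SW'; lia|]. split; [apply SW'; lia|].
  split.
  - assert (Hmove : forall u v, square u0 v0 r (u, v) ->
      du4 (W 0%nat) u v = vscal (P u v) (W 1%nat u v) /\
      dv4 (W 0%nat) u v = vscal (Q u v) (W 2%nat u v) /\
      moves (fun s => W 1%nat s v) (fun s => W 2%nat s v) (fun s => W 3%nat s v)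
        (fun s => W 4%nat s v) u
        (P u v * gamma1 u v) (P u v * nu1 u v) 0
        (P u v * lambda u v) (P u v * mu u v) (P u v * beta1 u v) /\
      moves (fun t => W 1%nat u t) (fun t => W 2%nat u t) (fun t => W 3%nat u t)
        (fun t => W 4%nat u t) v
        (- (Q u v * gamma2 u v)) (Q u v * lambda u v) (Q u v * mu u v)
        (Q u v * nu2 u v) 0 (Q u v * beta2 u v)).
    { intros u v Huv. apply In1 in Huv.
      assert (dWu : forall i w, (i <= 4)%nat ->
        w = (mulv 4 A F1 i u v, mulv 4 A F2 i u v,
             mulv 4 A F3 i u v, mulv 4 A F4 i u v) ->
        is_derive4 (fun s => W i s v) u w).
      { intros i w Hi ->.
        split; [|split; [|split]];
          [apply (E1 i u v Hi Huv)|apply (E2 i u v Hi Huv)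
          |apply (E3 i u v Hi Huv)|apply (E4 i u v Hi Huv)]. }
      assert (dWv : forall i w, (i <= 4)%nat ->
        w = (mulv 4 M F1 i u v, mulv 4 M F2 i u v,
             mulv 4 M F3 i u v, mulv 4 M F4 i u v) ->
        is_derive4 (fun t => W i u t) v w).
      { intros i w Hi ->.
        split; [|split; [|split]];
          [apply (E1 i u v Hi Huv)|apply (E2 i u v Hi Huv)
          |apply (E3 i u v Hi Huv)|apply (E4 i u v Hi Huv)]. }
      split; [|split; [|split]].
      - apply is_derive4_du4, dWu; [lia|]. components.
      - apply is_derive4_dv4, dWv; [lia|]. components.
      - split; [|split; [|split]]; apply dWu; try lia; components.
      - split; [|split; [|split]]; apply dWv; try lia; components. }
    intros u v Huv. destruct (Hmove u v Huv) as (Zu & Zv & Mu & Mv).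
    split; [|auto].
    apply pairing_orthonormal; [apply Hdet, In2, Huv|]. intros n m'.
    rewrite (square_constant u0 v0 r (fun u v => pairing (W 1%nat u v) (W 2%nat u v)
      (W 3%nat u v) (W 4%nat u v) (W 1%nat u v) (W 2%nat u v) (W 3%nat u v)
      (W 4%nat u v) n m') u v); [|intros s t Hst|exact Huv].
    + rewrite W1, W2, W3, W4. now apply orthonormal_pairing.
    + destruct (Hmove s t Hst) as (_ & _ & Ms & Mt).
      split; eapply moves_pairing; eassumption.
  - auto.
Qed.

(** * Existence and uniqueness of the surface *)

Theorem theorem5p1
  (D : R * R -> Prop) (HD : plane_domain D)
  (gamma1 gamma2 nu1 nu2 lambda mu beta1 beta2 : R -> R -> R)
  (Hgamma1 : smooth_on D gamma1) (Hgamma2 : smooth_on D gamma2)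
  (Hnu1 : smooth_on D nu1) (Hnu2 : smooth_on D nu2)
  (Hlambda : smooth_on D lambda) (Hmu : smooth_on D mu)
  (Hbeta1 : smooth_on D beta1) (Hbeta2 : smooth_on D beta2)
  (rE rG : R -> R -> R)
  (HrE : forall u v, D (u, v) ->
     rE u v = du mu u v /
       (2 * mu u v * gamma2 u v + nu1 u v * beta2 u v - lambda u v * beta1 u v))
  (HrG : forall u v, D (u, v) ->
     rG u v = dv mu u v /
       (2 * mu u v * gamma1 u v - lambda u v * beta2 u v + nu2 u v * beta1 u v))
  (HrE_pos : forall u v, D (u, v) ->
     2 * mu u v * gamma2 u v + nu1 u v * beta2 u v - lambda u v * beta1 u v <> 0
     /\ 0 < rE u v)
  (HrG_pos : forall u v, D (u, v) ->
     2 * mu u v * gamma1 u v - lambda u v * beta2 u v + nu2 u v * beta1 u v <> 0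
     /\ 0 < rG u v)
  (HEv : forall u v, D (u, v) -> - gamma1 u v * rE u v * rG u v = dv rE u v)
  (HGu : forall u v, D (u, v) -> - gamma2 u v * rE u v * rG u v = du rG u v)
  (HGauss : forall u v, D (u, v) ->
     nu1 u v * nu2 u v - lambda u v ^ 2 + mu u v ^ 2 =
       1 / rE u v * du gamma2 u v + 1 / rG u v * dv gamma1 u v
       - (gamma1 u v ^ 2 + gamma2 u v ^ 2))
  (HCodazzi1 : forall u v, D (u, v) ->
     2 * lambda u v * gamma2 u v - mu u v * beta1 u v
       - (nu1 u v - nu2 u v) * gamma1 u v =
       1 / rE u v * du lambda u v - 1 / rG u v * dv nu1 u v)
  (HCodazzi2 : forall u v, D (u, v) ->
     2 * lambda u v * gamma1 u v - mu u v * beta2 u v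
       + (nu1 u v - nu2 u v) * gamma2 u v =
       - (1 / rE u v) * du nu2 u v + 1 / rG u v * dv lambda u v)
  (HRicci : forall u v, D (u, v) ->
     gamma1 u v * beta1 u v - gamma2 u v * beta2 u v
       + (nu1 u v - nu2 u v) * mu u v =
       - (1 / rE u v) * du beta2 u v + 1 / rG u v * dv beta1 u v)
  (u0 v0 : R) (Hq0 : D (u0, v0))
  (Hnu_pos : 0 < nu1 u0 v0 + nu2 u0 v0)
  (p0 x0 y0 b0 l0 : R4)
  (Hframe : oriented_orthonormal x0 y0 b0 l0) :
  exists D0 : R * R -> Prop,
    plane_domain D0 /\ (forall q, D0 q -> D q) /\ D0 (u0, v0) /\
    exists z : R -> R -> R4,
      surface_with_data D0 u0 v0 p0 x0 y0 b0 l0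
        gamma1 gamma2 nu1 nu2 lambda mu beta1 beta2 z /\
      forall z' : R -> R -> R4,
        surface_with_data D0 u0 v0 p0 x0 y0 b0 l0
          gamma1 gamma2 nu1 nu2 lambda mu beta1 beta2 z' ->
        forall u v, D0 (u, v) -> z' u v = z u v.
Proof.
  destruct HD as (_ & HDo & _).
  set (dE := fun u v => 2 * mu u v * gamma2 u v + nu1 u v * beta2 u v
    - lambda u v * beta1 u v).
  set (dG := fun u v => 2 * mu u v * gamma1 u v - lambda u v * beta2 u v
    + nu2 u v * beta1 u v).
  assert (S2 : forall f, smooth_on D f -> smooth_on D (fun u v => 2 * f u v)).
  { intros f Hf. apply (smooth_mult D HDo (fun _ _ => 2)); [|exact Hf].
    exact (smooth_const D HDo 2). }
  assert (SrE : smooth_on D rE).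
  { apply (smooth_ext D HDo (fun u v => du mu u v / dE u v)).
    { intros u v Huv. symmetry. now apply HrE. }
    apply (smooth_div D HDo (du mu) dE).
    - intros u v Huv. now apply HrE_pos.
    - now apply smooth_du.
    - apply (smooth_minus D HDo (fun u v => 2 * mu u v * gamma2 u v + nu1 u v * beta2 u v)
        (fun u v => lambda u v * beta1 u v)); [|now apply smooth_mult].
      apply (smooth_plus D HDo (fun u v => 2 * mu u v * gamma2 u v)
        (fun u v => nu1 u v * beta2 u v)); [|now apply smooth_mult].
      apply (smooth_mult D HDo (fun u v => 2 * mu u v) gamma2); auto. }
  assert (SrG : smooth_on D rG).
  { apply (smooth_ext D HDo (fun u v => dv mu u v / dG u v)).
    { intros u v Huv. symmetry. now apply HrG. }
    apply (smooth_div D HDo (dv mu) dG).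
    - intros u v Huv. now apply HrG_pos.
    - now apply smooth_dv.
    - apply (smooth_plus D HDo (fun u v => 2 * mu u v * gamma1 u v - lambda u v * beta2 u v)
        (fun u v => nu2 u v * beta1 u v)); [|now apply smooth_mult].
      apply (smooth_minus D HDo (fun u v => 2 * mu u v * gamma1 u v)
        (fun u v => lambda u v * beta2 u v)); [|now apply smooth_mult].
      apply (smooth_mult D HDo (fun u v => 2 * mu u v) gamma1); auto. }
  assert (HEv' : forall u v, D (u, v) -> dv rE u v = - gamma1 u v * rE u v * rG u v)
    by (intros; symmetry; auto).
  assert (HGu' : forall u v, D (u, v) -> du rG u v = - gamma2 u v * rE u v * rG u v)
    by (intros; symmetry; auto).
  destruct (adapted_frame_local_existence D HDo rE rG gamma1 gamma2 nu1 nu2 lambda mu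
    beta1 beta2 u0 v0 p0 x0 y0 b0 l0)
    as (r1 & z & X & Y & B & L & Hr1 & Hin & Sz & SX & SY & HF & Ez & EX & EY & EB & EL);
    auto.
  { intros u v Huv. now apply HrE_pos. }
  { intros u v Huv. now apply HrG_pos. }
  { intros u v Huv. rewrite (HrE u v Huv), (HrG u v Huv).
    split; field; [apply (HrE_pos u v Huv)|apply (HrG_pos u v Huv)]. }
  destruct (continuity_2d_positive_near (fun u v => nu1 u v + nu2 u v) u0 v0)
    as (r2 & Hr2 & Hnu); [|exact Hnu_pos|].
  { apply (smooth_continuity D); [|exact Hq0]. now apply (smooth_plus D HDo). }
  set (r := Rmin r1 r2).
  assert (Hr : 0 < r) by now apply Rmin_pos.
  assert (In1 : forall p, square u0 v0 r p -> square u0 v0 r1 p)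
    by (intros p; apply square_le, Rmin_l).
  assert (In2 : forall p, square u0 v0 r p -> square u0 v0 r2 p)
    by (intros p; apply square_le, Rmin_r).
  assert (InD : forall p, square u0 v0 r p -> D p) by auto.
  assert (Hc := square_center u0 v0 r Hr).
  assert (HS := square_open u0 v0 r).
  assert (HF' : adapted_frame (square u0 v0 r) rE rG gamma1 gamma2 nu1 nu2 lambda mu
    beta1 beta2 z X Y B L) by (intros u v Huv; apply HF, In1, Huv).
  assert (Sz' := smooth4_on_subset _ _ z In1 Sz).
  assert (Hnu' : forall u v, square u0 v0 r (u, v) -> 0 < nu1 u v + nu2 u v) by auto.
  exists (square u0 v0 r).
  split; [now apply square_domain|]. split; [exact InD|]. split; [exact Hc|].
  exists z. split.
  - rewrite <- Ez, <- EX, <- EY, <- EB, <- EL.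
    apply (frame_surface_with_data (square u0 v0 r) HS rE rG); auto.
    + exact (smooth_on_subset _ _ rE InD SrE).
    + exact (smooth_on_subset _ _ rG InD SrG).
    + exact (smooth4_on_subset _ _ X In1 SX).
    + exact (smooth4_on_subset _ _ Y In1 SY).
    + intros u v Huv. now apply HrE_pos, InD.
    + intros u v Huv. now apply HrG_pos, InD.
  - intros z' (Tz & Tsp & Tpr & TH & Tp & (L' & TL) & (Tx & Ty & Tb & To)).
    assert (HF2 : adapted_frame (square u0 v0 r) rE rG gamma1 gamma2 nu1 nu2 lambda mu
      beta1 beta2 z' (frame_x z') (frame_y z') (frame_b z') L').
    { apply (surface_adapted_frame (square u0 v0 r) HS); auto.
      - exact (smooth_on_subset _ _ mu InD Hmu).
      - intros u v Huv. cbv zeta. split; [now apply HrE_pos, InD|now apply HrE, InD].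
      - intros u v Huv. cbv zeta. split; [now apply HrG_pos, InD|now apply HrG, InD]. }
    apply (adapted_frame_rigid u0 v0 r rE rG gamma1 gamma2 nu1 nu2 lambda mu beta1 beta2
      z X Y B L z' (frame_x z') (frame_y z') (frame_b z') L'); auto; try congruence.
    rewrite EL, (frame_timelike_cross _ _ _ _ To), Tx, Ty, Tb.
    apply frame_timelike_cross, (HF2 u0 v0 Hc).
Qed.
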